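(* Let $\mu$ be a finite positive Borel measure on $[0,1)$ which is a $1$-logarithmic $1$-Carleson measure, i.e. there is a constant $C_0>0$ such that $\mu([t,1))\log\frac{e}{1-t}\le C_0(1-t)$ for all $t\in[0,1)$. Then $$\|\mathcal{H}_\mu\|_e^{\mathcal{B}\to\mathcal{B}}\approx\|\mathcal{H}_\mu\|_e^{\mathcal{B}\to BMOA}\approx\limsup_{r\to1^-}\frac{\mu([r,1))\log\frac{e}{1-r}}{1-r},$$ where $A\approx B$ means that $C^{-1}B\le A\le CB$ for a constant $C>0$ independent of $\mu$.
   Context: $\mathbb{D}=\{z\in\mathbb{C}:|z|<1\}$ and $H(\mathbb{D})$ is the space of analytic functions on $\mathbb{D}$. The Bloch space $\mathcal{B}$ consists of all $f\in H(\mathbb{D})$ with $\|f\|_{\mathcal{B}}=\sup_{z\in\mathbb{D}}|f'(z)|(1-|z|^2)<\infty$; it is a Banach space with the norm $|f(0)|+\|f\|_{\mathcal{B}}$. $BMOA$ is the Banach space of all $f\in H(\mathbb{D})$ with $\|f\|_{BMOA}=|f(0)|+\sup_{a\in\mathbb{D}}\|f\circ\varphi_a-f(a)\|_{H^2}<\infty$, where $\varphi_a(z)=\frac{a-z}{1-\bar a z}$ and $H^2$ is the Hardy space. For a finite positive Borel measure $\mu$ on $[0,1)$ put $\mu_n=\int_{[0,1)}t^n\,d\mu(t)$, $n\ge 0$. The operator $\mathcal{H}_\mu$ acts on $f(z)=\sum_{k=0}^\infty a_kz^k\in H(\mathbb{D})$ by $$\mathcal{H}_\mu(f)(z)=\sum_{n=0}^\infty\Big(\sum_{k=0}^\infty\mu_{n+k}a_k\Big)z^n,$$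 whenever the right-hand side makes sense (the inner series converge) and defines an analytic function in $\mathbb{D}$. For $\mu$ a $1$-logarithmic $1$-Carleson measure, it is known that $\mathcal{H}_\mu$ is well defined and bounded from $\mathcal{B}$ to $BMOA$ (hence also from $\mathcal{B}$ to $\mathcal{B}$). The essential norm of a continuous linear operator $T:X\to Y$ between Banach spaces is $\|T\|_e^{X\to Y}=\inf\{\|T-K\|: K:X\to Y \text{ compact linear}\}$, where $\|\cdot\|$ is the operator norm. *)

(* Defs.v *)
From mathcomp Require Import all_boot all_order all_algebra.
From mathcomp Require Import all_classical all_reals all_analysis.
From mathcomp Require Import complex.

Set Implicit Arguments.
Unset Strict Implicit.
Unset Printing Implicit Defensive.

Import Order.TTheory GRing.Theory Num.Theory.
Import numFieldNormedType.Exports.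

Local Open Scope classical_set_scope.
Local Open Scope ring_scope.

(** [Cplx R] is [R[i]] packaged as a [numFieldType], so that it carries the
    topology and the complex derivative of MathComp-Analysis.  The generic norm
    [`|z|] takes values in [R[i]]; [cabs] is the same modulus with values
    in [R]. *)
Definition Cplx (R : realType) : numFieldType := R[i].

Definition cabs (R : realType) (z : Cplx R) : R := Normc.normc z.

Definition rtoC (R : realType) (x : R) : Cplx R := (x%:C)%C.

Definition unit_disc (R : realType) : set (Cplx R) := [set z | cabs z < 1].

(** * Linear spaces with a norm, compact operators, essential norm *)

(** A linear subspace of an ambient module, given by its carrier and its norm.
    The norm is extended-real valued because it is a supremum, which is finite
    exactly on the carrier for the spaces below; only its values on the carrier
    are meaningful. *)
Record nspace (K : numFieldType) (R : realType) (V : lmodType K) := NSpace {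
  carrier : set V ;
  nnorm : V -> \bar R }.

Section Operators.
Context {K : numFieldType} {R : realType} {V : lmodType K}.
Implicit Types (X Y : nspace R V) (T S : V -> V).

(** Operators [X -> Y] are represented by maps [V -> V], whose values outside
    the carrier of [X] are never used. *)
Definition linear_operator X Y S : Prop :=
  (forall f, carrier X f -> carrier Y (S f)) /\
  (forall (a : K) f g, carrier X f -> carrier X g ->
     S (a *: f + g) = a *: S f + S g).

Definition compact_operator X Y S : Prop :=
  forall (u : nat -> V) (M : R),
    (forall n, carrier X (u n) /\ (nnorm X (u n) <= M%:E)%E) ->
    exists (s : nat -> nat) (g : V),
      [/\ {homo s : m n / (m < n)%N},
          carrier Y g
        & (fun n => nnorm Y (S (u (s n)) - g)) @ \oo --> 0%E].

Definition opnorm X Y S : \bar R :=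
  ereal_sup [set nnorm Y (S f) |
             f in [set f | carrier X f /\ (nnorm X f <= 1)%E]].

Definition essential_norm X Y T : \bar R :=
  ereal_inf [set opnorm X Y (fun f => T f - S f) |
             S in [set S | linear_operator X Y S /\ compact_operator X Y S]].

End Operators.

(** * Analytic functions on the disc, the Bloch space and BMOA *)

Section Spaces.
Context {R : realType}.
Implicit Types (f g : Cplx R -> Cplx R) (a z : Cplx R).

(** Functions on the disc are represented by total functions extended by 0, so
    that equality of functions on the disc is Leibniz equality. *)
Definition analytic_disc : set (Cplx R -> Cplx R) :=
  [set f | (forall z, unit_disc z -> derivable f z 1) /\
           (forall z, ~ unit_disc z -> f z = 0)].

Definition bloch_seminorm f : \bar R :=
  ereal_sup [set (cabs (derive1 f z) * (1 - cabs z ^+ 2))%:E | z in @unit_disc R].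

Definition bloch : nspace R (Cplx R -> Cplx R) :=
  NSpace [set f | analytic_disc f /\ (bloch_seminorm f < +oo)%E]
         (fun f => ((cabs (f 0))%:E + bloch_seminorm f)%E).

Definition circle_point (r t : R) : Cplx R := ((r * cos t) +i* (r * sin t))%C.

Definition circle_mean2 g (r : R) : \bar R :=
  (((2 * pi : R)^-1)%:E *
   (\int[lebesgue_measure]_(t in `[0%R, (2 * pi)%R : R])
      (cabs (g (circle_point r t)) ^+ 2)%:E))%E.

Definition hardy2_norm g : \bar R :=
  ereal_sup [set sqrte (circle_mean2 g r) | r in `[0, 1[%classic].

Definition disc_aut a z : Cplx R := (a - z) / (1 - conjc a * z).

Definition bmoa_seminorm f : \bar R :=
  ereal_sup [set hardy2_norm (fun z => f (disc_aut a z) - f a)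
             | a in @unit_disc R].

Definition bmoa : nspace R (Cplx R -> Cplx R) :=
  NSpace [set f | analytic_disc f /\ (bmoa_seminorm f < +oo)%E]
         (fun f => ((cabs (f 0))%:E + bmoa_seminorm f)%E).

(** * The generalized Hilbert operator *)

Definition power_series_of f (c : nat -> Cplx R) : Prop :=
  forall z, unit_disc z -> series (fun k => c k * z ^+ k) @ \oo --> f z.

Definition taylor_coef f : nat -> Cplx R :=
  xget (fun=> 0) [set c | power_series_of f c].

Definition moment (mu : {measure set (measurableTypeR R) -> \bar R}) (n : nat) : R :=
  \int[mu]_(t in `[0, 1[) (t ^+ n).

(** The sums are the total limit operator, whose value is arbitrary when the
    series diverges; they converge whenever the Hilbert operator makes sense. *)
Definition hilbert_coef (mu : {measure set (measurableTypeR R) -> \bar R}) f (n : nat) : Cplx R :=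
  lim (series (fun k => rtoC (moment mu (n + k)) * taylor_coef f k) @ \oo).

Definition hilbert_op (mu : {measure set (measurableTypeR R) -> \bar R}) f : Cplx R -> Cplx R :=
  fun z => if cabs z < 1
           then lim (series (fun n => hilbert_coef mu f n * z ^+ n) @ \oo)
           else 0.

(** * Logarithmic Carleson measures *)

Definition log_carleson (mu : {measure set (measurableTypeR R) -> \bar R}) : Prop :=
  exists C0 : R, 0 < C0 /\
    forall t : R, 0 <= t < 1 ->
      (mu `[t, 1%R[%classic * (ln (expR 1 / (1 - t)))%:E <= (C0 * (1 - t))%:E)%E.

Definition carleson_limsup (mu : {measure set (measurableTypeR R) -> \bar R}) : \bar R :=
  limf_esup
    (fun r : R => mu `[r, 1%R[%classic * (ln (expR 1 / (1 - r)) / (1 - r))%:E)%E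
    (1 : R)^'-.

Definition comparable_with (C : R) (A B : \bar R) : Prop :=
  (C^-1%:E * B <= A)%E /\ (A <= C%:E * B)%E.

End Spaces.

(* Main.v *)
(* For f in the Bloch space, H_mu f (z) is the integral over [0, 1) of
   f(t) / (1 - t z) d mu(t).

   Upper bound. The part of this integral over [0, r) is approximated in BMOA by the
   finite-rank operators obtained by truncating both f and the kernel. For the part over
   [r, 1), composing with phi_a turns the kernel into a multiple of z / (1 - b z) with
   1 - |b|^2 = (1 - |a|^2) (1 - t^2) / |1 - t a|^2, and a quadratic estimate of the
   l^2 norm of the Taylor coefficients bounds its BMOA norm by a constant times the
   Carleson ratio on [r, 1), because |f(t)| is at most ||f|| log (e / (1 - t)).

   Lower bound. The polynomials u_N = 1/2 * sum of z^k / k over N <= k < N^2 have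
   Bloch norm at most 1, as do the sums of any u_N with disjoint blocks. Averages of such u_N
   therefore tend to 0, so a compact operator sends some of them to functions of small
   norm, whereas (H_mu u_N)'(r) is bounded below by the Carleson ratio at r
   when N^2 is about 1 / (2 (1 - r)).

   BMOA and Bloch norms are compared, and elements of both spaces expanded in power
   series, through Parseval's identity on circles and Cauchy's formula; the latter is
   obtained by Goursat's bisection carried out on the homotopy that contracts a circle to
   the point z. *)
Require Import Defs.
From mathcomp Require Import all_boot all_order all_algebra.
From mathcomp Require Import all_classical all_reals all_analysis.
From mathcomp Require Import measurable_realfun complex.
From mathcomp Require Import ring lra.
Import Order.TTheory GRing.Theory Num.Theory.
Import numFieldNormedType.Exports.
Local Open Scope classical_set_scope.
Local Open Scope ring_scope.
Set Implicit Arguments.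
Unset Strict Implicit.
Unset Printing Implicit Defensive.
Local Notation Re := complex.Re.
Local Notation Im := complex.Im.

(** Only two estimates carry constants: the limsup divided by 64 lies below the Bloch-to-Bloch
    essential norm, and 640 times the limsup lies above the Bloch-to-BMOA one. Since BMOA dominates
    Bloch with constant 1, they enclose both essential norms.

    The obstacle in the upper estimate is uniformity in a. The Taylor coefficients after composition
    with phi_a are integrals of beta_t b_t^n f(t). Testing their square sum against itself reduces
    it to the integral of |f(t)| |beta_t| / sqrt(1 - |b_t|^2), and a then enters only through sqrt(1
    - |a|^2) and the kernel log(e/(1-t)) / ((1 - t|a|) sqrt(1-t)). The integral of that kernel over
    [r, 1) is of order M / sqrt(1 - |a|), so the two factors cancel.

    In the lower estimate no weak topology is invoked: a compact operator is bounded on the partial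
    sums of the test functions, hence the averages of the images are small. The range N <= k < N^2
    is chosen because the sum of 1/k over it is of order log N, which recovers the logarithm in the
    Carleson ratio. *)

Lemma cvg_eq1 {T : Type} {U : topologicalType} (F : set_system T) (u v : T -> U) (l : U) :
  u =1 v -> u @ F --> l -> v @ F --> l.
Proof. by move=> /funext ->. Qed.

(** * Real-valued modulus and convergence of complex-valued maps *)

Section ComplexModulus.
Context {R : realType}.
Implicit Types (z w : Cplx R) (x y : R).

Lemma cnormE z : `|z| = rtoC (cabs z).
Proof. by []. Qed.

Lemma ReD z w : Re (z + w) = Re z + Re w. Proof. by case: z w => a b [c d]. Qed.
Lemma ImD z w : Im (z + w) = Im z + Im w. Proof. by case: z w => a b [c d]. Qed.
Lemma ReN z : Re (- z) = - Re z. Proof. by case: z. Qed.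
Lemma ImN z : Im (- z) = - Im z. Proof. by case: z. Qed.
Lemma ReB z w : Re (z - w) = Re z - Re w. Proof. by rewrite ReD ReN. Qed.
Lemma ImB z w : Im (z - w) = Im z - Im w. Proof. by rewrite ImD ImN. Qed.
Lemma ReM z w : Re (z * w) = Re z * Re w - Im z * Im w.
Proof. by case: z w => a b [c d]. Qed.
Lemma ImM z w : Im (z * w) = Re z * Im w + Im z * Re w.
Proof. by case: z w => a b [c d]. Qed.

Lemma cplx_eqP z w : Re z = Re w -> Im z = Im w -> z = w.
Proof. by case: z w => a b [c d] /= -> ->. Qed.

Lemma cabs_sqr z : cabs z ^+ 2 = Re z ^+ 2 + Im z ^+ 2.
Proof. by case: z => a b /=; rewrite sqr_sqrtr// addr_ge0// sqr_ge0. Qed.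

Lemma cabs_ge0 z : 0 <= cabs z. Proof. by case: z => a b; exact: sqrtr_ge0. Qed.
Lemma cabs0 : cabs (0 : Cplx R) = 0. Proof. exact: Normc.normc0. Qed.
Lemma cabs1 : cabs (1 : Cplx R) = 1. Proof. exact: Normc.normc1. Qed.
Lemma cabsN z : cabs (- z) = cabs z. Proof. by case: z => a b; rewrite /cabs /= !sqrrN. Qed.
Lemma cabsM z w : cabs (z * w) = cabs z * cabs w. Proof. exact: Normc.normcM. Qed.
Lemma cabsV z : cabs z^-1 = (cabs z)^-1. Proof. exact: Normc.normcV. Qed.
Lemma cabsD z w : cabs (z + w) <= cabs z + cabs w. Proof. exact: le_normcD. Qed.
Lemma cabsB z w : cabs (z - w) <= cabs z + cabs w.
Proof. by rewrite -(cabsN w) cabsD. Qed.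
Lemma cabsBC z w : cabs (z - w) = cabs (w - z).
Proof. by rewrite -cabsN opprB. Qed.
Lemma cabs_eq0 z : cabs z = 0 -> z = 0. Proof. exact: Normc.eq0_normc. Qed.
Lemma cabs_gt0 z : z != 0 -> 0 < cabs z.
Proof.
by move=> z0; rewrite lt_neqAle cabs_ge0 andbT; apply: contra z0 => /eqP/esym/cabs_eq0 ->.
Qed.
Lemma cabsX z n : cabs (z ^+ n) = cabs z ^+ n.
Proof. by elim: n => [|n IH]; rewrite ?expr0 ?cabs1// !exprS cabsM IH. Qed.
Lemma cabs_rtoC x : cabs (rtoC x) = `|x|.
Proof. by rewrite /cabs /= expr0n /= addr0 sqrtr_sqr. Qed.
Lemma cabs_conj z : cabs (conjc z) = cabs z.
Proof. by case: z => a b; rewrite /cabs /= sqrrN. Qed.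
Lemma cabs_le_sub z w : cabs z - cabs w <= cabs (z - w).
Proof. by rewrite lerBlDr -{1}(subrK w z) cabsD. Qed.

Lemma Re_le_cabs z : `|Re z| <= cabs z.
Proof. by rewrite -sqrtr_sqr; case: z => a b /=; rewrite ler_wsqrtr// lerDl sqr_ge0. Qed.
Lemma Im_le_cabs z : `|Im z| <= cabs z.
Proof. by rewrite -sqrtr_sqr; case: z => a b /=; rewrite ler_wsqrtr// lerDr sqr_ge0. Qed.
Lemma cabs_le_ReIm z : cabs z <= `|Re z| + `|Im z|.
Proof.
rewrite -(@ler_pXn2r _ 2)// ?nnegrE ?cabs_ge0 ?addr_ge0// cabs_sqr.
by rewrite sqrrD !real_normK ?num_real// lerD2r lerDl mulrn_wge0// mulr_ge0.
Qed.

Lemma cabs_sum (I : Type) (s : seq I) (P : pred I) (F : I -> Cplx R) :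
  cabs (\sum_(i <- s | P i) F i) <= \sum_(i <- s | P i) cabs (F i).
Proof.
elim/big_rec2: _ => [|i y z _ h]; first by rewrite cabs0.
by rewrite (le_trans (cabsD _ _))// lerD2l.
Qed.

Lemma rtoCD x y : rtoC (x + y) = rtoC x + rtoC y :> Cplx R. Proof. exact: raddfD. Qed.
Lemma rtoCB x y : rtoC (x - y) = rtoC x - rtoC y :> Cplx R. Proof. exact: raddfB. Qed.
Lemma rtoCM x y : rtoC (x * y) = rtoC x * rtoC y :> Cplx R. Proof. exact: rmorphM. Qed.
Lemma rtoCX x n : rtoC (x ^+ n) = rtoC x ^+ n :> Cplx R. Proof. exact: rmorphXn. Qed.
Lemma rtoCV x : rtoC x^-1 = (rtoC x)^-1 :> Cplx R. Proof. exact: fmorphV. Qed.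
Lemma rtoC1 : rtoC 1 = 1 :> Cplx R. Proof. by []. Qed.
Lemma rtoC0 : rtoC 0 = 0 :> Cplx R. Proof. by []. Qed.
Lemma rtoC_sum (I : Type) (s : seq I) (P : pred I) (F : I -> R) :
  rtoC (\sum_(i <- s | P i) F i) = \sum_(i <- s | P i) rtoC (F i) :> Cplx R.
Proof. exact: raddf_sum. Qed.

Lemma Re_rtoCM x z : Re (rtoC x * z) = x * Re z.
Proof. by rewrite ReM /= mul0r subr0. Qed.
Lemma Im_rtoCM x z : Im (rtoC x * z) = x * Im z.
Proof. by rewrite ImM /= mul0r addr0. Qed.

(* The unimodular rotation of [v] onto the positive real axis. *)
Lemma exists_rotation z : exists2 u : Cplx R, cabs u = 1 & u * z = rtoC (cabs z).
Proof.
have [->|z0] := eqVneq z 0; first by exists 1; rewrite ?cabs1// mulr0 cabs0.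
exists (rtoC (cabs z) * z^-1); last by rewrite mulfVK.
by rewrite cabsM cabsV cabs_rtoC ger0_norm ?cabs_ge0// divff// gt_eqF// cabs_gt0.
Qed.

Lemma mulJ_cabs z : z * conjc z = rtoC (cabs z ^+ 2).
Proof. by rewrite cabs_sqr; case: z => a b; apply: cplx_eqP => /=; ring. Qed.

(** The norm of [Cplx R] takes values in [R[i]], where a positive element has zero imaginary part.
    Every positive radius is therefore the image of a real one, and limits can be tested with
    [cabs]. *)
Lemma cvg_cplxP (T : Type) (F : set_system T) {FF : Filter F} (u : T -> Cplx R) (l : Cplx R) :
  (u @ F --> l) <-> (cabs (u x - l) @[x --> F] --> (0 : R)).
Proof.
split.
  move=> /cvgrPdist_lt h; apply/cvgrPdist_lt => e e0.
  have /h : (0 : Cplx R) < rtoC e by rewrite ltcR.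
  apply: filterS => x; rewrite cnormE ltcR => h'.
  by rewrite sub0r normrN ger0_norm ?cabs_ge0// cabsBC.
move=> /cvgrPdist_lt h; apply/cvgrPdist_lt => e e0.
have e0' : 0 < Re e by move: e0; rewrite ltcE => /andP[_].
have ee : e = rtoC (Re e).
  by case: e e0 {e0'} => a b; rewrite ltcE /= => /andP[/eqP -> _].
have := h _ e0'; apply: filterS => x.
by rewrite sub0r normrN ger0_norm ?cabs_ge0// cabsBC cnormE ee ltcR.
Qed.

Lemma cvg_Re (T : Type) (F : set_system T) {FF : Filter F} (u : T -> Cplx R) (l : Cplx R) :
  u @ F --> l -> Re (u x) @[x --> F] --> Re l.
Proof.
move=> /cvg_cplxP/cvgrPdist_lt h; apply/cvgrPdist_lt => e /h.
apply: filterS => x; rewrite sub0r normrN ger0_norm ?cabs_ge0//; apply: le_lt_trans.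
by rewrite distrC -ReB Re_le_cabs.
Qed.

Lemma cvg_Im (T : Type) (F : set_system T) {FF : Filter F} (u : T -> Cplx R) (l : Cplx R) :
  u @ F --> l -> Im (u x) @[x --> F] --> Im l.
Proof.
move=> /cvg_cplxP/cvgrPdist_lt h; apply/cvgrPdist_lt => e /h.
apply: filterS => x; rewrite sub0r normrN ger0_norm ?cabs_ge0//; apply: le_lt_trans.
by rewrite distrC -ImB Im_le_cabs.
Qed.

Lemma cvg_ReIm (T : Type) (F : set_system T) {FF : Filter F} (u : T -> Cplx R) (l : Cplx R) :
  Re (u x) @[x --> F] --> Re l -> Im (u x) @[x --> F] --> Im l -> u @ F --> l.
Proof.
move=> /cvgrPdist_lt hr /cvgrPdist_lt hi; apply/cvg_cplxP/cvgrPdist_lt => e e0.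
have e2 : 0 < e / 2 by rewrite divr_gt0.
apply: filterS2 (hr _ e2) (hi _ e2) => x h1 h2.
rewrite sub0r normrN ger0_norm ?cabs_ge0// (le_lt_trans (cabs_le_ReIm _))//.
by rewrite ReB ImB [`|Re _ - _|]distrC [`|Im _ - _|]distrC (splitr e) ltrD.
Qed.

Lemma cvg_cabs (T : Type) (F : set_system T) {FF : Filter F} (u : T -> Cplx R) (l : Cplx R) :
  u @ F --> l -> cabs (u x) @[x --> F] --> cabs l.
Proof.
move=> /cvg_cplxP/cvgrPdist_lt h; apply/cvgrPdist_lt => e /h.
apply: filterS => x; rewrite sub0r normrN ger0_norm ?cabs_ge0//; apply: le_lt_trans.
have h1 := cabs_le_sub l (u x); have h2 := cabs_le_sub (u x) l.
by rewrite cabsBC in h1; rewrite ler_norml; apply/andP; split; lra.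
Qed.

Lemma cvg_rtoC (T : Type) (F : set_system T) {FF : Filter F} (u : T -> R) (l : R) :
  u @ F --> l -> (rtoC (u x) : Cplx R) @[x --> F] --> (rtoC l : Cplx R).
Proof.
by move=> h; apply: cvg_ReIm => //=; exact: cvg_cst.
Qed.

Lemma cplx_cvg_unique (T : Type) (F : set_system T) {FF : ProperFilter F} (u : T -> Cplx R)
  (l l' : Cplx R) : u @ F --> l -> u @ F --> l' -> l = l'.
Proof.
move=> h h'; apply: cplx_eqP.
  exact: (cvg_unique (@Rhausdorff R) (cvg_Re h) (cvg_Re h')).
exact: (cvg_unique (@Rhausdorff R) (cvg_Im h) (cvg_Im h')).
Qed.

Lemma cplx_cvg_lim (T : Type) (F : set_system T) {FF : ProperFilter F} (u : T -> Cplx R)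
  (l : Cplx R) : u @ F --> l -> lim (u @ F) = l.
Proof.
by move=> h; apply: (cplx_cvg_unique (u := u)) (h); apply/cvg_ex; exists l.
Qed.

End ComplexModulus.

(** * Integrals of complex-valued functions *)

Section ComplexIntegral.
Context {d : measure_display} {T : measurableType d} {R : realType}.
Variable mu : {measure set T -> \bar R}.
Implicit Types (D : set T) (F G : T -> Cplx R) (g : T -> R) (c : Cplx R).

Definition cmeasurable D F : Prop :=
  measurable_fun D (fun x => Re (F x)) /\ measurable_fun D (fun x => Im (F x)).

Definition cintegrable D F : Prop :=
  mu.-integrable D (EFin \o (fun x => Re (F x))) /\
  mu.-integrable D (EFin \o (fun x => Im (F x))).

Definition cintegral D F : Cplx R :=
  ((\int[mu]_(x in D) Re (F x)) +i* (\int[mu]_(x in D) Im (F x)))%C.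

Lemma cmeasurableD D F G : cmeasurable D F -> cmeasurable D G ->
  cmeasurable D (fun x => F x + G x).
Proof.
move=> [F1 F2] [G1 G2]; split.
  by under eq_fun do rewrite ReD; exact: measurable_funD.
by under eq_fun do rewrite ImD; exact: measurable_funD.
Qed.

Lemma cmeasurableM D F G : cmeasurable D F -> cmeasurable D G ->
  cmeasurable D (fun x => F x * G x).
Proof.
move=> [F1 F2] [G1 G2]; split.
  under eq_fun do rewrite ReM.
  by apply: measurable_funB; exact: measurable_funM.
under eq_fun do rewrite ImM.
by apply: measurable_funD; exact: measurable_funM.
Qed.

Lemma cmeasurable_cst D c : cmeasurable D (fun=> c).
Proof. by split; exact: measurable_cst. Qed.

Lemma cmeasurable_rtoC D g : measurable_fun D g -> cmeasurable D (fun x => rtoC (g x)).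
Proof. by move=> mg; split => //=; exact: measurable_cst. Qed.

Lemma cmeasurable_sum D (I : Type) (s : seq I) (F : I -> T -> Cplx R) :
  (forall i, cmeasurable D (F i)) -> cmeasurable D (fun x => \sum_(i <- s) F i x).
Proof.
move=> mF; elim: s => [|i s IH].
  by under eq_fun do rewrite big_nil; exact: cmeasurable_cst.
by under eq_fun do rewrite big_cons; exact: cmeasurableD.
Qed.

Lemma cmeasurableX D F n : cmeasurable D F -> cmeasurable D (fun x => F x ^+ n).
Proof.
move=> mF; elim: n => [|n IH]; first by under eq_fun do rewrite expr0; exact: cmeasurable_cst.
by under eq_fun do rewrite exprS; exact: cmeasurableM.
Qed.

Lemma cmeasurable_cvg D (F : nat -> T -> Cplx R) G : (forall n, cmeasurable D (F n)) ->
  (forall x, D x -> (fun n => F n x) @ \oo --> G x) -> cmeasurable D G.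
Proof.
move=> mF FG; split.
  apply: (@measurable_fun_cvg _ _ _ _ (fun n x => Re (F n x))) => [n|x Dx]; first by case: (mF n).
  by apply: cvg_Re; exact: FG.
apply: (@measurable_fun_cvg _ _ _ _ (fun n x => Im (F n x))) => [n|x Dx]; first by case: (mF n).
by apply: cvg_Im; exact: FG.
Qed.

Lemma cintegrable_measurable D F : cintegrable D F -> cmeasurable D F.
Proof. by case=> /measurable_int/measurable_EFinP ? /measurable_int/measurable_EFinP. Qed.

Lemma eq_cintegral D F G : (forall x, D x -> F x = G x) -> cintegral D F = cintegral D G.
Proof.
move=> FG; rewrite /cintegral; congr (_ +i* _)%C;
  by apply: eq_Rintegral => x /set_mem Dx; rewrite FG.
Qed.

Lemma eq_cintegrable D F G : measurable D -> (forall x, D x -> F x = G x) ->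
  cintegrable D F -> cintegrable D G.
Proof.
move=> mD FG [F1 F2]; split.
  by apply: (eq_integrable mD _ _ _ F1) => x /set_mem Dx /=; rewrite FG.
by apply: (eq_integrable mD _ _ _ F2) => x /set_mem Dx /=; rewrite FG.
Qed.

Variable D : set T.
Hypothesis mD : measurable D.

Lemma cintegrable_le F g : cmeasurable D F ->
  mu.-integrable D (EFin \o g) -> (forall x, D x -> cabs (F x) <= g x) -> cintegrable D F.
Proof.
move=> [mR mI] ig Fg; split.
  apply: (le_integrable mD _ _ ig); first exact/measurable_EFinP.
  move=> x Dx /=; rewrite lee_fin (le_trans (Re_le_cabs _))// (le_trans (Fg _ Dx))//.
  exact: ler_norm.
apply: (le_integrable mD _ _ ig); first exact/measurable_EFinP.
move=> x Dx /=; rewrite lee_fin (le_trans (Im_le_cabs _))// (le_trans (Fg _ Dx))//.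
exact: ler_norm.
Qed.

Lemma cintegrable_cabs F : cintegrable D F ->
  exists2 g : T -> R, mu.-integrable D (EFin \o g) & forall x, D x -> cabs (F x) <= g x.
Proof.
move=> [iR iI]; exists (fun x => `|Re (F x)| + `|Im (F x)|).
  have : mu.-integrable D ((EFin \o (fun x => `|Re (F x)|)) \+ (EFin \o (fun x => `|Im (F x)|))).
    by apply: integrableD => //; [exact: (integrable_norm iR)|exact: (integrable_norm iI)].
  by [].
by move=> x _; exact: cabs_le_ReIm.
Qed.

Lemma cintegrableMl F (h : T -> Cplx R) B : cmeasurable D h -> cintegrable D F ->
  (forall x, D x -> cabs (h x) <= B) -> cintegrable D (fun x => h x * F x).
Proof.
move=> mh iF hB; have [g ig Fg] := cintegrable_cabs iF.
apply: (@cintegrable_le _ (fun x => B * g x)).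
- by apply: cmeasurableM => //; exact: cintegrable_measurable.
- by have := integrableZl mD B ig; exact: eq_integrable.
- move=> x Dx; rewrite cabsM ler_pM ?cabs_ge0//; [exact: hB|exact: Fg].
Qed.

Lemma cintegrableD F G : cintegrable D F -> cintegrable D G ->
  cintegrable D (fun x => F x + G x).
Proof.
move=> [F1 F2] [G1 G2]; split.
  have := integrableD mD F1 G1; apply: eq_integrable => // x _ /=.
  by rewrite ReD EFinD.
have := integrableD mD F2 G2; apply: eq_integrable => // x _ /=.
by rewrite ImD EFinD.
Qed.

Lemma cintegrableZ c F : cintegrable D F -> cintegrable D (fun x => c * F x).
Proof.
move=> iF; apply: (@cintegrableMl _ _ (cabs c)) => //; exact: cmeasurable_cst.
Qed.

Lemma cintegrable0 : cintegrable D (fun=> 0).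
Proof. by split; exact: integrable0. Qed.

Lemma cintegrableN F : cintegrable D F -> cintegrable D (fun x => - F x).
Proof.
move=> iF; apply: (eq_cintegrable mD _ (cintegrableZ (-1) iF)) => x _.
by rewrite mulN1r.
Qed.

Lemma cintegrableB F G : cintegrable D F -> cintegrable D G ->
  cintegrable D (fun x => F x - G x).
Proof. by move=> iF iG; apply: cintegrableD => //; exact: cintegrableN. Qed.

Lemma cintegrable_sum (I : Type) (s : seq I) (F : I -> T -> Cplx R) :
  (forall i, cintegrable D (F i)) -> cintegrable D (fun x => \sum_(i <- s) F i x).
Proof.
move=> iF; elim: s => [|i s IH].
  by apply: (eq_cintegrable mD _ cintegrable0) => x _; rewrite big_nil.
by apply: (eq_cintegrable mD _ (cintegrableD (iF i) IH)) => x _; rewrite big_cons.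
Qed.

Lemma cintegralD F G : cintegrable D F -> cintegrable D G ->
  cintegral D (fun x => F x + G x) = cintegral D F + cintegral D G.
Proof.
move=> [F1 F2] [G1 G2]; apply: cplx_eqP; rewrite ?ReD ?ImD /=.
  by rewrite -RintegralD//; apply: eq_Rintegral => x _; rewrite ReD.
by rewrite -RintegralD//; apply: eq_Rintegral => x _; rewrite ImD.
Qed.

Lemma cintegralZ c F : cintegrable D F ->
  cintegral D (fun x => c * F x) = c * cintegral D F.
Proof.
move=> [F1 F2].
have Z1 k : mu.-integrable D (EFin \o (fun x => k * Re (F x))).
  by have := integrableZl mD k F1; exact: eq_integrable.
have Z2 k : mu.-integrable D (EFin \o (fun x => k * Im (F x))).
  by have := integrableZl mD k F2; exact: eq_integrable.
apply: cplx_eqP; rewrite ?ReM ?ImM /=.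
  by rewrite -!RintegralZl// -RintegralB//; apply: eq_Rintegral => x _; rewrite ReM.
by rewrite -!RintegralZl// -RintegralD//; apply: eq_Rintegral => x _; rewrite ImM.
Qed.

Lemma cintegral0 : cintegral D (fun=> 0) = 0.
Proof.
transitivity (0 * cintegral D (fun=> 0)); last exact: mul0r.
by rewrite -(cintegralZ _ cintegrable0); apply: eq_cintegral => x _; rewrite mul0r.
Qed.

Lemma cintegralN F : cintegrable D F -> cintegral D (fun x => - F x) = - cintegral D F.
Proof.
by move=> iF; rewrite -mulN1r -cintegralZ//; apply: eq_cintegral => x _; rewrite mulN1r.
Qed.

Lemma cintegralB F G : cintegrable D F -> cintegrable D G ->
  cintegral D (fun x => F x - G x) = cintegral D F - cintegral D G.
Proof.
by move=> iF iG; rewrite cintegralD ?cintegralN//; exact: cintegrableN.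
Qed.

Lemma cintegral_sum (I : Type) (s : seq I) (F : I -> T -> Cplx R) :
  (forall i, cintegrable D (F i)) ->
  cintegral D (fun x => \sum_(i <- s) F i x) = \sum_(i <- s) cintegral D (F i).
Proof.
move=> iF; elim: s => [|i s IH].
  rewrite big_nil; transitivity (cintegral D (fun=> 0)); last exact: cintegral0.
  by apply: eq_cintegral => x _; rewrite big_nil.
rewrite big_cons -IH -cintegralD//; last exact: cintegrable_sum.
by apply: eq_cintegral => x _; rewrite big_cons.
Qed.

Lemma cintegral_rtoC g : cintegral D (fun x => rtoC (g x)) = rtoC (\int[mu]_(x in D) g x).
Proof.
apply: cplx_eqP => //=; rewrite /Rintegral integral0_eq//.
Qed.

(* Rotate the integral onto the positive axis, so that only its real part counts. *)
Lemma cabs_cintegral_le F g : cintegrable D F -> mu.-integrable D (EFin \o g) ->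
  (forall x, D x -> cabs (F x) <= g x) -> cabs (cintegral D F) <= \int[mu]_(x in D) g x.
Proof.
move=> iF ig Fg; have [u u1 uF] := exists_rotation (cintegral D F).
have -> : cabs (cintegral D F) = Re (rtoC (cabs (cintegral D F))) by [].
rewrite -uF -cintegralZ//=; apply: le_Rintegral => //.
  by have [] := cintegrableZ u iF.
move=> x Dx; rewrite (le_trans (ler_norm _))// (le_trans (Re_le_cabs _))//.
by rewrite cabsM u1 mul1r Fg.
Qed.

Lemma cintegral_dominated_cvg (F : nat -> T -> Cplx R) G g :
  (forall n, cmeasurable D (F n)) ->
  (forall x, D x -> (fun n => F n x) @ \oo --> G x) ->
  mu.-integrable D (EFin \o g) -> (forall n x, D x -> cabs (F n x) <= g x) ->
  cintegrable D G /\ (fun n => cintegral D (F n)) @ \oo --> cintegral D G.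
Proof.
move=> mF FG ig Fg.
have [mGR mGI] := cmeasurable_cvg mF FG.
have ae P : (forall x : T, P x) -> {ae mu, forall x, P x} by move=> h; exact: aeW.
have [|||||iR _ cR] := @dominated_convergence _ _ _ mu D mD
  (fun n x => (Re (F n x))%:E) (fun x => (Re (G x))%:E) (EFin \o g).
- by move=> n; apply/measurable_EFinP; case: (mF n).
- exact/measurable_EFinP.
- by apply: ae => x Dx; apply: cvg_EFin; [exact: nearW|apply: cvg_Re; exact: FG].
- exact: ig.
- by apply: ae => x n Dx; rewrite /= lee_fin (le_trans (Re_le_cabs _))// Fg.
have [|||||iI _ cI] := @dominated_convergence _ _ _ mu D mD
  (fun n x => (Im (F n x))%:E) (fun x => (Im (G x))%:E) (EFin \o g).
- by move=> n; apply/measurable_EFinP; case: (mF n).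
- exact/measurable_EFinP.
- by apply: ae => x Dx; apply: cvg_EFin; [exact: nearW|apply: cvg_Im; exact: FG].
- exact: ig.
- by apply: ae => x n Dx; rewrite /= lee_fin (le_trans (Im_le_cabs _))// Fg.
split; first by split.
apply: cvg_ReIm => /=.
  by apply: fine_cvg; rewrite fineK//; exact: integrable_fin_num.
by apply: fine_cvg; rewrite fineK//; exact: integrable_fin_num.
Qed.

(** The majorant bounds the partial sums of the moduli, not only the terms, so dominated convergence
    applies to the partial sums of the series. *)
Lemma cintegral_series (F : nat -> T -> Cplx R) G g :
  (forall n, cmeasurable D (F n)) ->
  (forall x, D x -> series (F^~ x) @ \oo --> G x) ->
  mu.-integrable D (EFin \o g) ->
  (forall n x, D x -> \sum_(0 <= k < n) cabs (F k x) <= g x) ->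
  [/\ cintegrable D G, forall n, cintegrable D (F n)
    & series (fun n => cintegral D (F n)) @ \oo --> cintegral D G].
Proof.
move=> mF FG ig Fg.
have iF n : cintegrable D (F n).
  apply: (cintegrable_le (mF n) ig) => x Dx.
  rewrite (le_trans _ (Fg n.+1 x Dx))// big_nat_recr//= lerDr sumr_ge0// => i _.
  exact: cabs_ge0.
have [||||h1 h2] := @cintegral_dominated_cvg (fun n x => series (F^~ x) n) G g.
- by move=> n; apply: cmeasurable_sum.
- exact: FG.
- exact: ig.
- by move=> n x Dx; rewrite (le_trans (cabs_sum _ _ _))// Fg.
split => //; apply: cvg_trans h2; apply: near_eq_cvg; apply: nearW => n /=.
by rewrite /series /= cintegral_sum.
Qed.

End ComplexIntegral.

(** * Power series on circles *)

Section CirclePoint.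
Context {R : realType}.
Implicit Types (r t x y : R) (n m : nat).
Local Notation leb := (@lebesgue_measure R).

Lemma integral_derivative (f F : R -> R) (a b : R) : a <= b ->
  (forall x, is_derive x 1 F (f x)) -> continuous f ->
  \int[leb]_(x in `[a, b]) f x = F b - F a.
Proof.
rewrite le_eqVlt => /predU1P[<-|ab] Ff cf.
  by rewrite set_itv1 Rintegral_set1 subrr.
have cF : continuous F.
  move=> x; apply/differentiable_continuous/derivable1_diffP.
  by have [] := Ff x.
rewrite /Rintegral (@continuous_FTC2 _ f F)//.
- exact: continuous_subspaceT.
- split; first by move=> x _; have [] := Ff x.
    exact/cvg_at_right_filter/cF.
  exact/cvg_at_left_filter/cF.
- by move=> x _; rewrite derive1E; have [] := Ff x.
Qed.

Lemma integrable_itv_cst (a b k : R) : leb.-integrable `[a, b] (EFin \o cst k).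
Proof.
apply: measurable_bounded_integrable => //=.
  by rewrite lebesgue_measure_itv; case: ifP => _; rewrite ?ltry// -EFinB ltry.
by exists `|k|; split => // y ky x _ /=; rewrite ltW.
Qed.

Lemma Rintegral_itv_cst (a b k : R) : a <= b -> \int[leb]_(x in `[a, b]) k = k * (b - a).
Proof.
move=> ab; rewrite Rintegral_cst//= lebesgue_measure_itv/= lte_fin.
move: ab; rewrite le_eqVlt => /predU1P[->|->]//=.
by rewrite ltxx subrr.
Qed.

Lemma circle_pointE r t : circle_point r t = rtoC r * circle_point 1 t.
Proof. by apply: cplx_eqP; rewrite ?Re_rtoCM ?Im_rtoCM /= !mul1r. Qed.

Lemma circle_point1X t n : circle_point 1 t ^+ n = circle_point 1 (n%:R * t).
Proof.
elim: n => [|n IH].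
  by rewrite expr0 mul0r /circle_point cos0 sin0 mulr1 mulr0.
rewrite exprS IH -natr1 mulrDl mul1r addrC.
by apply: cplx_eqP; rewrite ?ReM ?ImM /= !mul1r ?cosD ?sinD; ring.
Qed.

Lemma cabs_circle_point r t : cabs (circle_point r t) = `|r|.
Proof.
rewrite circle_pointE cabsM cabs_rtoC; suff -> : cabs (circle_point 1 t) = 1 by rewrite mulr1.
apply/eqP; rewrite -(@eqrXn2 _ 2)// ?cabs_ge0//.
by rewrite cabs_sqr expr1n /= !mul1r cos2Dsin2.
Qed.

Lemma circle_pointJ r t n :
  circle_point r t ^+ n * conjc (circle_point r t ^+ n) = rtoC (r ^+ (n * 2)).
Proof. by rewrite mulJ_cabs cabsX cabs_circle_point -exprM -normrX ger0_norm// exprM sqr_ge0. Qed.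

Lemma continuous_circle_Re r : continuous (fun t => Re (circle_point r t)).
Proof. by move=> t /=; apply: cvgM; [exact: cvg_cst|exact: continuous_cos]. Qed.

Lemma continuous_circle_Im r : continuous (fun t => Im (circle_point r t)).
Proof. by move=> t /=; apply: cvgM; [exact: cvg_cst|exact: continuous_sin]. Qed.

Lemma continuous_circle_point r : continuous (circle_point r : R -> Cplx R).
Proof.
move=> t; apply: cvg_ReIm; [exact: continuous_circle_Re|exact: continuous_circle_Im].
Qed.

Lemma cmeasurable_circle_point r (D : set R) :
  cmeasurable (D : set (measurableTypeR R)) (circle_point r).
Proof.
split; apply: measurable_funTS; apply: continuous_measurable_fun.
  exact: continuous_circle_Re.
exact: continuous_circle_Im.
Qed.

Lemma cmeasurable_conj (D : set (measurableTypeR R)) (F : R -> Cplx R) :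
  cmeasurable D F -> cmeasurable D (fun t => conjc (F t)).
Proof.
move=> [m1 m2]; split.
  by apply: (eq_measurable_fun _ _ m1) => t _ /=; case: (F t).
have := measurable_funN m2; apply: eq_measurable_fun => t _ /=.
by case: (F t).
Qed.

Lemma cintegrable_itv_bounded (a b B : R) (F : R -> Cplx R) :
  cmeasurable (`[a, b] : set (measurableTypeR R)) F ->
  (forall t, a <= t <= b -> cabs (F t) <= B) -> cintegrable leb `[a, b] F.
Proof.
move=> mF FB; apply: (cintegrable_le _ mF (integrable_itv_cst a b B)) => //.
Qed.

Lemma cabs_cintegral_itv_le (a b B : R) (F : R -> Cplx R) : a <= b ->
  cintegrable leb `[a, b] F ->
  (forall t, a <= t <= b -> cabs (F t) <= B) ->
  cabs (cintegral leb `[a, b] F) <= B * (b - a).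
Proof.
move=> ab iF FB; rewrite -(Rintegral_itv_cst _ ab).
apply: cabs_cintegral_le => //; exact: integrable_itv_cst.
Qed.

Lemma is_derive_sinM (k x : R) : is_derive x 1 (fun t => sin (k * t)) (k * cos (k * x)).
Proof.
have h : is_derive x 1 (fun t : R => k * t) k.
  by rewrite -[X in is_derive _ _ _ X]mulr1; exact: is_deriveZ.
by rewrite mulrC; have := is_derive1_comp (is_derive_sin (k * x)) h.
Qed.

Lemma is_derive_cosM (k x : R) : is_derive x 1 (fun t => cos (k * t)) (- (k * sin (k * x))).
Proof.
have h : is_derive x 1 (fun t : R => k * t) k.
  by rewrite -[X in is_derive _ _ _ X]mulr1; exact: is_deriveZ.
by rewrite mulrC -mulNr; have := is_derive1_comp (is_derive_cos (k * x)) h.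
Qed.

Lemma continuous_cosM (k : R) : continuous (fun t => cos (k * t)).
Proof. by move=> x; apply/differentiable_continuous/derivable1_diffP; have [] := is_derive_cosM k x. Qed.
Lemma continuous_sinM (k : R) : continuous (fun t => sin (k * t)).
Proof. by move=> x; apply/differentiable_continuous/derivable1_diffP; have [] := is_derive_sinM k x. Qed.

Lemma cos_sin_natM2pi n : cos (n%:R * (2 * pi)) = 1 :> R /\ sin (n%:R * (2 * pi)) = 0 :> R.
Proof.
elim: n => [|n [IHc IHs]]; first by rewrite mul0r sin0 cos0.
rewrite -natr1 mulrDl mul1r cosD sinD IHc IHs (mulr_natl pi 2) cos2pi sin2pi.
by rewrite !mulr0 mul1r !mul0r subr0 addr0.
Qed.

Lemma pi2_ge0 : 0 <= 2 * pi :> R. Proof. by rewrite mulr_ge0// pi_ge0. Qed.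
Lemma pi2_gt0 : 0 < 2 * pi :> R. Proof. by rewrite mulr_gt0// pi_gt0. Qed.

Lemma cintegral_circle_pointX n :
  cintegral leb `[0, 2 * pi] (fun t => circle_point 1 t ^+ n.+1) = 0.
Proof.
have n0 : n.+1%:R != 0 :> R by rewrite pnatr_eq0.
apply: cplx_eqP => /=.
  have h x : is_derive x 1 (fun t => n.+1%:R^-1 * sin (n.+1%:R * t)) (cos (n.+1%:R * x)).
    have := @is_deriveZ _ _ _ _ n.+1%:R^-1 _ _ _ (is_derive_sinM n.+1%:R x).
    by rewrite /GRing.scale /= mulrA mulVf// mul1r.
  under eq_Rintegral do rewrite circle_point1X /= mul1r.
  rewrite (integral_derivative pi2_ge0 h (@continuous_cosM _)).
  by rewrite (cos_sin_natM2pi _).2 !mulr0 sin0 mulr0 subrr.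
have h x : is_derive x 1 (fun t => - n.+1%:R^-1 * cos (n.+1%:R * t)) (sin (n.+1%:R * x)).
  have := @is_deriveZ _ _ _ _ (- n.+1%:R^-1) _ _ _ (is_derive_cosM n.+1%:R x).
  by rewrite /GRing.scale /= mulrNN mulrA mulVf// mul1r.
under eq_Rintegral do rewrite circle_point1X /= mul1r.
rewrite (integral_derivative pi2_ge0 h (@continuous_sinM _)).
by rewrite (cos_sin_natM2pi _).1 !mulr0 cos0 subrr.
Qed.

Lemma cintegral_circle_cst (c : Cplx R) : cintegral leb `[0, 2 * pi] (fun=> c) = rtoC (2 * pi) * c.
Proof.
apply: cplx_eqP; rewrite ?Re_rtoCM ?Im_rtoCM /= Rintegral_itv_cst ?pi2_ge0// subr0 mulrC//.
Qed.

Lemma cintegral_conj (D : set (measurableTypeR R)) (F : R -> Cplx R) : measurable D -> cintegrable leb D F ->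
  cintegral leb D (fun t => conjc (F t)) = conjc (cintegral leb D F).
Proof.
move=> mD [iR iI]; apply: cplx_eqP => /=.
  by apply: eq_Rintegral => t _; case: (F t).
rewrite -mulN1r -RintegralZl//; apply: eq_Rintegral => t _.
by case: (F t) => a b /=; rewrite mulN1r.
Qed.

Lemma conjcM (z w : Cplx R) : conjc (z * w) = conjc z * conjc w.
Proof. by case: z w => a b [c d]; apply: cplx_eqP => /=; ring. Qed.
Lemma conjcX (z : Cplx R) n : conjc (z ^+ n) = conjc z ^+ n.
Proof. by elim: n => [|n IH]; rewrite ?expr0 ?exprS ?conjcM ?IH//; exact: conjc1. Qed.
Lemma conjcD (z w : Cplx R) : conjc (z + w) = conjc z + conjc w.
Proof. by case: z w => a b [c d]; apply: cplx_eqP => /=; ring. Qed.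
Lemma conjc_sum (I : Type) (s : seq I) (F : I -> Cplx R) :
  conjc (\sum_(i <- s) F i) = \sum_(i <- s) conjc (F i).
Proof.
by elim: s => [|i s IH]; rewrite ?big_nil ?big_cons ?conjcD ?IH//; exact: conjc0.
Qed.
Lemma conjc_rtoC (x : R) : conjc (rtoC x) = rtoC x :> Cplx R.
Proof. exact: conjc_real. Qed.

Lemma cmeasurable_circle_pointX r n :
  cmeasurable (`[0, 2 * pi] : set (measurableTypeR R)) (fun t => circle_point r t ^+ n).
Proof. apply: cmeasurableX; exact: cmeasurable_circle_point. Qed.

(** For distinct exponents the common power contributes a constant and a positive power of the unit
    circle point remains, whose integral is 0. The case [n < m] is the conjugate of the other
    one. *)
Lemma cintegral_orthogonal r n m :
  cintegral leb `[0, 2 * pi] (fun t => circle_point r t ^+ n * conjc (circle_point r t ^+ m)) =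
  if n == m then rtoC (2 * pi * r ^+ (n * 2)) else 0.
Proof.
have int0 k : cintegrable leb `[0, 2 * pi] (fun t => circle_point 1 t ^+ k).
  apply: (@cintegrable_itv_bounded _ _ 1); first exact: cmeasurable_circle_pointX.
  by move=> t _; rewrite cabsX cabs_circle_point normr1 expr1n.
have key n' k : cintegral leb `[0, 2 * pi]
    (fun t => circle_point r t ^+ (n' + k.+1) * conjc (circle_point r t ^+ n')) = 0.
  transitivity (cintegral leb `[0, 2 * pi]
      (fun t => rtoC (r ^+ (n' * 2) * r ^+ k.+1) * circle_point 1 t ^+ k.+1)).
    apply: eq_cintegral => t _; rewrite exprD mulrAC circle_pointJ circle_pointE exprMn.
    by rewrite mulrA -rtoCX -rtoCM.
  by rewrite cintegralZ ?cintegral_circle_pointX ?mulr0.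
have int1 n' k : cintegrable leb `[0, 2 * pi] (fun t => circle_point r t ^+ k * conjc (circle_point r t ^+ n')).
  apply: (@cintegrable_itv_bounded _ _ (`|r| ^+ k * `|r| ^+ n')).
    apply: cmeasurableM; first exact: cmeasurable_circle_pointX.
    by apply: cmeasurable_conj; exact: cmeasurable_circle_pointX.
  by move=> t _; rewrite cabsM cabs_conj !cabsX cabs_circle_point.
case: ltngtP => [nm|mn|->].
- have -> : m = (n + (m - n).-1.+1)%N by rewrite prednK ?subn_gt0// subnKC// ltnW.
  set k := (m - n).-1.
  transitivity (conjc (cintegral leb `[0, 2 * pi]
     (fun t => circle_point r t ^+ (n + k.+1) * conjc (circle_point r t ^+ n)))).
    rewrite -cintegral_conj//; apply: eq_cintegral => t _.
    by rewrite conjcM conjcK mulrC.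
  by rewrite key; exact: conjc0.
- have -> : n = (m + (n - m).-1.+1)%N by rewrite prednK ?subn_gt0// subnKC// ltnW.
  exact: key.
- transitivity (cintegral leb `[0, 2 * pi] (fun=> rtoC (r ^+ (m * 2)) : Cplx R)).
    by apply: eq_cintegral => t _; rewrite circle_pointJ.
  by rewrite cintegral_circle_cst -rtoCM.
Qed.

End CirclePoint.

(** * Parseval's identity *)

Section Parseval.
Context {R : realType}.
Local Notation leb := (@lebesgue_measure R).

Lemma cintegral_trig_poly (c : nat -> Cplx R) (r : R) (N : nat) :
  let p t := \sum_(0 <= k < N) c k * circle_point r t ^+ k in
  cintegral leb `[0, 2 * pi] (fun t => p t * conjc (p t)) =
  rtoC (2 * pi * \sum_(0 <= k < N) cabs (c k) ^+ 2 * r ^+ (k * 2)).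
Proof.
move=> p.
have ic i j : cintegrable leb `[0, 2 * pi]
    (fun t => circle_point r t ^+ i * conjc (circle_point r t ^+ j)).
  apply: (@cintegrable_itv_bounded _ _ _ (`|r| ^+ i * `|r| ^+ j)).
    apply: cmeasurableM; first exact: cmeasurable_circle_pointX.
    by apply: cmeasurable_conj; exact: cmeasurable_circle_pointX.
  by move=> t _; rewrite cabsM cabs_conj !cabsX cabs_circle_point.
transitivity (cintegral leb `[0, 2 * pi] (fun t =>
    \sum_(0 <= i < N) \sum_(0 <= j < N) (c i * conjc (c j)) *
      (circle_point r t ^+ i * conjc (circle_point r t ^+ j)))).
  apply: eq_cintegral => t _; rewrite /p conjc_sum big_distrlr /=.
  apply: eq_bigr => i _; apply: eq_bigr => j _; rewrite conjcM; ring.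
rewrite cintegral_sum//; last first.
  by move=> i; apply: cintegrable_sum => // j; exact: cintegrableZ.
rewrite mulr_sumr rtoC_sum; apply: eq_big_nat => i /andP[_ iN].
rewrite cintegral_sum//; last by move=> j; exact: cintegrableZ.
under eq_bigr do rewrite cintegralZ// cintegral_orthogonal.
rewrite (bigD1_seq i)/= ?mem_index_iota ?iota_uniq//= eqxx big1.
  by rewrite addr0 mulJ_cabs -rtoCM; congr rtoC; ring.
by move=> j; rewrite eq_sym => /negbTE ->; rewrite mulr0.
Qed.

Lemma cabs_sqr_measurable (D : set (measurableTypeR R)) (F : R -> Cplx R) :
  cmeasurable D F -> measurable_fun D (fun t => cabs (F t) ^+ 2).
Proof.
move=> [m1 m2]; under eq_fun do rewrite cabs_sqr.
by apply: measurable_funD; exact: measurable_funX.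
Qed.

(** The bound [S] holds for all partial sums uniformly in [t], so the finite identity
    [cintegral_trig_poly] passes to the limit with the constant majorant [S ^ 2]. *)
Lemma parseval (c : nat -> Cplx R) (r S : R) (f : R -> Cplx R) :
  (forall N, \sum_(0 <= k < N) cabs (c k) * `|r| ^+ k <= S) ->
  (forall t, series (fun k => c k * circle_point r t ^+ k) @ \oo --> f t) ->
  [/\ cmeasurable (`[0, 2 * pi] : set (measurableTypeR R)) f,
      forall t, cabs (f t) <= S
    & (fun N => \sum_(0 <= k < N) cabs (c k) ^+ 2 * r ^+ (k * 2)) @ \oo -->
      (2 * pi)^-1 * \int[leb]_(t in `[0, 2 * pi]) (cabs (f t) ^+ 2)].
Proof.
move=> cS cf.
pose p N t := \sum_(0 <= k < N) c k * circle_point r t ^+ k.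
have mp N : cmeasurable (`[0, 2 * pi] : set (measurableTypeR R)) (p N).
  apply: cmeasurable_sum => k; apply: cmeasurableM; first exact: cmeasurable_cst.
  exact: cmeasurable_circle_pointX.
have pS N t : cabs (p N t) <= S.
  rewrite (le_trans (cabs_sum _ _ _))// (le_trans _ (cS N))// ler_sum// => k _.
  by rewrite cabsM cabsX cabs_circle_point.
have mf : cmeasurable (`[0, 2 * pi] : set (measurableTypeR R)) f.
  by apply: (cmeasurable_cvg mp) => t _; exact: cf.
have fS t : cabs (f t) <= S.
  apply: (cvgr_to_le (cvg_cabs (cf t))).
  by apply: nearW => N; exact: pS.
split => //.
have [|||||_] := @cintegral_dominated_cvg _ _ _ leb `[0, 2 * pi] _
  (fun N t => p N t * conjc (p N t)) (fun t => f t * conjc (f t)) (cst (S ^+ 2)).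
- by [].
- by move=> N; apply: cmeasurableM => //; exact: cmeasurable_conj.
- move=> t _; under eq_fun do rewrite mulJ_cabs; rewrite mulJ_cabs.
  apply: cvg_rtoC; under eq_fun do rewrite expr2; rewrite expr2.
  by apply: cvgM; exact: (cvg_cabs (cf t)).
- exact: integrable_itv_cst.
- move=> N t _; rewrite cabsM cabs_conj -expr2 ler_pXn2r ?nnegrE ?cabs_ge0//=.
  exact: le_trans (cabs_ge0 _) (pS N t).
under eq_fun do rewrite cintegral_trig_poly.
move=> /cvg_Re /= h.
have -> : \int[leb]_(t in `[0, 2 * pi]) (cabs (f t) ^+ 2) =
    \int[leb]_(t in `[0, 2 * pi]) Re (f t * conjc (f t)).
  by apply: eq_Rintegral => t _; rewrite mulJ_cabs.
apply: (cvg_eq1 _ (cvgM (cvg_cst (2 * pi : R)^-1) h)) => N; rewrite [LHS]mulKf//.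
by rewrite gt_eqF// pi2_gt0.
Qed.

Lemma integrable_cabs_sqr (S : R) (f : R -> Cplx R) :
  cmeasurable (`[0, 2 * pi] : set (measurableTypeR R)) f -> (forall t, cabs (f t) <= S) ->
  leb.-integrable `[0, 2 * pi] (EFin \o (fun t => cabs (f t) ^+ 2)).
Proof.
move=> mf fS; apply: (le_integrable _ _ _ (integrable_itv_cst 0 (2 * pi) (S ^+ 2))) => //.
  by apply/measurable_EFinP; exact: cabs_sqr_measurable.
move=> t _ /=; rewrite lee_fin ler_norml normrX real_normK ?num_real//.
have S0 := le_trans (cabs_ge0 _) (fS t).
have := sqr_ge0 S; have := sqr_ge0 (cabs (f t)).
have : cabs (f t) ^+ 2 <= S ^+ 2 by rewrite ler_pXn2r ?nnegrE ?cabs_ge0.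
by move=> *; apply/andP; split; lra.
Qed.

Lemma circle_mean2_Rintegral (S r : R) (g : Cplx R -> Cplx R) :
  cmeasurable (`[0, 2 * pi] : set (measurableTypeR R)) (fun t => g (circle_point r t)) ->
  (forall t, cabs (g (circle_point r t)) <= S) ->
  circle_mean2 g r = ((2 * pi)^-1 *
    \int[leb]_(t in `[0, 2 * pi]) (cabs (g (circle_point r t)) ^+ 2))%:E.
Proof.
move=> mg gS; rewrite /circle_mean2 EFinM; congr (_ * _)%E.
rewrite /Rintegral fineK//; apply: integrable_fin_num => //.
exact: (integrable_cabs_sqr mg gS).
Qed.

End Parseval.

(** * Absolute convergence and uniqueness of power series *)

Lemma geometric_sum (F : fieldType) (x : F) N : 1 - x != 0 ->
  \sum_(0 <= k < N) x ^+ k = (1 - x)^-1 * (1 - x ^+ N).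
Proof.
move=> x1; apply: (mulfI x1); rewrite mulVKf// big_mkord.
by rewrite -[RHS]opprB subrX1 -mulNr opprB.
Qed.

Section PowerSeries.
Context {R : realType}.
Implicit Types (c : nat -> Cplx R) (r s : R) (z : Cplx R).

Lemma pseries_terms_bounded c (r : R) (l : Cplx R) :
  series (fun k => c k * rtoC r ^+ k) @ \oo --> l ->
  exists2 B, 0 < B & forall k, cabs (c k) * `|r| ^+ k <= B.
Proof.
move=> h; have c0 : [series c k * rtoC r ^+ k]_k n.+1 - [series c k * rtoC r ^+ k]_k n @[n --> \oo] --> (0 : Cplx R).
  rewrite -(subrr l); apply: cvgB => //.
  by move: h; rewrite -(cvg_shiftS (series _)).
have {}c0 : (fun n => cabs (c n) * `|r| ^+ n) @ \oo --> (0 : R).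
  rewrite -[X in _ --> X]cabs0; apply: (cvg_eq1 _ (cvg_cabs c0)) => n.
  by rewrite /series /= big_nat_recr//= addrAC subrr add0r cabsM cabsX cabs_rtoC.
have /cvg_seq_bounded[B [_ hB]] : cvgn (fun n => cabs (c n) * `|r| ^+ n) by apply/cvg_ex; exists 0.
exists (`|B| + 1); first by rewrite ltr_pwDr.
move=> k; apply: le_trans (ler_norm _) _; apply: hB => //.
by rewrite (le_lt_trans (ler_norm B))// ltrDl.
Qed.

Lemma sum_geometric_le (x : R) N : 0 <= x < 1 -> \sum_(0 <= k < N) x ^+ k <= (1 - x)^-1.
Proof.
move=> /andP[x0 x1]; have x10 : 0 < 1 - x by rewrite subr_gt0.
rewrite -(@ler_pM2l _ (1 - x))// mulfV ?gt_eqF//.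
have -> : (1 - x) * \sum_(0 <= k < N) x ^+ k = 1 - x ^+ N.
  by rewrite big_mkord -opprB mulNr -subrX1 opprB.
by rewrite lerBlDr lerDl exprn_ge0.
Qed.

Lemma pseries_abs_bounded c (s r : R) (B : R) :
  0 <= s < r -> (forall k, cabs (c k) * r ^+ k <= B) ->
  forall N, \sum_(0 <= k < N) cabs (c k) * s ^+ k <= B * (1 - s / r)^-1.
Proof.
move=> /andP[s0 sr] cB N; have r0 : 0 < r by exact: le_lt_trans sr.
have B0 : 0 <= B by rewrite (le_trans _ (cB 0%N))// expr0 mulr1 cabs_ge0.
apply: (@le_trans _ _ (\sum_(0 <= k < N) B * (s / r) ^+ k)).
  apply: ler_sum => k _; rewrite expr_div_n mulrA ler_pdivlMr ?exprn_gt0//.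
  by rewrite mulrAC ler_wpM2r ?exprn_ge0.
rewrite -mulr_sumr ler_wpM2l// sum_geometric_le//.
by rewrite divr_ge0 ?(ltW r0)//= ltr_pdivrMr// mul1r.
Qed.

(** By Parseval on a small circle the sums of [|c k|^2 r^(2k)] tend to the mean of the zero
    function; their terms are nonnegative, so all of them vanish. *)
Lemma pseries_eq0 c (e : R) : 0 < e ->
  (forall z, cabs z < e -> series (fun k => c k * z ^+ k) @ \oo --> (0 : Cplx R)) ->
  forall k, c k = 0.
Proof.
move=> e0 h.
have e2 : 0 < e / 2 by rewrite divr_gt0.
have /h/pseries_terms_bounded[B B0 hB] : cabs (rtoC (e / 2)) < e.
  by rewrite cabs_rtoC gtr0_norm// ltr_pdivrMr// ltr_pMr// ltr1n.
(* Convergence at radius [e / 2] bounds the terms there; the smaller radius [e / 4] then has the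
   absolute convergence that [parseval] asks for. *)
have e4 : 0 < e / 4 by rewrite divr_gt0.
have cS N : \sum_(0 <= k < N) cabs (c k) * `|e / 4| ^+ k <= B * (1 - (e / 4) / (e / 2))^-1.
  rewrite gtr0_norm//; apply: pseries_abs_bounded; first by apply/andP; split; lra.
  by move=> k; have := hB k; rewrite gtr0_norm.
have [|_ _] := @parseval _ c (e / 4) _ (fun=> 0) cS.
  by move=> t; apply: h; rewrite cabs_circle_point gtr0_norm//; lra.
under eq_Rintegral do rewrite cabs0 expr0n /=.
rewrite Rintegral_itv_cst ?pi2_ge0// mul0r mulr0 => lim0 k.
have : cabs (c k) ^+ 2 * (e / 4) ^+ (k * 2) <= 0.
  apply: (cvgr_to_ge lim0).
  exists k.+1 => // n /= kn; rewrite (bigD1_seq k)/= ?mem_index_iota ?iota_uniq//=.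
  by rewrite lerDl sumr_ge0// => i _; rewrite mulr_ge0 ?sqr_ge0// exprn_ge0// ltW.
rewrite pmulr_lle0 ?exprn_gt0// => h0; apply/cabs_eq0/eqP.
by rewrite -(@sqrf_eq0 R) eq_le h0 sqr_ge0.
Qed.

Lemma pseries_unique c c' (f : Cplx R -> Cplx R) (e : R) : 0 < e ->
  (forall z, cabs z < e -> series (fun k => c k * z ^+ k) @ \oo --> f z) ->
  (forall z, cabs z < e -> series (fun k => c' k * z ^+ k) @ \oo --> f z) ->
  c = c'.
Proof.
move=> e0 h h'; apply/funext => k; apply: subr0_eq.
suff cc z : cabs z < e -> series (fun k => (c k - c' k) * z ^+ k) @ \oo --> (0 : Cplx R).
  exact: (pseries_eq0 e0 cc).
move=> ze; suff : series (fun k => (c k - c' k) * z ^+ k) @ \oo --> f z - f z by rewrite subrr.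
apply: (cvg_eq1 _ (cvgB (h z ze) (h' z ze))) => n.
transitivity (\sum_(0 <= i < n) c i * z ^+ i - \sum_(0 <= i < n) c' i * z ^+ i) => //.
by rewrite -sumrB; apply: eq_bigr => i _; rewrite mulrBl.
Qed.

End PowerSeries.

(** * Complex derivatives and Goursat's bisection *)

Section ComplexDerivative.
Context {R : realType}.
Implicit Types (f g : Cplx R -> Cplx R) (z w : Cplx R).

(** A first-order expansion with real moduli and no quotient: [w = z] is not exceptional, and
    remainder estimates can be used as they stand. *)
Definition has_cderiv f z (a : Cplx R) : Prop := forall e : R, 0 < e ->
  exists2 dl : R, 0 < dl & forall w, cabs (w - z) < dl ->
    cabs (f w - f z - a * (w - z)) <= e * cabs (w - z).

Lemma nbhs_cabsP z (P : set (Cplx R)) :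
  nbhs z P <-> exists2 dl : R, 0 < dl & forall w, cabs (w - z) < dl -> P w.
Proof.
split.
  move=> /nbhs_ballP[e /= e0 h]; exists (Re e); first by move: e0; rewrite ltcE => /andP[].
  move=> w wz; apply: h; rewrite -ball_normE /= cnormE cabsBC.
  have -> : e = rtoC (Re e).
    by case: e e0 {wz} => a b; rewrite ltcE /= => /andP[/eqP -> _].
  by rewrite ltcR.
move=> [dl d0 h]; apply/nbhs_ballP; exists (rtoC dl); first by rewrite /= ltcR.
by move=> w; rewrite -ball_normE /= cnormE cabsBC ltcR => /h.
Qed.

Lemma derivable_quotient f z :
  derivable f z 1 = cvg ((fun h : Cplx R => h^-1 *: (f (h + z) - f z)) @ 0^').
Proof.
rewrite /derivable.
suff -> : (fun h : Cplx R => h^-1 *: ((f \o shift z) (h *: 1) - f z)) =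
  (fun h => h^-1 *: (f (h + z) - f z)) by [].
by apply/funext => h /=; rewrite /GRing.scale /= mulr1.
Qed.

Lemma derivable_has_cderiv f z : derivable f z 1 -> has_cderiv f z (derive1 f z).
Proof.
rewrite derivable_quotient => df e e0.
have /cvg_cplxP/cvgrPdist_le/(_ _ e0) : (fun h : Cplx R => h^-1 *: (f (h + z) - f z)) @ 0^' --> derive1 f z.
  by [].
rewrite near_withinE => /nbhs_cabsP[dl d0 h]; exists dl => // w wz.
have [->|wz0] := eqVneq w z; first by rewrite !subrr mulr0 subr0 cabs0 mulr0.
have wz0' : w - z != 0 by rewrite subr_eq0.
have := h (w - z); rewrite subr0 => /(_ wz wz0').
rewrite subrK sub0r normrN ger0_norm ?cabs_ge0// => h1.
rewrite -ler_pdivrMr ?cabs_gt0// -cabsV -cabsM; apply: le_trans h1.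
rewrite le_eqVlt; apply/orP; left; apply/eqP; congr cabs.
rewrite /GRing.scale /= mulrBl mulfK//; congr (_ - _); exact: mulrC.
Qed.

Lemma has_cderivP f z a : has_cderiv f z a -> derivable f z 1 /\ derive1 f z = a.
Proof.
move=> h.
have hc : (fun k : Cplx R => k^-1 *: (f (k + z) - f z)) @ 0^' --> a.
  apply/cvg_cplxP/cvgrPdist_le => e e0; have [dl d0 hd] := h e e0.
  rewrite near_withinE; apply/nbhs_cabsP; exists dl => // k; rewrite subr0 => kd k0.
  rewrite sub0r normrN ger0_norm ?cabs_ge0//.
  have := hd (k + z); rewrite addrK => /(_ kd) h1.
  rewrite -(@ler_pM2r _ (cabs k)) ?cabs_gt0// -cabsM; apply: le_trans h1.
  rewrite le_eqVlt; apply/orP; left; apply/eqP; congr cabs.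
  by rewrite /GRing.scale /= mulrBl mulrAC mulVf// mul1r.
split; last exact: cplx_cvg_lim.
by rewrite derivable_quotient; apply/cvg_ex; exists a.
Qed.

Lemma has_cderiv_continuous f z a : has_cderiv f z a -> {for z, continuous f}.
Proof.
move=> /has_cderivP[df _]; apply: differentiable_continuous.
exact/derivable1_diffP.
Qed.

End ComplexDerivative.

Section Bisection.
Context {R : realType}.

(** Goursat's argument for an arbitrary function of rectangles that is additive under cuts in both
    directions. After [n] steps some subrectangle keeps at least the fraction [4^-n] of the modulus,
    while the square of its size is [4^-n] of the original one; a local bound with a small constant
    at the common point of these rectangles is then contradictory. *)
Lemma rectangle_bisection (I : R -> R -> R -> R -> Cplx R) (a b c d : R) :
  a <= b -> c <= d ->
  (forall x m y s t, a <= x -> x <= m -> m <= y -> y <= b -> c <= s -> s <= t -> t <= d ->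
     I x y s t = I x m s t + I m y s t) ->
  (forall x y s m t, a <= x -> x <= y -> y <= b -> c <= s -> s <= m -> m <= t -> t <= d ->
     I x y s t = I x y s m + I x y m t) ->
  (forall p q e : R, a <= p <= b -> c <= q <= d -> 0 < e ->
     exists2 dl : R, 0 < dl & forall x y s t, a <= x -> x <= p -> p <= y -> y <= b ->
       c <= s -> s <= q -> q <= t -> t <= d -> y - x < dl -> t - s < dl ->
       cabs (I x y s t) <= e * ((y - x) + (t - s)) ^+ 2) ->
  I a b c d = 0.
Proof.
move=> ab cd add1 add2 loc.
pose J (Q : (R * R) * (R * R)) := cabs (I Q.1.1 Q.1.2 Q.2.1 Q.2.2).
pose ok (Q : (R * R) * (R * R)) :=
  [/\ a <= Q.1.1, Q.1.1 <= Q.1.2, Q.1.2 <= b & [/\ c <= Q.2.1, Q.2.1 <= Q.2.2 & Q.2.2 <= d]].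
pose half (Q Q' : (R * R) * (R * R)) := [/\ ok Q',
  Q.1.1 <= Q'.1.1 /\ Q'.1.2 <= Q.1.2, Q.2.1 <= Q'.2.1 /\ Q'.2.2 <= Q.2.2,
  Q'.1.2 - Q'.1.1 = (Q.1.2 - Q.1.1) / 2 /\ Q'.2.2 - Q'.2.1 = (Q.2.2 - Q.2.1) / 2
  & J Q <= 4 * J Q'].
(* [F] selects a quarter that carries at least a fourth of the modulus. On arguments that are not
   [ok] it may take any value. *)
have /choice[F hF] : forall Q, exists Q', ok Q -> half Q Q'.
  move=> [[x y] [s t]]; set m := (x + y) / 2; set k := (s + t) / 2.
  have [okQ|] := pselect (ok ((x, y), (s, t))); last by exists ((x, y), (s, t)).
  case: (okQ) => /= ax xy yb [cs st td].
  have xm : x <= m by rewrite /m; lra.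
  have my : m <= y by rewrite /m; lra.
  have sk : s <= k by rewrite /k; lra.
  have kt : k <= t by rewrite /k; lra.
  have am := le_trans ax xm; have mb := le_trans my yb.
  have ck := le_trans cs sk; have kd := le_trans kt td.
  have mx : m - x = (y - x) / 2 by rewrite /m; field.
  have ym : y - m = (y - x) / 2 by rewrite /m; field.
  have ks : k - s = (t - s) / 2 by rewrite /k; field.
  have tk : t - k = (t - s) / 2 by rewrite /k; field.
  have E : J ((x, y), (s, t)) <= J ((x, m), (s, k)) + J ((x, m), (k, t)) +
      (J ((m, y), (s, k)) + J ((m, y), (k, t))).
    rewrite /J /= (add1 x m y s t)// (add2 x m s k t)//.
    rewrite (add2 m y s k t)//.
    by rewrite (le_trans (cabsD _ _))// lerD// cabsD.
  have [h1|h1] := leP (J ((x, y), (s, t))) (4 * J ((x, m), (s, k))).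
    by exists ((x, m), (s, k)) => _; do !split => //=.
  have [h2|h2] := leP (J ((x, y), (s, t))) (4 * J ((x, m), (k, t))).
    by exists ((x, m), (k, t)) => _; do !split => //=.
  have [h3|h3] := leP (J ((x, y), (s, t))) (4 * J ((m, y), (s, k))).
    by exists ((m, y), (s, k)) => _; do !split => //=.
  exists ((m, y), (k, t)) => _; do !split => //=.
  by move: E h1 h2 h3; move: (J _) (J _) (J _) (J _) (J _) => *; lra.
pose Q n := iter n F ((a, b), (c, d)).
have okQ n : ok (Q n).
  by elim: n => [|n IH]; [rewrite /ok /= !lexx|have [] := hF _ IH].
have hQ n : half (Q n) (Q n.+1) by apply: hF; exact: okQ.
have mono1 m n : (m <= n)%N -> (Q m).1.1 <= (Q n).1.1 /\ (Q n).1.2 <= (Q m).1.2.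
  move=> mn; rewrite -(subnK mn); elim: (n - m)%N => [//|k [IH1 IH2]].
  have [_ [h1 h2] _ _ _] := hQ (k + m)%N; rewrite addSn; split.
    exact: le_trans h1.
  exact: le_trans IH2.
have mono2 m n : (m <= n)%N -> (Q m).2.1 <= (Q n).2.1 /\ (Q n).2.2 <= (Q m).2.2.
  move=> mn; rewrite -(subnK mn); elim: (n - m)%N => [//|k [IH1 IH2]].
  have [_ _ [h1 h2] _ _] := hQ (k + m)%N; rewrite addSn; split.
    exact: le_trans h1.
  exact: le_trans IH2.
have le1 m n : (Q m).1.1 <= (Q n).1.2.
  have [mn|/ltnW nm] := leqP m n.
    by rewrite (le_trans (mono1 _ _ mn).1)//; have [] := okQ n.
  by rewrite (le_trans _ (mono1 _ _ nm).2)//; have [] := okQ m.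
have le2 m n : (Q m).2.1 <= (Q n).2.2.
  have [mn|/ltnW nm] := leqP m n.
    by rewrite (le_trans (mono2 _ _ mn).1)//; have [_ _ _ []] := okQ n.
  by rewrite (le_trans _ (mono2 _ _ nm).2)//; have [_ _ _ []] := okQ m.
have sup1 (u v : nat -> R) : (forall m n, u m <= v n) ->
    forall n, u n <= sup (range u) <= v n.
  move=> uv n; have ub k : ubound (range u) (v k) by move=> _ [m _ <-].
  apply/andP; split.
    by apply: ub_le_sup; [exists (v n)|exists n].
  by apply: ge_sup => //; exists (u n), n.
(* The rectangles are nested, so the suprema of their left and lower ends give a point lying in all
   of them. *)
have hp := sup1 (fun n => (Q n).1.1) (fun n => (Q n).1.2) le1.
have hq := sup1 (fun n => (Q n).2.1) (fun n => (Q n).2.2) le2.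
set p := sup _ in hp; set q := sup _ in hq.
have len n : (Q n).1.2 - (Q n).1.1 = (b - a) / 2 ^+ n /\
    (Q n).2.2 - (Q n).2.1 = (d - c) / 2 ^+ n.
  elim: n => [|n [IH1 IH2]]; first by rewrite expr0 !divr1.
  by have [_ _ _ [-> ->] _] := hQ n; rewrite IH1 IH2 exprSr invfM !mulrA.
have JQ n : J ((a, b), (c, d)) <= 4 ^+ n * J (Q n).
  elim: n => [|n IH]; first by rewrite expr0 mul1r.
  rewrite (le_trans IH)// exprSr -mulrA ler_wpM2l ?exprn_ge0//.
  by have [] := hQ n.
apply: cabs_eq0; apply/eqP; rewrite eq_le cabs_ge0 andbT leNgt; apply/negP => J0.
set eta := cabs (I a b c d) in J0.
set L := ((b - a) + (d - c)) ^+ 2.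
have L0 : 0 <= L by exact: sqr_ge0.
(* With [L + 1] in place of [L] the tolerance makes sense for [L = 0], and [eta * L / (L + 1)] is
   strictly below [eta]. *)
have e0 : 0 < eta / (L + 1) by rewrite divr_gt0// ltr_wpDl.
have [dl d0 hdl] := loc p q _ (hp 0%N) (hq 0%N) e0.
have [n hn] : exists n, (b - a) / 2 ^+ n < dl /\ (d - c) / 2 ^+ n < dl.
  have cv (k : R) : (fun n => k / 2 ^+ n) @ \oo --> (0 : R).
    rewrite -(mulr0 k); apply: cvgM; first exact: cvg_cst.
    apply: (cvg_eq1 (u := fun n => (2^-1 : R) ^+ n)) => [n|]; first by rewrite exprVn.
    by apply: cvg_expr; rewrite ger0_norm ?invr_ge0// invf_lt1// ltr1n.
  have h1 : \forall n \near \oo, (b - a) / 2 ^+ n < dl by exact: cvgr_lt (cv (b - a)) _ d0.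
  have h2 : \forall n \near \oo, (d - c) / 2 ^+ n < dl by exact: cvgr_lt (cv (d - c)) _ d0.
  by have [n _ /(_ n (leqnn n))] := filterI h1 h2; exists n.
have [ax xy yb [cs st td]] := okQ n.
have /andP[xp py] := hp n; have /andP[sq qt] := hq n.
have := hdl _ _ _ _ ax xp py yb cs sq qt td.
rewrite (len n).1 (len n).2 => /(_ hn.1 hn.2) h.
have := JQ n; rewrite /J /= -/eta => h'.
have : eta <= eta / (L + 1) * L.
  apply: le_trans h' _; rewrite mulrC -ler_pdivlMr ?exprn_gt0//; apply: le_trans h _.
  rewrite -mulrDl expr_div_n -/L -exprM mulnC exprM.
  by have -> : (2 : R) ^+ 2 = 4 by [rewrite expr2 -natrM]; rewrite mulrA.
rewrite leNgt => /negP; apply.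
by rewrite -mulrA -[ltRHS]mulr1 ltr_pM2l// mulrC ltr_pdivrMr ?ltr_wpDl// mul1r ltrDl.
Qed.

End Bisection.

(** * Cauchy's formula and Taylor expansion *)

Section IntervalIntegral.
Context {R : realType}.
Local Notation leb := (@lebesgue_measure R).
Implicit Types (F : R -> Cplx R) (a b m : R).

Lemma cintegrable_continuous F a b :
  (forall t, a <= t <= b -> {for t, continuous F}) -> cintegrable leb `[a, b] F.
Proof.
move=> cF; split; apply: continuous_compact_integrable; try exact: segment_compact.
  by apply: continuous_in_subspaceT => t /set_mem /= tab; apply: cvg_Re; exact: cF.
by apply: continuous_in_subspaceT => t /set_mem /= tab; apply: cvg_Im; exact: cF.
Qed.

Lemma cintegral_itv_split F a m b : a <= m -> m <= b -> cintegrable leb `[a, b] F ->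
  cintegral leb `[a, b] F = cintegral leb `[a, m] F + cintegral leb `[m, b] F.
Proof.
move=> am mb [iR iI].
have split (g : R -> R) : leb.-integrable `[a, b] (EFin \o g) ->
    \int[leb]_(t in `[a, b]) g t = \int[leb]_(t in `[a, m]) g t + \int[leb]_(t in `[m, b]) g t.
  move=> ig; have := Rintegral_itvB ig _ _ => /(_ m).
  rewrite !bnd_simp => /(_ am mb); rewrite Rintegral_itv_obnd_cbnd.
    by move=> <-; rewrite addrC subrK.
  apply: integrableS ig => //.
  by move=> t /=; rewrite !in_itv/= => /andP[mt ->]; rewrite (le_trans am (ltW mt)).
by apply: cplx_eqP; rewrite ?ReD ?ImD /= split.
Qed.

Lemma circle_point_integral (r s t : R) : s <= t ->
  circle_point r t - circle_point r s = 'i%C * cintegral leb `[s, t] (circle_point r).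
Proof.
move=> st.
have hc (x : R) : is_derive x 1 (fun t => r * sin t) (r * cos x).
  exact: (@is_deriveZ _ _ _ _ r _ _ _ (is_derive_sin x)).
have hs (x : R) : is_derive x 1 (fun t => - r * cos t) (r * sin x).
  have := @is_deriveZ _ _ _ _ (- r) _ _ _ (is_derive_cos x).
  by rewrite /GRing.scale /= mulrNN.
have /= ic := integral_derivative st hc (@continuous_circle_Re _ r).
have /= isn := integral_derivative st hs (@continuous_circle_Im _ r).
by apply: cplx_eqP; rewrite ?ReM ?ImM ?ReB ?ImB /= ic isn; ring.
Qed.

Lemma circle_point_lip (r s t : R) :
  cabs (circle_point r t - circle_point r s) <= `|r| * `|t - s|.
Proof.
wlog st : s t / s <= t => [h|].
  by have [/h//|/ltW/h] := leP s t; rewrite cabsBC distrC.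
rewrite circle_point_integral// cabsM.
have -> : cabs ('i%C : Cplx R) = 1 by rewrite /cabs /= expr0n expr1n add0r sqrtr1.
rewrite mul1r (ger0_norm (_ : 0 <= t - s)) ?subr_ge0//; apply: cabs_cintegral_itv_le => //.
  by apply: cintegrable_continuous => u _; exact: continuous_circle_point.
by move=> u _; rewrite cabs_circle_point.
Qed.

End IntervalIntegral.

Section Cauchy.
Context {R : realType}.
Local Notation leb := (@lebesgue_measure R).
Variables (f : Cplx R -> Cplx R) (rho : R) (z : Cplx R).
Hypothesis derf : forall w, cabs w < 1 -> derivable f w 1.
Hypothesis zrho : cabs z < rho.
Hypothesis rho1 : rho < 1.

Implicit Types (l t s x y m p u : R) (h : Cplx R -> Cplx R).

Let rho0 : 0 < rho. Proof. exact: le_lt_trans (cabs_ge0 z) zrho. Qed.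

(* The homotopy contracting the circle of radius [rho] to [z]; pulled back by it,
   [h w dw / (w - z)] becomes [h (gam l t) (dl / l + 'i * cker t dt)]. *)
Let gam (l t : R) : Cplx R := rtoC (1 - l) * z + rtoC l * circle_point rho t.
Let cker (t : R) : Cplx R := circle_point rho t / (circle_point rho t - z).

(** The counterclockwise integral of the pulled-back form over the boundary of [[x, y] x [s, t]],
    opposite sides being combined into differences. Because of the factor [1 / l], it is used only
    on rectangles with [x > 0]. *)
Let boundary (h : Cplx R -> Cplx R) (x y s t : R) : Cplx R :=
  cintegral leb `[x, y] (fun l => (h (gam l s) - h (gam l t)) * rtoC l^-1) +
  'i%C * cintegral leb `[s, t] (fun u => (h (gam y u) - h (gam x u)) * cker u).

Let gamE l t : gam l t = z + rtoC l * (circle_point rho t - z).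
Proof. by rewrite /gam rtoCB rtoC1; ring. Qed.

Let cabs_cz t : rho - cabs z <= cabs (circle_point rho t - z).
Proof. by rewrite (le_trans _ (cabs_le_sub _ _))// cabs_circle_point gtr0_norm. Qed.

Let cabs_cz2 t : cabs (circle_point rho t - z) <= 2.
Proof.
rewrite (le_trans (cabsB _ _))// cabs_circle_point gtr0_norm//.
by have := zrho; have := rho1; lra.
Qed.

Let cz_neq0 t : circle_point rho t - z != 0.
Proof.
apply/eqP => h; have := cabs_cz t; rewrite h cabs0.
by have := zrho; lra.
Qed.

Let cabs_gam l t : 0 <= l <= 1 -> cabs (gam l t) < 1.
Proof.
move=> /andP[l0 l1]; apply: le_lt_trans rho1; rewrite (le_trans (cabsD _ _))//.
rewrite !cabsM !cabs_rtoC cabs_circle_point (ger0_norm l0) (gtr0_norm rho0).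
rewrite ger0_norm ?subr_ge0//.
have : (1 - l) * cabs z <= (1 - l) * rho by rewrite ler_wpM2l ?subr_ge0// ltW.
by lra.
Qed.

Let Bq := (rho - cabs z)^-1.
Let Bq0 : 0 < Bq. Proof. by rewrite invr_gt0 subr_gt0. Qed.

Let cabs_cker t : cabs (cker t) <= Bq.
Proof.
rewrite cabsM cabsV cabs_circle_point gtr0_norm//.
rewrite -[leRHS]mul1r ler_pM ?(ltW rho0) ?invr_ge0 ?cabs_ge0 ?(ltW rho1)//.
by rewrite lef_pV2 ?posrE ?subr_gt0// ?cabs_gt0.
Qed.

Let continuous_cker : continuous cker.
Proof.
move=> t; apply: cvgM; first exact: continuous_circle_point.
apply: cvgV => //; apply: cvgB; [exact: continuous_circle_point|exact: cvg_cst].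
Qed.

Let continuous_gaml t : continuous (gam ^~ t).
Proof.
move=> l; apply: cvgD; apply: cvgM; try exact: cvg_cst; apply: cvg_rtoC => //.
by apply: cvgB => //; exact: cvg_cst.
Qed.

Let continuous_gamt l : continuous (gam l).
Proof.
move=> t; apply: cvgD; first exact: cvg_cst.
by apply: cvgM; [exact: cvg_cst|exact: continuous_circle_point].
Qed.

Let good (h : Cplx R -> Cplx R) := forall w, cabs w < 1 -> {for w, continuous h}.

Let good_f : good f.
Proof. by move=> w /derf/derivable_has_cderiv/has_cderiv_continuous. Qed.

Let cvg_hl h l t : good h -> 0 <= l <= 1 -> h (gam x t) @[x --> l] --> h (gam l t).
Proof.
move=> gh l01; have ch := gh _ (cabs_gam t l01).
exact: (continuous_comp (@continuous_gaml t l) ch).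
Qed.

Let cvg_ht h l t : good h -> 0 <= l <= 1 -> h (gam l x) @[x --> t] --> h (gam l t).
Proof.
move=> gh l01; have ch := gh _ (cabs_gam t l01).
exact: (continuous_comp (@continuous_gamt l t) ch).
Qed.

Let int_l h x y s t : good h -> 0 < x -> y <= 1 ->
  cintegrable leb `[x, y] (fun l => (h (gam l s) - h (gam l t)) * rtoC l^-1).
Proof.
move=> gh x0 y1; apply: cintegrable_continuous => l /andP[xl ly].
have l0 : 0 < l by exact: lt_le_trans xl.
have l01 : 0 <= l <= 1 by rewrite (ltW l0) (le_trans ly).
apply: cvgM; first by apply: cvgB; exact: cvg_hl.
by apply: cvg_rtoC; apply: cvgV; rewrite ?gt_eqF.
Qed.

Let int_t1 h l s t : good h -> 0 <= l <= 1 ->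
  cintegrable leb `[s, t] (fun u => h (gam l u) * cker u).
Proof.
move=> gh l01; apply: cintegrable_continuous => u _.
by apply: cvgM; [exact: cvg_ht|exact: continuous_cker].
Qed.

Let int_t h x y s t : good h -> 0 <= x <= 1 -> 0 <= y <= 1 ->
  cintegrable leb `[s, t] (fun u => (h (gam y u) - h (gam x u)) * cker u).
Proof.
move=> gh x01 y01; apply: cintegrable_continuous => u _.
by apply: cvgM; [apply: cvgB; exact: cvg_ht|exact: continuous_cker].
Qed.

Let good_affine (al be : Cplx R) : good (fun w => al + be * w).
Proof.
move=> w _; have hm : be * x @[x --> w] --> be * w by exact: mulrl_continuous.
exact: (cvgD (cvg_cst al) hm).
Qed.

(** Both integrands are explicit for an affine function: the two parts are [be * (y - x)] times [E]
    and times ['i] times the integral of [circle_point rho], which are opposite by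
    [circle_point_integral]. This is what allows a tangent to be subtracted in [boundary_local]. *)
Let boundary_affine al be x y s t : 0 < x -> x <= y -> y <= 1 -> s <= t ->
  boundary (fun w => al + be * w) x y s t = 0.
Proof.
move=> x0 xy y1 st; rewrite /boundary.
set E := circle_point rho s - circle_point rho t.
have -> : cintegral leb `[x, y] (fun l => (al + be * gam l s - (al + be * gam l t)) * rtoC l^-1)
    = cintegral leb `[x, y] (fun=> be * E).
  apply: eq_cintegral => l /=; rewrite in_itv/= => /andP[xl _].
  have l0 : rtoC l != 0 :> Cplx R by rewrite (inj_eq (@complexI _)) gt_eqF// (lt_le_trans x0).
  by rewrite rtoCV !gamE /E; field.
have -> : cintegral leb `[s, t] (fun u => (al + be * gam y u - (al + be * gam x u)) * cker u)
    = cintegral leb `[s, t] (fun u => be * rtoC (y - x) * circle_point rho u).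
  apply: eq_cintegral => u _; rewrite !gamE /cker rtoCB; field.
  by have := cz_neq0 u.
have -> : cintegral leb `[x, y] (fun=> be * E) = rtoC (y - x) * (be * E).
  apply: cplx_eqP; rewrite ?Re_rtoCM ?Im_rtoCM /= Rintegral_itv_cst// mulrC//.
rewrite cintegralZ//; last first.
  by apply: cintegrable_continuous => u _; exact: continuous_circle_point.
have -> : E = - ('i%C * cintegral leb `[s, t] (circle_point rho)).
  by rewrite -circle_point_integral// opprB.
by ring.
Qed.

Let boundary_add1 x m y s t : 0 < x -> x <= m -> m <= y -> y <= 1 -> s <= t ->
  boundary f x y s t = boundary f x m s t + boundary f m y s t.
Proof.
move=> x0 xm my y1 st; rewrite /boundary.
have x01 : 0 <= x <= 1 by lra.
have m01 : 0 <= m <= 1 by lra.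
have y01 : 0 <= y <= 1 by lra.
rewrite (cintegral_itv_split xm my); last exact: int_l.
have -> : cintegral leb `[s, t] (fun u => (f (gam y u) - f (gam x u)) * cker u) =
    cintegral leb `[s, t] (fun u => (f (gam m u) - f (gam x u)) * cker u) +
    cintegral leb `[s, t] (fun u => (f (gam y u) - f (gam m u)) * cker u).
  rewrite -cintegralD//; [|exact: int_t|exact: int_t].
  by apply: eq_cintegral => u _; ring.
by ring.
Qed.

Let boundary_add2 x y s m t : 0 < x -> x <= y -> y <= 1 -> s <= m -> m <= t ->
  boundary f x y s t = boundary f x y s m + boundary f x y m t.
Proof.
move=> x0 xy y1 sm mt; rewrite /boundary.
have x01 : 0 <= x <= 1 by lra.
have y01 : 0 <= y <= 1 by lra.
rewrite (@cintegral_itv_split _ _ s m t)//; last exact: int_t.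
have -> : cintegral leb `[x, y] (fun l => (f (gam l s) - f (gam l t)) * rtoC l^-1) =
    cintegral leb `[x, y] (fun l => (f (gam l s) - f (gam l m)) * rtoC l^-1) +
    cintegral leb `[x, y] (fun l => (f (gam l m) - f (gam l t)) * rtoC l^-1).
  rewrite -cintegralD//; [|exact: int_l|exact: int_l].
  by apply: eq_cintegral => u _; ring.
by ring.
Qed.

Let gam_lip l t p u : 0 <= p <= 1 -> cabs (gam l t - gam p u) <= 2 * (`|l - p| + `|t - u|).
Proof.
move=> /andP[p0 p1].
have -> : gam l t - gam p u = rtoC (l - p) * (circle_point rho t - z) +
    rtoC p * (circle_point rho t - circle_point rho u).
  by rewrite !gamE rtoCB; ring.
rewrite (le_trans (cabsD _ _))// !cabsM !cabs_rtoC mulrDr lerD//.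
  by rewrite mulrC ler_wpM2r// cabs_cz2.
apply: (@le_trans _ _ (1 * (1 * `|t - u|))).
  apply: ler_pM; rewrite ?cabs_ge0//; first by rewrite ger0_norm.
  rewrite (le_trans (circle_point_lip _ _ _))// gtr0_norm//.
  by rewrite ler_wpM2r// ltW.
by have := normr_ge0 (t - u); lra.
Qed.

(** [boundary] does not change when the tangent of [f] at [gam p u] is subtracted. What is left is
    at most [e / K] times the distance to that point, which gives one factor of the size of the
    rectangle; the lengths of the sides give the other. *)
Let boundary_local l0 p u (e : R) : 0 < l0 -> l0 <= p <= 1 -> 0 < e ->
  exists2 dl : R, 0 < dl & forall x y s t, l0 <= x -> x <= p -> p <= y -> y <= 1 ->
    s <= u -> u <= t -> y - x < dl -> t - s < dl ->
    cabs (boundary f x y s t) <= e * ((y - x) + (t - s)) ^+ 2.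
Proof.
move=> l00 /andP[lp p1] e0.
have p01 : 0 <= p <= 1 by lra.
have w1 := cabs_gam u p01; set w0 := gam p u in w1.
have /derivable_has_cderiv := derf w1; set a := derive1 f w0 => hd.
(* The 4 is 2 for the Lipschitz constant of [gam] times 2 for the difference of two values in each
   integrand; [l0^-1] and [Bq] bound the two kernels. *)
pose K := 4 * (l0^-1 + Bq).
have K0 : 0 < K by rewrite mulr_gt0// addr_gt0// invr_gt0.
have [dl d0 hdl] := hd (e / K) (divr_gt0 e0 K0).
exists (dl / 4) => [|x y s t lx xp py y1 su ut xy st]; first by lra.
set D := (y - x) + (t - s).
have D0 : 0 <= D by rewrite /D; lra.
pose g w := f w - (f w0 - a * w0 + a * w).
have x0 : 0 < x by lra.
have x01 : 0 <= x <= 1 by lra.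
have y01 : 0 <= y <= 1 by lra.
have gg : good g.
  move=> w w11; have h1 : f v @[v --> w] --> f w by exact: good_f.
  have h2 : (f w0 - a * w0 + a * v) @[v --> w] --> f w0 - a * w0 + a * w by exact: good_affine.
  exact: (cvgB h1 h2).
have ga := @good_affine (f w0 - a * w0) a.
have gb l v : x <= l -> l <= y -> s <= v -> v <= t -> cabs (g (gam l v)) <= e / K * (2 * D).
  move=> xl ly sv vt; have h : cabs (gam l v - w0) <= 2 * D.
    rewrite (le_trans (gam_lip _ _ _ p01))// ler_wpM2l//; apply: lerD; rewrite ler_norml; lra.
  have /hdl : cabs (gam l v - w0) < dl by apply: (le_lt_trans h); rewrite /D; lra.
  have -> : f (gam l v) - f w0 - a * (gam l v - w0) = g (gam l v) by rewrite /g; ring.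
  by move=> h'; rewrite (le_trans h')// ler_wpM2l// divr_ge0// ltW.
have Bf : boundary f x y s t = boundary g x y s t.
  rewrite -[RHS]addr0 -(@boundary_affine (f w0 - a * w0) a x y s t)//; [|lra|lra].
  rewrite /boundary addrACA -mulrDr; congr (_ + 'i%C * _).
    rewrite -cintegralD//; last 2 first.
    - exact: int_l.
    - exact: (@int_l _ x y s t ga x0 y1).
    by apply: eq_cintegral => l _; rewrite /g; ring.
  rewrite -cintegralD//; last 2 first.
  - exact: int_t.
  - exact: (@int_t _ x y s t ga x01 y01).
  by apply: eq_cintegral => l _; rewrite /g; ring.
set b := e / K * (2 * D) in gb.
have b0 : 0 <= b by apply: mulr_ge0; [exact/ltW/divr_gt0|lra].
rewrite Bf (le_trans (cabsD _ _))// cabsM.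
have -> : cabs ('i%C : Cplx R) = 1 by rewrite /cabs /= expr0n expr1n add0r sqrtr1.
rewrite mul1r.
have h1 : cabs (cintegral leb `[x, y] (fun l => (g (gam l s) - g (gam l t)) * rtoC l^-1)) <=
    (2 * b) * l0^-1 * (y - x).
  apply: cabs_cintegral_itv_le; [lra|exact: int_l|].
  move=> l /andP[xl ly]; rewrite cabsM ler_pM ?cabs_ge0//.
    rewrite (le_trans (cabsB _ _))//.
    have st' : s <= t by lra.
    have := gb l s xl ly (lexx s) st'; have := gb l t xl ly st' (lexx t); lra.
  rewrite cabs_rtoC ger0_norm ?invr_ge0; last lra.
  by rewrite lef_pV2 ?posrE//; lra.
have h2 : cabs (cintegral leb `[s, t] (fun u0 => (g (gam y u0) - g (gam x u0)) * cker u0)) <=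
    (2 * b) * Bq * (t - s).
  apply: cabs_cintegral_itv_le; [lra|exact: int_t|].
  move=> v /andP[sv vt]; rewrite cabsM ler_pM ?cabs_ge0//.
  rewrite (le_trans (cabsB _ _))//.
  have xy' : x <= y by lra.
  have := gb x v (lexx x) xy' sv vt; have := gb y v xy' (lexx y) sv vt; lra.
apply: (le_trans (lerD h1 h2)).
have -> : e * D ^+ 2 = (2 * b) * (l0^-1 + Bq) * D.
  rewrite /b /K; have Kn : l0^-1 + Bq != 0 by rewrite gt_eqF// addr_gt0// invr_gt0.
  move: (l0^-1 + Bq) Kn => k kn; by field.
have b20 : 0 <= 2 * b by rewrite mulr_ge0.
have bl : 0 <= 2 * b * l0^-1 by rewrite mulr_ge0// invr_ge0 ltW.
have bB : 0 <= 2 * b * Bq by rewrite mulr_ge0// ltW.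
have yx0 : 0 <= y - x by lra.
have ts0 : 0 <= t - s by lra.
rewrite [leRHS](_ : _ = 2 * b * l0^-1 * D + 2 * b * Bq * D); last by ring.
by apply: lerD; apply: ler_wpM2l => //; rewrite /D; lra.
Qed.

(** On [[l, 1] x [0, 2 pi]] the sides [t = 0] and [t = 2 pi] have the same image and cancel, so only
    the difference of the two circle integrals is left in [boundary]. *)
Let circle_const l : 0 < l -> l <= 1 ->
  cintegral leb `[0, 2 * pi] (fun t => (f (gam 1 t) - f (gam l t)) * cker t) = 0.
Proof.
move=> l0 l1.
have B0 : boundary f l 1 0 (2 * pi) = 0.
  apply: (@rectangle_bisection R (boundary f) l 1 0 (2 * pi)) => //.
  - exact: pi2_ge0.
  - by move=> x m y s t lx xm my y1 _ st _; apply: boundary_add1 => //; lra.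
  - by move=> x y s m t lx xy y1 _ sm mt _; apply: boundary_add2 => //; lra.
  - move=> p u e /andP[lp p1] _ e0.
    have [|dl d0 h] := @boundary_local l p u e l0 _ e0; first by rewrite lp p1.
    by exists dl => // x y s t lx xp py y1 _ su ut _; exact: h.
move: B0; rewrite /boundary.
have -> : cintegral leb `[l, 1] (fun l0 => (f (gam l0 0) - f (gam l0 (2 * pi))) * rtoC l0^-1) = 0.
  rewrite -[RHS](cintegral0 leb (measurable_itv `[l, 1])); apply: eq_cintegral => k _.
  suff -> : gam k (2 * pi) = gam k 0 by rewrite subrr mul0r.
  rewrite /gam; congr (_ + _ * _); rewrite /circle_point.
  have := @cos_sin_natM2pi R 1; rewrite mul1r => -[-> ->].
  by rewrite cos0 sin0.
rewrite add0r => /eqP; rewrite mulf_eq0 => /orP[|/eqP//].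
by rewrite eq_complex /= oner_eq0 andbF.
Qed.

(** [circle_const] with the inner circle shrinking to [z], where [f] is continuous. The kernel
    integral on the right is left unevaluated; [circle_kernel_series] for a constant function later
    gives it the value [2 pi f(z)]. *)
Lemma cauchy_formula :
  cintegral leb `[0, 2 * pi] (fun t => f (circle_point rho t) * (circle_point rho t / (circle_point rho t - z))) =
  cintegral leb `[0, 2 * pi] (fun t => f z * (circle_point rho t / (circle_point rho t - z))).
Proof.
have gz : gam 0 = fun=> z by apply/funext => t; rewrite gamE mul0r addr0.
have g1 : gam 1 = circle_point rho by apply/funext => t; rewrite gamE mul1r addrC subrK.
have i0 l : 0 <= l <= 1 -> cintegrable leb `[0, 2 * pi] (fun t => (f (gam 1 t) - f (gam l t)) * cker t).
  by move=> l01; apply: int_t => //; rewrite ler01 lexx.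
apply/eqP; rewrite -subr_eq0 -cintegralB//; last 2 first.
- by have := @int_t1 f 1 0 (2 * pi) good_f; rewrite g1; apply; rewrite ler01 lexx.
- by have := @int_t1 f 0 0 (2 * pi) good_f; rewrite gz; apply; rewrite ler01 lexx.
apply/eqP/cabs_eq0/eqP; rewrite eq_le cabs_ge0 andbT; apply/ler_addgt0Pr => e e0; rewrite add0r.
have z1 : cabs z < 1 by exact: lt_trans rho1.
pose e1 := e / (Bq * (2 * pi)).
have e10 : 0 < e1 by rewrite divr_gt0// mulr_gt0// pi2_gt0.
have /cvg_cplxP/cvgrPdist_lt/(_ e1 e10)/nbhs_cabsP[dl d0 hd] := good_f z1.
(* Since [|gam l t - z| = l |circle_point rho t - z| <= 2 l], the inner circle lies within [dl] of
   [z]. *)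
pose l := Num.min 1 (dl / 4).
have l0 : 0 < l by rewrite lt_min ltr01/= divr_gt0.
have l1 : l <= 1 by rewrite ge_min lexx.
have l01 : 0 <= l <= 1 by rewrite l1 ltW.
have -> : cintegral leb `[0, 2 * pi] (fun t =>
     f (circle_point rho t) * (circle_point rho t / (circle_point rho t - z)) -
     f z * (circle_point rho t / (circle_point rho t - z))) =
   cintegral leb `[0, 2 * pi] (fun t => (f (gam l t) - f (gam 0 t)) * cker t).
  rewrite -[RHS]add0r -(circle_const l0 l1) -cintegralD//.
  - by apply: eq_cintegral => t _; rewrite g1 gz /cker; ring.
  - exact: i0.
  - by apply: int_t => //; rewrite lexx ler01.
have h : cabs (cintegral leb `[0, 2 * pi] (fun t => (f (gam l t) - f (gam 0 t)) * cker t)) <=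
    e1 * Bq * (2 * pi - 0).
  apply: cabs_cintegral_itv_le; first exact: pi2_ge0.
    by apply: int_t => //; rewrite lexx ler01.
  move=> t _; rewrite cabsM ler_pM ?cabs_ge0// gz.
  have := hd (gam l t); rewrite sub0r normrN ger0_norm ?cabs_ge0// => h; apply/ltW/h.
  rewrite gamE addrAC subrr add0r cabsM cabs_rtoC gtr0_norm//.
  apply: (@le_lt_trans _ _ (dl / 4 * 2)); last by lra.
  by rewrite ler_pM ?cabs_ge0// ?(ltW l0)// ge_min lexx orbT.
apply: (le_trans h); rewrite subr0 -mulrA /e1 mulfVK//.
by rewrite gt_eqF// mulr_gt0// pi2_gt0.
Qed.

(** The kernel is [1 / (1 - y t)] with [|y t| = |z| / rho < 1], and its geometric series is
    integrated term by term. [G] is arbitrary because it stands both for the values of [f] on the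
    circle and for the constant [f z]. *)
Lemma circle_kernel_series (G : R -> Cplx R) (M : R) :
  cmeasurable (`[0, 2 * pi] : set (measurableTypeR R)) G ->
  (forall t, 0 <= t <= 2 * pi -> cabs (G t) <= M) ->
  series (fun n => (rtoC rho)^-1 ^+ n *
    cintegral leb `[0, 2 * pi] (fun t => G t * conjc (circle_point 1 t ^+ n)) * z ^+ n) @ \oo -->
  cintegral leb `[0, 2 * pi] (fun t => G t * (circle_point rho t / (circle_point rho t - z))).
Proof.
move=> mG GM.
pose y t : Cplx R := (rtoC rho)^-1 * z * conjc (circle_point 1 t).
have my : cmeasurable (`[0, 2 * pi] : set (measurableTypeR R)) y.
  apply: cmeasurableM; first exact: cmeasurable_cst.
  by apply: cmeasurable_conj; exact: cmeasurable_circle_point.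
pose x := rho^-1 * cabs z.
have cy t : cabs (y t) = x.
  by rewrite !cabsM cabsV cabs_rtoC (gtr0_norm rho0) cabs_conj cabs_circle_point normr1 mulr1.
have x01 : 0 <= x < 1.
  rewrite /x mulr_ge0 ?invr_ge0 ?cabs_ge0 ?(ltW rho0)//=.
  by rewrite mulrC ltr_pdivrMr// mul1r.
have cp0 t : circle_point 1 t * conjc (circle_point 1 t) = 1.
  by have := circle_pointJ 1 t 1; rewrite !expr1 expr1n.
have rho_neq0 : rtoC rho != 0 :> Cplx R by rewrite (inj_eq (@complexI _)) gt_eqF.
have kE t : circle_point rho t / (circle_point rho t - z) = (1 - y t)^-1.
  have zE : z = circle_point rho t * y t.
    rewrite /y circle_pointE mulrACA mulVKf ?mulrA ?(mulrC _ z)//.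
    by rewrite -mulrA cp0 mulr1.
  rewrite {1}zE -[X in X - _]mulr1 -mulrBr invfM mulrA mulfV ?mul1r//.
  by apply/eqP => h; have := cabs_circle_point rho t; rewrite h cabs0 gtr0_norm// => /eqP; rewrite lt_eqF.
have y1 t : 1 - y t != 0.
  by apply/eqP => /subr0_eq h; have := cy t; rewrite -h cabs1 => h'; move: x01; rewrite -h' ltxx andbF.
have ser t : series (fun n => G t * y t ^+ n) @ \oo --> G t * (1 - y t)^-1.
  apply: (cvg_eq1 (u := fun n => G t * (1 - y t)^-1 * (1 - y t ^+ n))).
    by move=> n; rewrite /series /= -mulr_sumr geometric_sum// mulrA.
  rewrite -[X in _ --> X]mulr1; apply: cvgM; first exact: cvg_cst.
  rewrite -[X in _ --> X]subr0; apply: cvgB; first exact: cvg_cst.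
  apply/cvg_cplxP; under eq_fun do rewrite subr0 cabsX cy.
  by apply: cvg_expr; case/andP: x01 => ? ?; rewrite ger0_norm.
have [||||_ _] := @cintegral_series _ _ _ leb `[0, 2 * pi] (measurable_itv _)
  (fun n t => G t * y t ^+ n) (fun t => G t * (1 - y t)^-1) (cst (M * (1 - x)^-1)).
- by move=> n; apply: cmeasurableM => //; exact: cmeasurableX.
- by move=> t _; exact: ser.
- exact: integrable_itv_cst.
- move=> n t /= t2; under eq_bigr do rewrite cabsM cabsX cy.
  rewrite -mulr_sumr ler_pM ?cabs_ge0 ?sumr_ge0//; last exact: sum_geometric_le.
    by move=> i _; rewrite exprn_ge0//; case/andP: x01.
  by apply: GM; rewrite in_itv in t2.
have -> : cintegral leb `[0, 2 * pi] (fun t => G t * (1 - y t)^-1) =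
   cintegral leb `[0, 2 * pi] (fun t => G t * (circle_point rho t / (circle_point rho t - z))).
  by apply: eq_cintegral => t _; rewrite kE.
apply: cvg_eq1 => n; apply: eq_bigr => k _.
transitivity (cintegral leb `[0, 2 * pi] (fun t => ((rtoC rho)^-1 * z) ^+ k * (G t * conjc (circle_point 1 t ^+ k)))).
  by apply: eq_cintegral => t _; rewrite /y [in LHS]exprMn conjcX; ring.
rewrite cintegralZ//; first by rewrite exprMn; ring.
apply: (@cintegrable_itv_bounded _ _ _ M).
  apply: cmeasurableM => //; apply: cmeasurable_conj; exact: cmeasurable_circle_pointX.
by move=> t t2; rewrite cabsM cabs_conj cabsX cabs_circle_point normr1 expr1n mulr1 GM.
Qed.

End Cauchy.

(** * Taylor expansion on the disc, coefficient bounds and rules for derivatives *)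

Section Taylor.
Context {R : realType}.
Local Notation leb := (@lebesgue_measure R).
Implicit Types (f : Cplx R -> Cplx R) (c : nat -> Cplx R) (z w : Cplx R).

Lemma pseries_circle f rho z : (forall w, cabs w < 1 -> derivable f w 1) ->
  cabs z < rho -> rho < 1 ->
  series (fun n => rtoC (2 * pi)^-1 * ((rtoC rho)^-1 ^+ n *
    cintegral leb `[0, 2 * pi] (fun t => f (circle_point rho t) * conjc (circle_point 1 t ^+ n))) * z ^+ n)
  @ \oo --> f z.
Proof.
move=> df zrho rho1.
have rho0 : 0 < rho by exact: le_lt_trans (cabs_ge0 z) zrho.
pose G (t : R) := f (circle_point rho t).
have cG : continuous G.
  move=> t; have h : cabs (circle_point rho t) < 1 by rewrite cabs_circle_point gtr0_norm.
  have cf : {for circle_point rho t, continuous f}.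
    exact: (has_cderiv_continuous (derivable_has_cderiv (df _ h))).
  exact: (continuous_comp (@continuous_circle_point R rho t) cf).
have [M GM] : exists M, forall t, 0 <= t <= 2 * pi -> cabs (G t) <= M.
  have [|t0 _ ht0] := @EVT_max R (fun t => cabs (G t)) 0 (2 * pi) pi2_ge0.
    by apply: continuous_subspaceT => t; apply: cvg_cabs; exact: cG.
  by exists (cabs (G t0)) => t t2; apply: ht0; rewrite in_itv.
have mG : cmeasurable (`[0, 2 * pi] : set (measurableTypeR R)) G.
  split; apply: measurable_funTS; apply: continuous_measurable_fun => t.
    by apply: cvg_Re; exact: cG.
  by apply: cvg_Im; exact: cG.
have h1 := circle_kernel_series zrho mG GM.
have h2 := @circle_kernel_series _ rho z zrho (fun=> f z) (cabs (f z))
  (cmeasurable_cst _ _) (fun _ _ => lexx _).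
have pi2 : rtoC (2 * pi) != 0 :> Cplx R.
  by rewrite (inj_eq (@complexI _)) gt_eqF// pi2_gt0.
(* For a constant function every coefficient after the first is the conjugate of the integral of a
   positive power of the circle point, hence 0. *)
have {}h2 : cintegral leb `[0, 2 * pi]
    (fun t => f z * (circle_point rho t / (circle_point rho t - z))) = rtoC (2 * pi) * f z.
  apply: (cplx_cvg_unique h2); apply: cvg_near_cst.
  exists 1%N => // n /= n0; rewrite /series /= -(prednK n0) big_nat_recl// big1_seq.
    rewrite addr0 !expr0 mul1r mulr1 -cintegral_circle_cst.
    by apply: eq_cintegral => t _; rewrite expr0 conjc1 mulr1.
  move=> i _; suff -> : cintegral leb `[0, 2 * pi] (fun t => f z * conjc (circle_point 1 t ^+ i.+1)) = 0.
    by rewrite mulr0 mul0r.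
  have ic : cintegrable leb `[0, 2 * pi] (fun t => circle_point 1 t ^+ i.+1).
    apply: (@cintegrable_itv_bounded _ _ _ 1); first exact: cmeasurable_circle_pointX.
    by move=> t _; rewrite cabsX cabs_circle_point normr1 expr1n.
  have icj : cintegrable leb `[0, 2 * pi] (fun t => conjc (circle_point 1 t ^+ i.+1)).
    apply: (@cintegrable_itv_bounded _ _ _ 1).
      by apply: cmeasurable_conj; exact: cmeasurable_circle_pointX.
    by move=> t _; rewrite cabs_conj cabsX cabs_circle_point normr1 expr1n.
  by rewrite cintegralZ// cintegral_conj// cintegral_circle_pointX conjc0 mulr0.
move: h1; rewrite (cauchy_formula df zrho rho1) h2 => h1.
suff : series (fun n => rtoC (2 * pi)^-1 * ((rtoC rho)^-1 ^+ n *
    cintegral leb `[0, 2 * pi] (fun t => f (circle_point rho t) * conjc (circle_point 1 t ^+ n))) * z ^+ n)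
  @ \oo --> rtoC (2 * pi)^-1 * (rtoC (2 * pi) * f z).
  by rewrite rtoCV mulKf.
apply: (cvg_eq1 _ (cvgM (cvg_cst (rtoC (2 * pi)^-1 : Cplx R)) h1)) => n.
rewrite [LHS]mulr_sumr /series /=.
by apply: eq_bigr => i _; rewrite mulrA.
Qed.

(** The coefficients in [pseries_circle] depend on the radius of the circle. Any larger radius gives
    the same ones as radius [1/2], since both expansions hold for [|z| < 1/2]; one sequence
    therefore serves the whole disc. *)
Lemma analytic_pseries f : (forall w, cabs w < 1 -> derivable f w 1) ->
  exists c, power_series_of f c.
Proof.
move=> df.
pose c rho n := rtoC (2 * pi)^-1 * ((rtoC rho)^-1 ^+ n *
    cintegral leb `[0, 2 * pi] (fun t => f (circle_point rho t) * conjc (circle_point 1 t ^+ n))).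
have hc rho z : cabs z < rho -> rho < 1 -> series (fun n => c rho n * z ^+ n) @ \oo --> f z.
  exact: pseries_circle.
have half1 : 2^-1 < 1 :> R by lra.
exists (c 2^-1) => z; rewrite /unit_disc /= => z1.
have m1 : Num.max (cabs z) 2^-1 < 1 by rewrite gt_max z1.
set m := Num.max _ _ in m1.
have zm : cabs z <= m by rewrite le_max lexx.
have hm : 2^-1 <= m by rewrite le_max lexx orbT.
have rho1 : (m + 1) / 2 < 1 by lra.
have <- : c ((m + 1) / 2) = c 2^-1.
  apply: (@pseries_unique _ _ _ f 2^-1) => [|w w2|w w2]; first by lra.
  - by apply: hc => //; lra.
  - exact: hc.
by apply: hc => //; lra.
Qed.

Lemma taylor_coefP f : (forall w, cabs w < 1 -> derivable f w 1) ->
  power_series_of f (taylor_coef f).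
Proof.
by move=> /analytic_pseries[c hc]; rewrite /taylor_coef; apply: xgetPex; exists c.
Qed.

Lemma taylor_coef_unique f c : power_series_of f c -> taylor_coef f = c.
Proof.
move=> hc; have h : power_series_of f (taylor_coef f).
  by rewrite /taylor_coef; apply: xgetPex; exists c.
by apply: (@pseries_unique _ _ _ f 1).
Qed.

Lemma pseries_summable f c (r : R) : power_series_of f c -> 0 <= r < 1 ->
  exists2 S : R, 0 < S & forall N, \sum_(0 <= k < N) cabs (c k) * r ^+ k <= S.
Proof.
move=> fc /andP[r0 r1].
have s1 : cabs (rtoC ((r + 1) / 2)) < 1 by rewrite cabs_rtoC ger0_norm; lra.
have [B B0 hB] := pseries_terms_bounded (fc _ s1).
have s0 : 0 < (r + 1) / 2 by lra.
exists (B * (1 - r / ((r + 1) / 2))^-1).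
  by rewrite mulr_gt0// invr_gt0 subr_gt0 ltr_pdivrMr//; lra.
apply: pseries_abs_bounded; first by apply/andP; split => //; lra.
by move=> k; have := hB k; rewrite gtr0_norm.
Qed.

Lemma circle_mean_cvg f c (r : R) : power_series_of f c -> 0 <= r < 1 ->
  exists S : R, [/\ cmeasurable (`[0, 2 * pi] : set (measurableTypeR R)) (fun t => f (circle_point r t)),
    forall t, cabs (f (circle_point r t)) <= S
  & (fun N => \sum_(0 <= k < N) cabs (c k) ^+ 2 * r ^+ (k * 2)) @ \oo -->
      (2 * pi)^-1 * \int[leb]_(t in `[0, 2 * pi]) (cabs (f (circle_point r t)) ^+ 2)].
Proof.
move=> fc r01; have [S S0 hS] := pseries_summable fc r01; exists S.
have /andP[r0 r1] := r01.
apply: (@parseval _ c r) => [N|t]; first by rewrite ger0_norm.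
by apply: fc; rewrite /unit_disc /mkset cabs_circle_point ger0_norm.
Qed.

(** By Parseval these sums increase to the mean of [|f|^2] over the circle of radius [r]. *)
Lemma coef_square_sum_le f c (r M : R) : power_series_of f c -> 0 <= r < 1 ->
  (forall z, cabs z = r -> cabs (f z) <= M) ->
  forall N, \sum_(0 <= k < N) cabs (c k) ^+ 2 * r ^+ (k * 2) <= M ^+ 2.
Proof.
move=> fc /[dup] r01 /andP[r0 r1] fM N; have [S [mf fS hc]] := circle_mean_cvg fc r01.
have fM' t : cabs (f (circle_point r t)) <= M.
  by apply: fM; rewrite cabs_circle_point ger0_norm.
apply: (@le_trans _ _ ((2 * pi)^-1 *
    \int[leb]_(t in `[0, 2 * pi]) (cabs (f (circle_point r t)) ^+ 2))).
  apply: (cvgr_to_ge hc); exists N => // n /= Nn.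
  rewrite [leRHS](big_cat_nat (n := N))//= lerDl sumr_ge0// => i _.
  by rewrite mulr_ge0 ?sqr_ge0// exprn_ge0.
rewrite -ler_pdivlMl ?invr_gt0 ?pi2_gt0// invrK.
apply: (@le_trans _ _ (\int[leb]_(t in `[0, 2 * pi]) (M ^+ 2))).
  apply: le_Rintegral => //; first exact: (integrable_cabs_sqr mf fS).
    exact: integrable_itv_cst.
  move=> t _; rewrite ler_pXn2r ?nnegrE ?cabs_ge0//.
  exact: le_trans (cabs_ge0 _) (fM' t).
by rewrite Rintegral_itv_cst ?pi2_ge0// subr0 mulrC.
Qed.

Lemma has_cderiv_quadratic f z a (K dl : R) : 0 < dl ->
  (forall w, cabs (w - z) < dl -> cabs (f w - f z - a * (w - z)) <= K * cabs (w - z) ^+ 2) ->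
  has_cderiv f z a.
Proof.
move=> d0 h e e0; have K1 : 0 < `|K| + 1 by rewrite ltr_pwDr.
exists (Num.min dl (e / (`|K| + 1))); first by rewrite lt_min d0 divr_gt0.
move=> w; rewrite lt_min => /andP[w1 w2]; rewrite (le_trans (h _ w1))//.
rewrite expr2 mulrA ler_wpM2r ?cabs_ge0// (@le_trans _ _ ((`|K| + 1) * cabs (w - z)))//.
  by rewrite ler_wpM2r ?cabs_ge0// (le_trans (ler_norm _))// lerDl.
by rewrite mulrC -ler_pdivlMr// ltW.
Qed.

Lemma has_cderiv_comp f g z a b : has_cderiv g z b -> has_cderiv f (g z) a ->
  has_cderiv (f \o g) z (a * b).
Proof.
move=> hg hf e e0.
set B := cabs b + 1; have B0 : 0 < B by rewrite /B ltr_wpDl ?cabs_ge0.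
set A := cabs a + 1; have A0 : 0 < A by rewrite /A ltr_wpDl ?cabs_ge0.
have [d1 d10 h1] := hf (e / (2 * B)) (divr_gt0 e0 (mulr_gt0 (ltr0Sn R 1) B0)).
have [d2 d20 h2] := hg 1 ltr01.
have [d3 d30 h3] := hg (e / (2 * A)) (divr_gt0 e0 (mulr_gt0 (ltr0Sn R 1) A0)).
exists (Num.min (d1 / B) (Num.min d2 d3)); first by rewrite !lt_min divr_gt0// d20 d30.
move=> w; rewrite !lt_min => /and3P[w1 w2 w3] /=.
have gw : cabs (g w - g z) <= B * cabs (w - z).
  have -> : g w - g z = (g w - g z - b * (w - z)) + b * (w - z) by rewrite subrK.
  rewrite (le_trans (cabsD _ _))// cabsM /B mulrDl mul1r addrC lerD2l.
  by rewrite (le_trans (h2 _ w2))// mul1r.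
have gd : cabs (g w - g z) < d1.
  by apply: (le_lt_trans gw); rewrite mulrC -ltr_pdivlMr.
have -> : f (g w) - f (g z) - a * b * (w - z) =
  (f (g w) - f (g z) - a * (g w - g z)) + a * (g w - g z - b * (w - z)) by ring.
rewrite (le_trans (cabsD _ _))// cabsM.
have E1 : cabs (f (g w) - f (g z) - a * (g w - g z)) <= e / 2 * cabs (w - z).
  rewrite (le_trans (h1 _ gd))//.
  have -> : e / 2 * cabs (w - z) = e / (2 * B) * (B * cabs (w - z)) by field; rewrite gt_eqF.
  by rewrite ler_wpM2l// divr_ge0 ?mulr_ge0// ltW.
have E2 : cabs a * cabs (g w - g z - b * (w - z)) <= e / 2 * cabs (w - z).
  have -> : e / 2 * cabs (w - z) = A * (e / (2 * A) * cabs (w - z)) by field; rewrite gt_eqF.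
  rewrite ler_pM ?cabs_ge0//; last exact: h3.
  by rewrite /A lerDl.
lra.
Qed.

Lemma pseries_derive1_0 f c : power_series_of f c -> has_cderiv f 0 (c 1%N).
Proof.
move=> fc; have r4 : 0 <= (4^-1 : R) < 1 by lra.
have [S S0 hS] := pseries_summable fc r4.
(* For [|w| < 1/4] and [k >= 2], [|w|^k <= 16 |w|^2 4^-k], so the tail from degree 2 is at most
   [16 S |w|^2]. *)
apply: (@has_cderiv_quadratic _ _ _ (16 * S) 4^-1) => [|w]; first by lra.
rewrite !subr0 => w4.
have f0 : f 0 = c 0%N.
  have d0 : unit_disc (0 : Cplx R) by rewrite /unit_disc /mkset cabs0.
  have := fc 0 d0 => h; apply: (cplx_cvg_unique h).
  apply: cvg_near_cst; exists 1%N => // n /= n0.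
  rewrite /series /= -(prednK n0) big_nat_recl// expr0 mulr1 big1_seq ?addr0// => i _.
  by rewrite expr0n /= mulr0.
have w1 : unit_disc w by rewrite /unit_disc /mkset; lra.
have h : (fun n => series (fun k => c k * w ^+ k) n - f 0 - c 1%N * w) @ \oo --> f w - f 0 - c 1%N * w.
  exact: (cvgB (cvgB (fc w w1) (cvg_cst (f 0))) (cvg_cst (c 1%N * w))).
apply: (cvgr_to_le (cvg_cabs h)); exists 2%N => // n /= n2.
have -> : series (fun k => c k * w ^+ k) n - f 0 - c 1%N * w = \sum_(2 <= k < n) c k * w ^+ k.
  rewrite /series /= (big_cat_nat (n := 2))//= big_nat_recl// big_nat1 f0 expr0 expr1 mulr1.
  by ring.
rewrite (le_trans (cabs_sum _ _ _))//.
apply: (@le_trans _ _ (\sum_(2 <= k < n) 16 * cabs w ^+ 2 * (cabs (c k) * 4^-1 ^+ k))).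
  rewrite big_nat_cond [leRHS]big_nat_cond; apply: ler_sum => k /andP[/andP[k2 _] _].
  rewrite cabsM cabsX -(subnK k2); move: (k - 2)%N => m.
  rewrite !exprD; have -> : (4^-1 : R) ^+ 2 = 16^-1 by field.
  have : cabs w ^+ m <= 4^-1 ^+ m by rewrite lerXn2r ?nnegrE ?cabs_ge0// ltW.
  move=> hm; rewrite [leRHS](_ : _ = cabs (c (m + 2)%N) * (4^-1 ^+ m * cabs w ^+ 2)); last by field.
  by rewrite ler_wpM2l ?cabs_ge0// ler_wpM2r// sqr_ge0.
rewrite -mulr_sumr mulrAC ler_wpM2r ?sqr_ge0// ler_wpM2l//.
rewrite (le_trans _ (hS n))// [leRHS](big_cat_nat (n := 2))//= lerDr sumr_ge0// => i _.
by rewrite mulr_ge0 ?cabs_ge0// exprn_ge0.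
Qed.

End Taylor.

(** * Möbius invariance and growth *)

Section DiscAut.
Context {R : realType}.
Implicit Types (a z w : Cplx R) (f g : Cplx R -> Cplx R).

Lemma cabs_lt1_sqr z : cabs z < 1 -> cabs z ^+ 2 < 1.
Proof. by move=> z1; rewrite expr_lt1// cabs_ge0. Qed.

(** The pseudohyperbolic identity. It shows that [disc_aut] preserves the disc and, with a real
    first argument, gives [1 - |b|^2] for the transformed kernel. *)
Lemma cabs_disc_identity a z :
  cabs (1 - conjc a * z) ^+ 2 = cabs (a - z) ^+ 2 + (1 - cabs a ^+ 2) * (1 - cabs z ^+ 2).
Proof. by rewrite !cabs_sqr; case: a z => a b [x y] /=; ring. Qed.

Lemma one_minus_cabs_ge (b z : Cplx R) : 1 - cabs b * cabs z <= cabs (1 - b * z).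
Proof. by rewrite -cabsM -cabs1 cabs_le_sub. Qed.

Lemma one_minus_neq0 (b z : Cplx R) : cabs b <= 1 -> cabs z < 1 -> 1 - b * z != 0.
Proof.
move=> b1 z1; apply/eqP => h; have := one_minus_cabs_ge b z; rewrite h cabs0.
have : cabs b * cabs z <= 1 * cabs z by rewrite ler_wpM2r ?cabs_ge0.
lra.
Qed.

Lemma disc_aut_lt1 a z : cabs a < 1 -> cabs z < 1 -> cabs (disc_aut a z) < 1.
Proof.
move=> a1 z1.
have n0 : 1 - conjc a * z != 0 by rewrite one_minus_neq0 ?cabs_conj// ltW.
rewrite cabsM cabsV ltr_pdivrMr ?cabs_gt0// mul1r.
rewrite -(@ltr_pXn2r _ 2)// ?nnegrE ?cabs_ge0// cabs_disc_identity ltrDl mulr_gt0// subr_gt0 cabs_lt1_sqr//.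
Qed.

Lemma disc_aut0 a : disc_aut a 0 = a.
Proof. by rewrite /disc_aut mulr0 !subr0 divr1. Qed.

Lemma has_cderiv_disc_aut a z : cabs a < 1 -> cabs z < 1 ->
  has_cderiv (disc_aut a) z (- (1 - a * conjc a) / (1 - conjc a * z) ^+ 2).
Proof.
move=> a1 z1.
set b := conjc a; have b1 : cabs b < 1 by rewrite cabs_conj.
have nz w : cabs w < 1 -> 1 - b * w != 0 by apply: one_minus_neq0; exact: ltW.
pose K := cabs ((1 - a * b) * b / (1 - b * z) ^+ 2) * (1 - cabs b)^-1.
apply: (@has_cderiv_quadratic _ _ _ _ K (1 - cabs z)); first by rewrite subr_gt0.
move=> w wz; have w1 : cabs w < 1.
  by have := cabs_le_sub w z; lra.
have n1 := nz z z1; have n2 := nz w w1.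
have -> : disc_aut a w - disc_aut a z - - (1 - a * b) / (1 - b * z) ^+ 2 * (w - z) =
  - ((1 - a * b) * b / (1 - b * z) ^+ 2) * (1 - b * w)^-1 * (w - z) ^+ 2.
  by rewrite /disc_aut -/b; field; rewrite n1 n2.
rewrite (cabsM _ (_ ^+ 2)) cabsX cabsM cabsN cabsV ler_wpM2r ?sqr_ge0// ler_wpM2l ?cabs_ge0//.
rewrite lef_pV2 ?posrE ?subr_gt0 ?cabs_gt0// (le_trans _ (one_minus_cabs_ge b w))//.
by rewrite lerD2l lerN2 -[leRHS]mulr1 ler_wpM2l ?cabs_ge0// ltW.
Qed.

Lemma cderiv_unique f z a b : has_cderiv f z a -> has_cderiv f z b -> a = b.
Proof. by move=> /has_cderivP[_ <-] /has_cderivP[_ <-]. Qed.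

Lemma has_cderivBcst f z a (k : Cplx R) : has_cderiv f z a -> has_cderiv (fun w => f w - k) z a.
Proof.
move=> h e e0; have [dl d0 hd] := h e e0; exists dl => // w wz.
by rewrite opprB addrA subrK; exact: hd.
Qed.

(** By Parseval the mean on the circle of radius [r] is at least [|c 1|^2 r^2]; then [r] tends to
    1. *)
Lemma hardy2_norm_ge_coef g (c : nat -> Cplx R) : power_series_of g c ->
  ((cabs (c 1%N))%:E <= hardy2_norm g)%E.
Proof.
move=> gc.
have h (r : R) : 0 <= r < 1 -> ((cabs (c 1%N) * r)%:E <= hardy2_norm g)%E.
  move=> r01; have [S [mg gS hc]] := circle_mean_cvg gc r01.
  have /andP[r0 _] := r01.
  apply: (@le_trans _ _ (sqrte (circle_mean2 g r))); last first.
    by apply: ereal_sup_ubound; exists r => //=; rewrite in_itv.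
  rewrite (circle_mean2_Rintegral mg gS) /= lee_fin.
  rewrite -(@ger0_norm _ (cabs (c 1%N) * r)) ?mulr_ge0 ?cabs_ge0//.
  rewrite -sqrtr_sqr ler_wsqrtr//; apply: (cvgr_to_ge hc).
  exists 2%N => // n /= n2; rewrite (bigD1_seq 1%N)/= ?mem_index_iota ?iota_uniq//.
  by rewrite exprMn lerDl sumr_ge0// => i _; rewrite mulr_ge0 ?sqr_ge0// exprn_ge0.
have : (0 <= hardy2_norm g)%E.
  have := h 0; rewrite mulr0; apply; lra.
move: h; case: (hardy2_norm g) => [x| |]//; last by move=> _ _; rewrite leey.
move=> h; rewrite !lee_fin => x0; rewrite leNgt; apply/negP => xc.
have c0 : 0 < cabs (c 1%N) by exact: le_lt_trans xc.
(* If [x < |c 1|], the radius halfway between [x / |c 1|] and 1 yields [(x + |c 1|) / 2 <= x], a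
   contradiction. *)
have := h ((x / cabs (c 1%N) + 1) / 2); rewrite lee_fin.
have xc1 : x / cabs (c 1%N) < 1 by rewrite ltr_pdivrMr// mul1r.
have xc0 : 0 <= x / cabs (c 1%N) by rewrite divr_ge0// ltW.
have -> : cabs (c 1%N) * ((x / cabs (c 1%N) + 1) / 2) = (x + cabs (c 1%N)) / 2.
  by field; rewrite gt_eqF.
move=> h'; suff : (x + cabs (c 1%N)) / 2 <= x by lra.
by apply: h'; apply/andP; split; lra.
Qed.

(** The chain rule at 0 shows that [(1 - |a|^2) |f'(a)|] is the modulus of the first Taylor
    coefficient of [f o disc_aut a - f a], which is at most its Hardy norm. *)
Lemma bloch_le_bmoa_seminorm f : analytic_disc f -> (bloch_seminorm f <= bmoa_seminorm f)%E.
Proof.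
move=> [df _]; apply: ge_ereal_sup => _ [a a1 <-].
rewrite /unit_disc /mkset in a1.
pose g z := f (disc_aut a z) - f a.
have dg z : cabs z < 1 -> has_cderiv g z
    (derive1 f (disc_aut a z) * (- (1 - a * conjc a) / (1 - conjc a * z) ^+ 2)).
  move=> z1; apply: has_cderivBcst; apply: has_cderiv_comp.
    exact: has_cderiv_disc_aut.
  by apply: derivable_has_cderiv; apply: df; exact: disc_aut_lt1.
have [c gc] : exists c, power_series_of g c.
  by apply: analytic_pseries => w /dg/has_cderivP[].
have z0 : cabs (0 : Cplx R) < 1 by rewrite cabs0.
have c1 := cderiv_unique (pseries_derive1_0 gc) (dg 0 z0).
apply: (@le_trans _ _ (hardy2_norm g)); last by apply: ereal_sup_ubound; exists a.
apply: le_trans (hardy2_norm_ge_coef gc).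
rewrite c1 disc_aut0 mulr0 subr0 expr1n divr1 cabsM cabsN mulJ_cabs -rtoC1 -rtoCB.
by rewrite cabs_rtoC ger0_norm// subr_ge0 ltW// cabs_lt1_sqr.
Qed.

Lemma bloch_seminorm_ge0 f : (0 <= bloch_seminorm f)%E.
Proof.
apply: (@le_trans _ _ (cabs (derive1 f 0) * (1 - cabs (0 : Cplx R) ^+ 2))%:E).
  by rewrite lee_fin cabs0 expr0n subr0 mulr1 cabs_ge0.
by apply: ereal_sup_ubound; exists 0 => //; rewrite /unit_disc /mkset cabs0.
Qed.

Lemma bloch_norm_ge0 f : (0 <= nnorm bloch f)%E.
Proof. by rewrite adde_ge0 ?bloch_seminorm_ge0// lee_fin cabs_ge0. Qed.

Lemma bloch_norm_le_bmoa f : analytic_disc f -> (nnorm bloch f <= nnorm bmoa f)%E.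
Proof. by move=> df; rewrite leeD2l// bloch_le_bmoa_seminorm. Qed.

Lemma bmoa_carrier_bloch f : carrier bmoa f -> carrier bloch f.
Proof.
move=> [df fB]; split => //; exact: le_lt_trans (bloch_le_bmoa_seminorm df) fB.
Qed.

End DiscAut.

Section BlochGrowth.
Context {R : realType}.
Implicit Types (f : Cplx R -> Cplx R) (z : Cplx R).

Lemma is_derive_eps (g : R -> R) (s l : R) :
  (forall e : R, 0 < e -> exists2 dl : R, 0 < dl & forall h, `|h| < dl ->
     `|g (h + s) - g s - l * h| <= e * `|h|) -> is_derive s 1 g l.
Proof.
move=> H.
have hc : (fun h : R => h^-1 *: ((g \o shift s) (h *: 1) - g s)) @ 0^' --> l.
  apply/cvgrPdist_le => e e0; have [dl d0 hd] := H e e0.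
  rewrite near_withinE; exists dl => // h /=; rewrite sub0r normrN => hdl h0.
  rewrite /GRing.scale /= mulr1 -(@ler_pM2r _ `|h|) ?normr_gt0// -normrM.
  apply: le_trans (hd _ hdl); rewrite -normrN le_eqVlt; apply/orP; left; apply/eqP; congr `|_|.
  by rewrite -mulNr opprB mulrBl mulrAC mulVf// mul1r.
split; first by apply/cvg_ex; exists l.
by apply: cvg_lim => //; exact: Rhausdorff.
Qed.

Lemma is_derive_radial f z (s : R) (a u : Cplx R) : has_cderiv f (rtoC s * z) a ->
  is_derive s 1 (fun x => Re (u * f (rtoC x * z))) (Re (u * (a * z))).
Proof.
move=> hf; apply: is_derive_eps => e e0.
set B := (cabs u + 1) * (cabs z + 1).
have B0 : 0 < B by rewrite mulr_gt0// ltr_wpDl ?cabs_ge0.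
have uz : cabs u * cabs z <= B by rewrite ler_pM ?cabs_ge0// lerDl.
have [dl d0 hd] := hf (e / B) (divr_gt0 e0 B0).
exists (dl / (cabs z + 1)) => [|h hdl]; first by rewrite divr_gt0// ltr_wpDl ?cabs_ge0.
have z10 : 0 < cabs z + 1 by rewrite ltr_wpDl ?cabs_ge0.
have E : rtoC (h + s) * z - rtoC s * z = rtoC h * z by rewrite rtoCD; ring.
have := hd (rtoC (h + s) * z); rewrite E cabsM cabs_rtoC => hd'.
have -> : Re (u * f (rtoC (h + s) * z)) - Re (u * f (rtoC s * z)) - Re (u * (a * z)) * h =
    Re (u * (f (rtoC (h + s) * z) - f (rtoC s * z) - a * (rtoC h * z))).
  have -> : u * (f (rtoC (h + s) * z) - f (rtoC s * z) - a * (rtoC h * z)) =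
    u * f (rtoC (h + s) * z) - u * f (rtoC s * z) - rtoC h * (u * (a * z)) by ring.
  by rewrite !ReB Re_rtoCM (mulrC h).
rewrite (le_trans (Re_le_cabs _))// cabsM.
apply: (@le_trans _ _ (cabs u * (e / B * (`|h| * cabs z)))).
  rewrite ler_wpM2l ?cabs_ge0//; apply: hd'.
  rewrite (@le_lt_trans _ _ (`|h| * (cabs z + 1)))//; last by rewrite -ltr_pdivlMr.
  by rewrite ler_wpM2l// lerDl.
rewrite [leLHS](_ : _ = e * `|h| * (cabs u * cabs z / B)); last by field; rewrite gt_eqF.
by rewrite -[leRHS]mulr1 ler_wpM2l ?mulr_ge0 ?(ltW e0)// ler_pdivrMr// mul1r.
Qed.

Lemma is_derive_ln_affine (r s : R) : r * s < 1 ->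
  is_derive s 1 (fun x => ln (1 - r * x)) (- r / (1 - r * s)).
Proof.
move=> rs; have h : is_derive s 1 (fun x : R => 1 - r * x) (- r).
  have h1 : is_derive s 1 (fun x : R => r * x) r.
    by rewrite -[X in is_derive _ _ _ X]mulr1; exact: is_deriveZ.
  have := @is_deriveB _ _ _ (cst (1 : R)) (fun x : R => r * x) s 1 0 r (is_derive_cst _ _ _) h1.
  by rewrite sub0r.
have p0 : 0 < 1 - r * s by lra.
by have := @is_derive1_comp _ (@ln R) (fun x => 1 - r * x) s _ _ (is_derive1_ln p0) h; rewrite mulrC.
Qed.

(** Along the segment from 0 to [z], and after a rotation making [f z - f 0] positive, the real part
    of [f] grows at rate at most [L r / (1 - r s)], the derivative of [- L ln (1 - r s)]. Hence
    [psi] is nonincreasing. *)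
Lemma bloch_growth f (L : R) z : analytic_disc f ->
  (forall w, cabs w < 1 -> cabs (derive1 f w) * (1 - cabs w ^+ 2) <= L) ->
  cabs z < 1 -> cabs (f z) <= cabs (f 0) - L * ln (1 - cabs z).
Proof.
move=> [df _] fL z1.
have L0 : 0 <= L.
  have := fL 0; rewrite cabs0 => /(_ ltr01); apply: le_trans.
  by rewrite expr0n subr0 mulr1 cabs_ge0.
have [u u1 uf] := exists_rotation (f z - f 0).
set r := cabs z in z1.
have r0 : 0 <= r by exact: cabs_ge0.
have sz (s : R) : 0 <= s <= 1 -> cabs (rtoC s * z) = s * r /\ s * r < 1.
  move=> /andP[s0 s1]; rewrite cabsM cabs_rtoC ger0_norm//; split => //.
  by apply: le_lt_trans z1; rewrite -[leRHS]mul1r ler_wpM2r.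
pose psi (s : R) := Re (u * f (rtoC s * z)) + L * ln (1 - r * s).
have dpsi (s : R) : 0 <= s <= 1 -> is_derive s 1 psi
    (Re (u * (derive1 f (rtoC s * z) * z)) + L * (- r / (1 - r * s))).
  move=> s01; have [e1 e2] := sz s s01.
  apply: is_deriveD.
    by apply: is_derive_radial; apply: derivable_has_cderiv; apply: df; rewrite /unit_disc /mkset e1.
  by apply: is_deriveZ; apply: is_derive_ln_affine; rewrite mulrC.
have cpsi : {within `[0, 1], continuous psi}.
  apply: continuous_in_subspaceT => s /set_mem /=; rewrite in_itv/= => s01.
  by apply/differentiable_continuous/derivable1_diffP; have [] := dpsi s s01.
have dpsi1 : {in `]0, 1[%R, forall s : R, derivable psi s 1}.
  move=> s; rewrite in_itv/= => /andP[/ltW s0 /ltW s1].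
  have s01 : 0 <= s <= 1 by rewrite s0.
  by have [] := dpsi s s01.
have npsi : {in `]0, 1[%R, forall s : R, derive1 psi s <= 0}.
  move=> s; rewrite in_itv/= => /andP[/ltW s0 /ltW s1].
  have s01 : 0 <= s <= 1 by rewrite s0.
  rewrite derive1E; have [_ ->] := dpsi s s01.
  have [e1 e2] := sz s s01.
  have w1 : cabs (rtoC s * z) < 1 by rewrite e1.
  have := fL _ w1; rewrite e1 => h.
  have p0 : 0 < 1 - r * s by rewrite mulrC; lra.
  have h2 : Re (u * (derive1 f (rtoC s * z) * z)) <= cabs (derive1 f (rtoC s * z)) * r.
    by rewrite (le_trans (ler_norm _))// (le_trans (Re_le_cabs _))// !cabsM u1 mul1r.
  suff : cabs (derive1 f (rtoC s * z)) <= L / (1 - r * s).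
    move=> h3; have : cabs (derive1 f (rtoC s * z)) * r <= L / (1 - r * s) * r by rewrite ler_wpM2r.
    have -> : L * (- r / (1 - r * s)) = - (L / (1 - r * s) * r) by field; rewrite gt_eqF.
    by move: h2 => /[swap]; move: (cabs _) (Re _) => *; lra.
  rewrite ler_pdivlMr//; apply: le_trans h; rewrite ler_wpM2l ?cabs_ge0//.
  have : 0 <= s * r by rewrite mulr_ge0.
  move: e2; rewrite (mulrC r); move: (s * r) => x *; nra.
have psi10 : psi 1 <= psi 0.
  by apply: (ler0_derive1_le_cc dpsi1 npsi cpsi); rewrite ?in_itv/= ?lexx ?ler01.
have : cabs (f z - f 0) <= - (L * ln (1 - r)).
  have -> : cabs (f z - f 0) = Re (u * (f z - f 0)) by rewrite uf.
  move: psi10; rewrite /psi rtoC1 rtoC0 mul1r mul0r mulr0 subr0 ln1 mulr0 addr0 mulr1.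
  by rewrite mulrBr ReB; move=> *; lra.
have := cabsD (f z - f 0) (f 0); rewrite subrK; lra.
Qed.

Definition elog (t : R) : R := ln (expR 1 / (1 - t)).

Lemma elogE (t : R) : t < 1 -> elog t = 1 - ln (1 - t).
Proof.
move=> t1; rewrite /elog ln_div ?posrE ?expR_gt0 ?subr_gt0//.
by rewrite expRK.
Qed.

Lemma elog_ge1 (t : R) : 0 <= t < 1 -> 1 <= elog t.
Proof.
move=> /andP[t0 t1]; rewrite elogE// lerBrDr gerDl ln_le0//; lra.
Qed.

(** Since [elog] is at least 1, the single factor [M * elog] absorbs [|f 0|] as well. *)
Lemma bloch_norm_growth f (M : R) z : carrier bloch f -> (nnorm bloch f <= M%:E)%E ->
  cabs z < 1 -> cabs (f z) <= M * elog (cabs z).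
Proof.
move=> [df fB] fM z1.
have fin : bloch_seminorm f \is a fin_num by rewrite ge0_fin_numE ?bloch_seminorm_ge0.
have [L hL] : exists L, bloch_seminorm f = L%:E by exists (fine (bloch_seminorm f)); rewrite fineK.
move: fM; rewrite /= hL -EFinD lee_fin => fM.
have fL w : cabs w < 1 -> cabs (derive1 f w) * (1 - cabs w ^+ 2) <= L.
  by move=> w1; rewrite -lee_fin -hL; apply: ereal_sup_ubound; exists w.
have L0 : 0 <= L by rewrite -lee_fin -hL bloch_seminorm_ge0.
have := bloch_growth df fL z1.
have z01 : 0 <= cabs z < 1 by rewrite cabs_ge0.
have := elog_ge1 z01; rewrite elogE//; have := cabs_ge0 (f 0).
by move: (cabs (f 0)) (cabs (f z)) (ln _) fM => x y l *; nra.
Qed.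

End BlochGrowth.

(** * Logarithmic Carleson measures *)

Section CarlesonIntegral.
Context {R : realType}.
Variable mu : {finite_measure set (measurableTypeR R) -> \bar R}.
Implicit Types (t s r M al : R).

Lemma measurable_fun_unit_itv (g : R -> R) (D : set R) : measurable D -> D `<=` `[0, 1[ ->
  (forall t, -1 < t < 1 -> {for t, continuous g}) ->
  measurable_fun (D : set (measurableTypeR R)) g.
Proof.
move=> mD D01 cg; apply: (@measurable_funS _ _ _ _ (`]-1, 1[ : set (measurableTypeR R))) => //.
  move=> t /D01 /=; rewrite !in_itv/= => /andP[t0 ->]; rewrite andbT.
  by apply: lt_le_trans t0; lra.
apply: open_continuous_measurable_fun; first exact: interval_open.
by move=> t /set_mem /=; rewrite in_itv/=; exact: cg.
Qed.

Lemma continuous_elog t : t < 1 -> {for t, continuous (@elog R)}.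
Proof.
move=> t1.
have h : (expR 1 / (1 - x)) @[x --> t] --> expR 1 / (1 - t).
  apply: cvgM; first exact: cvg_cst.
  by apply: cvgV; [rewrite gt_eqF// subr_gt0|apply: cvgB => //; exact: cvg_cst].
have p0 : 0 < expR 1 / (1 - t) by rewrite divr_gt0 ?expR_gt0// subr_gt0.
exact: (continuous_comp h (continuous_ln p0)).
Qed.

Lemma elog_le (s t : R) : s <= t -> t < 1 -> elog s <= elog t.
Proof.
move=> st t1; rewrite !elogE//; last exact: le_lt_trans t1.
by rewrite lerD2l lerN2 ler_ln ?posrE ?subr_gt0//; lra.
Qed.

(** The Carleson bound localised to [[r, 1)]. At [r = 0] it expresses the hypothesis on the measure;
    with [r] close to 1 any [M] above the limsup is allowed. *)
Definition carleson_at r M := forall s, r <= s -> s < 1 ->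
  fine (mu `[s, 1[%classic) * elog s <= M * (1 - s).

(** For [al = |a|] this is the kernel that bounds the square sum of the coefficients after
    composition with [disc_aut a]. For [al = 0] it is an integrable majorant of [elog]. *)
Definition shell_kernel al t := elog t / ((1 - t * al) * Num.sqrt (1 - t)).

Lemma shell_kernel_ge0 al t : 0 <= al < 1 -> 0 <= t < 1 -> 0 <= shell_kernel al t.
Proof.
move=> /andP[a0 a1] /[dup] t01 /andP[t0 t1]; rewrite divr_ge0//.
  by rewrite (le_trans _ (elog_ge1 t01)).
by rewrite mulr_ge0 ?sqrtr_ge0//; nra.
Qed.

Lemma measurable_shell_kernel al r : 0 <= al < 1 -> 0 <= r ->
  measurable_fun (`[r, 1%R[ : set (measurableTypeR R)) (shell_kernel al).
Proof.
move=> /andP[a0 a1] r0; apply: measurable_fun_unit_itv => //.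
  by move=> t /=; rewrite !in_itv/= => /andP[rt ->]; rewrite (le_trans r0).
move=> t /andP[t0 t1].
have d0 : (1 - t * al) * Num.sqrt (1 - t) != 0.
  by rewrite mulf_neq0// ?sqrtr_eq0 -?ltNge ?subr_gt0// gt_eqF//; nra.
apply: cvgM; first exact: continuous_elog.
apply: cvgV => //; apply: cvgM.
  by apply: cvgB; [exact: cvg_cst|apply: cvgM => //; exact: cvg_cst].
have h : (1 - x) @[x --> t] --> 1 - t by apply: cvgB => //; exact: cvg_cst.
exact: (continuous_comp h (@sqrt_continuous _ _)).
Qed.

(* Split [r, 1) at the points [1 - (1 - r) / 4 ^ j]. *)
Section Shells.
Variables (r M al : R).
Hypothesis r01 : 0 <= r < 1.
Hypothesis al01 : 0 <= al < 1.
Hypothesis hM : carleson_at r M.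

(** Square roots of the distances of [al] and [p_ j] to 1: apart from the logarithm, all bounds on
    the shells become rational in [c] and [s_ j]. *)
Let c := Num.sqrt (1 - al).
Let s_ (j : nat) := Num.sqrt (1 - r) / 2 ^+ j.
Let p_ (j : nat) := 1 - s_ j ^+ 2.
(** The bound of the kernel on the shell [[p_ j, p_ j.+1)]. The 16 is 4 from [elog_p] times 4 from
    [1 - t al >= (s_ j.+1 + c)^2 / 4]. *)
Let k_ (j : nat) := 16 * elog (p_ j) / ((s_ j.+1 + c) ^+ 2 * s_ j.+1).

Let c0 : 0 < c. Proof. by rewrite sqrtr_gt0 subr_gt0; case/andP: al01. Qed.
Let c2 : c ^+ 2 = 1 - al. Proof. by rewrite sqr_sqrtr// subr_ge0 ltW//; case/andP: al01. Qed.
Let s0 j : 0 < s_ j.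
Proof. by rewrite divr_gt0 ?exprn_gt0// sqrtr_gt0 subr_gt0; case/andP: r01. Qed.
Let sS j : s_ j = 2 * s_ j.+1.
Proof. by rewrite /s_ exprS; field; rewrite expf_neq0. Qed.
Let sS2 j : s_ j ^+ 2 = 4 * s_ j.+1 ^+ 2.
Proof. by rewrite (sS j); move: (s_ j.+1) => x; ring. Qed.
Let p00 : p_ 0%N = r.
Proof. by rewrite /p_ /s_ expr0 divr1 sqr_sqrtr; [lra|case/andP: r01 => _ /ltW; rewrite subr_ge0]. Qed.
Let p_lt1 j : p_ j < 1.
Proof. by rewrite /p_ ltrBlDr ltrDl exprn_gt0. Qed.
Let p_S j : p_ j <= p_ j.+1.
Proof.
rewrite /p_ sS2; have := sqr_ge0 (s_ j.+1); move: (s_ j.+1 ^+ 2) => x *; lra.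
Qed.
Let p_ge j : r <= p_ j.
Proof. by elim: j => [|j IH]; rewrite ?p00// (le_trans IH). Qed.
Let p_01 j : 0 <= p_ j < 1.
Proof. by rewrite p_lt1 (le_trans _ (p_ge j))//; case/andP: r01. Qed.
Let k_ge0 j : 0 <= k_ j.
Proof.
rewrite divr_ge0//; first by rewrite mulr_ge0// (le_trans _ (elog_ge1 (p_01 j))).
by rewrite mulr_ge0 ?sqr_ge0// ltW.
Qed.

(** The distance to 1 is divided by 4, which adds [ln 4 <= 3] to a quantity that is at least 1. *)
Let elog_p j : elog (p_ j.+1) <= 4 * elog (p_ j).
Proof.
have l1 := elog_ge1 (p_01 j); move: l1; rewrite !elogE//.
have e1 : 1 - p_ j.+1 = s_ j.+1 ^+ 2 by rewrite /p_ opprB addrC subrK.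
have e2 : 1 - p_ j = 4 * s_ j.+1 ^+ 2 by rewrite /p_ opprB addrC subrK sS2.
rewrite e1 e2 lnM ?posrE ?exprn_gt0//.
have : ln (4 : R) <= 3.
  have -> : 4 = 1 + 3 :> R by lra.
  by apply: le_ln1Dx; lra.
lra.
Qed.

(** [1 - t al] dominates both [1 - t >= s_ j.+1 ^ 2] and [1 - al = c ^ 2], hence their average and
    so [(s_ j.+1 + c)^2 / 4]. *)
Let kernel_bound j t : p_ j <= t -> t < p_ j.+1 -> shell_kernel al t <= k_ j.
Proof.
move=> pt tp; have /andP[pj0 _] := p_01 j.
have t01 : 0 <= t < 1 by rewrite (le_trans pj0)//= (lt_trans tp).
have /andP[t0 t1] := t01; have /andP[a0 a1] := al01.
have s1t : s_ j.+1 ^+ 2 <= 1 - t by move: tp; rewrite /p_; lra.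
have h1 : elog t <= 4 * elog (p_ j).
  by rewrite (le_trans _ (elog_p j))// elog_le// ltW.
have h2 : (s_ j.+1 + c) ^+ 2 / 4 <= 1 - t * al.
  have : c ^+ 2 <= 1 - t * al by rewrite c2; nra.
  have : 1 - t <= 1 - t * al by nra.
  have := sqr_ge0 (s_ j.+1 - c); nra.
have h3 : s_ j.+1 <= Num.sqrt (1 - t).
  by rewrite -(ger0_norm (ltW (s0 j.+1))) -sqrtr_sqr ler_wsqrtr.
have sc : 0 < (s_ j.+1 + c) ^+ 2 by rewrite exprn_gt0// addr_gt0.
have d0 : 0 < (s_ j.+1 + c) ^+ 2 / 4 * s_ j.+1 by rewrite mulr_gt0// divr_gt0.
have d1 : (s_ j.+1 + c) ^+ 2 / 4 * s_ j.+1 <= (1 - t * al) * Num.sqrt (1 - t).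
  by rewrite ler_pM// ltW// divr_gt0.
have e0 : 0 <= elog t by rewrite (le_trans _ (elog_ge1 t01)).
rewrite /shell_kernel; apply: (@le_trans _ _ (4 * elog (p_ j) / ((s_ j.+1 + c) ^+ 2 / 4 * s_ j.+1))).
  apply: ler_pM => //; first by rewrite invr_ge0 (le_trans (ltW d0)).
  by rewrite lef_pV2 ?posrE// (lt_le_trans d0).
rewrite /k_ le_eqVlt; apply/orP; left; apply/eqP; field.
by rewrite !gt_eqF ?addr_gt0.
Qed.

Let find_shell t : r <= t < 1 -> exists j, p_ j <= t < p_ j.+1.
Proof.
move=> /andP[rt t1].
have [n hn] : exists n, t < p_ n.
  have cv : p_ n @[n --> \oo] --> (1 : R).
    rewrite -[X in _ --> X]subr0; apply: cvgB; first exact: cvg_cst.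
    rewrite (_ : 0 = (Num.sqrt (1 - r) * 0) * (Num.sqrt (1 - r) * 0)); last by rewrite !mulr0.
    have h : s_ n @[n --> \oo] --> Num.sqrt (1 - r) * 0.
      apply: cvgM; first exact: cvg_cst.
      apply: (cvg_eq1 (u := fun n => (2^-1 : R) ^+ n)) => [n|]; first by rewrite exprVn.
      by apply: cvg_expr; rewrite ger0_norm ?invr_ge0// invf_lt1// ltr1n.
    exact: (cvgM h h).
  have [n _ /(_ n (leqnn n)) h] := cvgr_gt _ cv _ t1.
  by exists n.
elim: n hn => [|n IH hn]; first by rewrite p00 ltNge rt.
have [/IH//|h] := ltP t (p_ n).
by exists n; rewrite h.
Qed.

Let mass_bound j : k_ j * fine (mu `[p_ j, 1%R[%classic) <= 64 * M * (s_ j.+1 / (s_ j.+1 + c) ^+ 2).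
Proof.
have := hM (p_ge j) (p_lt1 j).
have l1 := elog_ge1 (p_01 j).
have -> : 1 - p_ j = 4 * s_ j.+1 ^+ 2 by rewrite /p_ opprB addrC subrK sS2.
set m := fine _ => h.
have sc : 0 < (s_ j.+1 + c) ^+ 2 * s_ j.+1 by rewrite mulr_gt0// exprn_gt0// addr_gt0.
rewrite [leRHS](_ : _ = 16 * (M * (4 * s_ j.+1 ^+ 2)) / ((s_ j.+1 + c) ^+ 2 * s_ j.+1)); last first.
  by field; rewrite !gt_eqF ?addr_gt0.
rewrite /k_ [leLHS](_ : _ = 16 * (m * elog (p_ j)) / ((s_ j.+1 + c) ^+ 2 * s_ j.+1)); last first.
  by field; rewrite !gt_eqF ?addr_gt0.
by rewrite ler_wpM2r ?invr_ge0 ?(ltW sc)// ler_wpM2l.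
Qed.

Let M_ge0 : 0 <= M.
Proof.
have /andP[r0 r1] := r01; have := hM (lexx r) r1 => h.
have : 0 <= M * (1 - r).
  apply: le_trans h; rewrite mulr_ge0 ?fine_ge0//.
  by rewrite (le_trans _ (elog_ge1 r01)).
by rewrite pmulr_lge0// subr_gt0.
Qed.

(** [G] is a primitive of [1 / (s + c)^2], so the sum is compared, like a Riemann sum, with the
    increments of [G] between successive [s_ j]; moreover [0 <= G <= 1 / c]. *)
Let telescope N : \sum_(0 <= j < N) s_ j.+1 / (s_ j.+1 + c) ^+ 2 <= 2 / c.
Proof.
pose G (s : R) := s / (c * (c + s)).
have step j : s_ j.+1 / (s_ j.+1 + c) ^+ 2 <= 2 * (G (s_ j) - G (s_ j.+1)).
  rewrite (sS j) /G; have s1 := s0 j.+1; move: (s_ j.+1) s1 => s s1.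
  have -> : 2 * s / (c * (c + 2 * s)) - s / (c * (c + s)) = s / ((c + 2 * s) * (c + s)).
    have n1 : c + s != 0 by rewrite gt_eqF// addr_gt0.
    have n2 : c + 2 * s != 0 by rewrite gt_eqF// addr_gt0// mulr_gt0.
    have n3 : c != 0 by rewrite gt_eqF.
    by field; rewrite n1 n2 n3.
  have PQ : (c + 2 * s) * (c + s) <= 2 * (s + c) ^+ 2.
    by have := mulr_gt0 c0 s1; have := sqr_ge0 c; move: c => x *; nra.
  have P0 : 0 < (c + 2 * s) * (c + s) by rewrite mulr_gt0 ?addr_gt0// mulr_gt0.
  have Q0 : 0 < (s + c) ^+ 2 by rewrite exprn_gt0// addr_gt0.
  rewrite mulrCA ler_wpM2l ?(ltW s1)//.
  by rewrite -[leLHS]mul1r ler_pdivrMr// mulrAC ler_pdivlMr// mul1r.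
apply: (@le_trans _ _ (\sum_(0 <= j < N) 2 * (G (s_ j) - G (s_ j.+1)))); first exact: ler_sum.
rewrite -mulr_sumr ler_pM2l//.
have -> : \sum_(0 <= j < N) (G (s_ j) - G (s_ j.+1)) = G (s_ 0%N) - G (s_ N).
  elim: N => [|N IH]; first by rewrite big_nil subrr.
  by rewrite big_nat_recr//= IH; lra.
have G0 j : 0 <= G (s_ j) by rewrite divr_ge0 ?mulr_ge0 ?addr_ge0// ltW.
have : G (s_ 0%N) <= c^-1.
  rewrite /G invfM mulrCA -[leRHS]mulr1 ler_wpM2l ?invr_ge0 ?(ltW c0)//.
  by rewrite ler_pdivrMr ?addr_gt0// mul1r lerDr ltW.
by have := G0 N; lra.
Qed.

(** The kernel is majorised by the sum of [k_ j] times the indicator of the whole tail [[p_ j, 1)],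
    since tails are the sets whose mass [carleson_at] controls. The 128 is 64 from [mass_bound]
    times 2 from [telescope]. *)
Lemma shell_integral_ereal :
  (\int[mu]_(t in `[r, 1%R[) (shell_kernel al t)%:E <= (128 * M / Num.sqrt (1 - al))%:E)%E.
Proof.
have /andP[r0 r1] := r01.
pose f j t := (k_ j * \1_(`[p_ j, 1%R[%classic) t)%:E.
have mf j : measurable_fun (`[r, 1%R[ : set (measurableTypeR R)) (f j).
  apply/measurable_EFinP; apply: measurable_funM; first exact: measurable_cst.
  exact: measurable_indic.
have f0 j t : (0%R <= f j t)%E by rewrite lee_fin mulr_ge0.
apply: (@le_trans _ _ (\int[mu]_(t in `[r, 1%R[) (\sum_(0 <= j <oo) f j t)))%E.
  apply: ge0_le_integral => //.
  - move=> t /=; rewrite in_itv/= => /andP[rt t1]; rewrite lee_fin shell_kernel_ge0//.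
    by rewrite (le_trans r0).
  - by apply/measurable_EFinP; exact: measurable_shell_kernel.
  - exact: ge0_emeasurable_sum.
  move=> t /=; rewrite in_itv/= => /find_shell[j /andP[pt tp]].
  apply: le_trans (@nneseries_lim_ge R (f^~ t) xpredT 0%N j.+1 _); last by move=> n _ _.
  rewrite big_nat_recr//=; apply: (@le_trans _ _ (f j t)).
    rewrite lee_fin indicE mem_set ?mulr1; first exact: kernel_bound.
    by rewrite /= in_itv/= pt (lt_trans tp).
  by rewrite leeDr// sume_ge0.
rewrite integral_nneseries//.
apply: lime_le; first by apply: is_cvg_nneseries => n _ _; exact: integral_ge0.
apply: nearW => N.
have E j : (\int[mu]_(t in `[r, 1%R[) f j t)%E = (k_ j * fine (mu `[p_ j, 1%R[%classic))%:E.
  rewrite (@integralZl_indic _ _ R mu _ (measurable_itv _)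
    (fun=> (`[p_ j, 1%R[%classic : set (measurableTypeR R))) (k_ j))//; last first.
    by move=> k0; have := k_ge0 j; rewrite leNgt k0.
  rewrite integral_indic// [RHS]EFinM fineK ?fin_num_measure//; congr (_ * mu _)%E.
  apply/setIidl => t /=; rewrite !in_itv/= => /andP[pt ->].
  by rewrite (le_trans (p_ge j)).
under eq_bigr do rewrite E.
rewrite sumEFin lee_fin; apply: (@le_trans _ _ (\sum_(0 <= j < N) 64 * M * (s_ j.+1 / (s_ j.+1 + c) ^+ 2))).
  by apply: ler_sum => j _; exact: mass_bound.
rewrite -mulr_sumr (_ : 128 * M / Num.sqrt (1 - al) = 64 * M * (2 / c)); last by rewrite /c; ring.
by rewrite ler_wpM2l// mulr_ge0.
Qed.

End Shells.

Lemma shell_integral r M al : 0 <= r < 1 -> 0 <= al < 1 -> carleson_at r M ->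
  mu.-integrable `[r, 1%R[ (EFin \o shell_kernel al) /\
  \int[mu]_(t in `[r, 1%R[) shell_kernel al t <= 128 * M / Num.sqrt (1 - al).
Proof.
move=> r01 al01 hM; have h := shell_integral_ereal r01 al01 hM.
have /andP[r0 r1] := r01.
have k0 t : `[r, 1%R[%classic t -> 0 <= shell_kernel al t.
  rewrite /= in_itv/= => /andP[rt t1]; apply: shell_kernel_ge0 => //.
  by rewrite (le_trans r0).
have fin : (\int[mu]_(t in `[r, 1%R[) (shell_kernel al t)%:E)%E \is a fin_num.
  rewrite ge0_fin_numE; first exact: le_lt_trans h (ltry _).
  by apply: integral_ge0 => t /k0; rewrite lee_fin.
split; last by rewrite -lee_fin fineK.
apply/integrableP; split; first by apply/measurable_EFinP; exact: measurable_shell_kernel.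
under eq_integral => t /set_mem /k0 h0 do rewrite /= ger0_norm//.
exact: le_lt_trans h (ltry _).
Qed.

End CarlesonIntegral.

(** * Integral representation of the Hilbert operator *)

Section CauchyTransform.
Context {R : realType}.
Variable mu : {finite_measure set (measurableTypeR R) -> \bar R}.
Implicit Types (z w : Cplx R) (F : R -> Cplx R).

Lemma cmeasurable_unit_itv (D : set R) F : measurable (D : set (measurableTypeR R)) ->
  D `<=` `[0, 1%R[ ->
  (forall t : R, -1 < t < 1 -> {for t, continuous F}) ->
  cmeasurable (D : set (measurableTypeR R)) F.
Proof.
move=> mD D01 cF; split; apply: measurable_fun_unit_itv => // t t1.
  by apply: cvg_Re; exact: cF.
by apply: cvg_Im; exact: cF.
Qed.

Lemma continuous_rtoC : continuous (@rtoC R).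
Proof. by move=> t; apply: cvg_rtoC. Qed.

Lemma cabs_rtoC_lt1 (t : R) : -1 < t < 1 -> cabs (rtoC t) < 1.
Proof. by move=> /andP[t0 t1]; rewrite cabs_rtoC ltr_norml t0. Qed.

Lemma kernel_neq0 (t : R) z : -1 < t < 1 -> cabs z < 1 -> 1 - rtoC t * z != 0.
Proof. by move=> t1 z1; apply: one_minus_neq0 => //; exact/ltW/cabs_rtoC_lt1. Qed.

Lemma cmeasurable_kernel (D : set R) z : measurable (D : set (measurableTypeR R)) ->
  D `<=` `[0, 1%R[ -> cabs z < 1 ->
  cmeasurable (D : set (measurableTypeR R)) (fun t => (1 - rtoC t * z)^-1).
Proof.
move=> mD D01 z1; apply: cmeasurable_unit_itv => // t t1.
apply: cvgV; first exact: kernel_neq0.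
apply: cvgB; first exact: cvg_cst.
by apply: cvgM; [exact: continuous_rtoC|exact: cvg_cst].
Qed.

Lemma cabs_kernel_ge (t : R) z : 0 <= t < 1 -> 1 - cabs z <= cabs (1 - rtoC t * z).
Proof.
move=> /andP[t0 t1]; rewrite (le_trans _ (one_minus_cabs_ge _ _))//.
by rewrite cabs_rtoC ger0_norm// lerD2l lerN2 ler_piMl ?cabs_ge0// ltW.
Qed.

Lemma cabs_kernel_le (t : R) z : 0 <= t < 1 -> cabs z < 1 ->
  cabs (1 - rtoC t * z)^-1 <= (1 - cabs z)^-1.
Proof.
move=> t01 z1; rewrite cabsV lef_pV2 ?posrE ?subr_gt0 ?cabs_kernel_ge//.
by apply: lt_le_trans (cabs_kernel_ge z t01); rewrite subr_gt0.
Qed.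

Lemma unit_itv_ltN1 (t : R) : 0 <= t < 1 -> -1 < t < 1.
Proof. by move=> /andP[t0 ->]; rewrite andbT; apply: lt_le_trans t0; lra. Qed.

Definition cauchy_transform (D : set R) F z : Cplx R :=
  cintegral mu D (fun t => F t * (1 - rtoC t * z)^-1).

Section Derivative.
Variables (D : set R) (F : R -> Cplx R).
Hypothesis mD : measurable (D : set (measurableTypeR R)).
Hypothesis D01 : D `<=` `[0, 1%R[.
Hypothesis iF : cintegrable mu D F.

Let Dt t : D t -> 0 <= t < 1. Proof. by move=> /D01 /=; rewrite in_itv. Qed.

Lemma cintegrable_kernel z : cabs z < 1 ->
  cintegrable mu D (fun t => F t * (1 - rtoC t * z)^-1).
Proof.
move=> z1.
have h : cintegrable mu D (fun t => (1 - rtoC t * z)^-1 * F t).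
  apply: (@cintegrableMl _ _ _ mu _ mD _ (fun t => (1 - rtoC t * z)^-1) (1 - cabs z)^-1) => //.
    exact: cmeasurable_kernel.
  by move=> t /Dt t01; exact: cabs_kernel_le.
by apply: (eq_cintegrable mD _ h) => t _; rewrite mulrC.
Qed.

Lemma cintegrable_kernel2 z : cabs z < 1 ->
  cintegrable mu D (fun t => F t * (rtoC t * (1 - rtoC t * z)^-1 ^+ 2)).
Proof.
move=> z1.
have h : cintegrable mu D (fun t => rtoC t * (1 - rtoC t * z)^-1 ^+ 2 * F t).
  apply: (@cintegrableMl _ _ _ mu _ mD _ (fun t => rtoC t * (1 - rtoC t * z)^-1 ^+ 2) ((1 - cabs z)^-1 ^+ 2)) => //.
    apply: cmeasurableM; last by apply: cmeasurableX; exact: cmeasurable_kernel.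
    by apply: cmeasurable_unit_itv => // t _; exact: continuous_rtoC.
  move=> t /Dt /[dup] t01 /andP[t0 t1]; rewrite cabsM cabsX cabs_rtoC ger0_norm//.
  rewrite -[leRHS]mul1r ler_pM ?exprn_ge0 ?cabs_ge0 ?(ltW t1)//.
  by rewrite lerXn2r ?nnegrE ?cabs_ge0 ?cabs_kernel_le// invr_ge0 subr_ge0 ltW.
by apply: (eq_cintegrable mD _ h) => t _; rewrite mulrC.
Qed.

(** The second-order remainder of [1 / (1 - t w)] at [z] is exactly
    [t^2 (w - z)^2 / ((1 - t z)^2 (1 - t w))]. For [w] within half the distance from [z] to the unit
    circle it is at most [K |w - z|^2], uniformly in [t]. *)
Lemma has_cderiv_cauchy_transform z : cabs z < 1 ->
  has_cderiv (cauchy_transform D F) z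
    (cintegral mu D (fun t => F t * (rtoC t * (1 - rtoC t * z)^-1 ^+ 2))).
Proof.
move=> z1; have [g ig Fg] := cintegrable_cabs mD iF.
set x := 1 - cabs z; have x0 : 0 < x by rewrite subr_gt0.
pose K := x^-1 ^+ 2 * (x / 2)^-1.
apply: (@has_cderiv_quadratic _ _ _ _ (K * \int[mu]_(t in D) g t) (x / 2)); first by lra.
move=> w wz.
have wx : x / 2 <= 1 - cabs w by have := cabs_le_sub w z; rewrite /x in wz *; lra.
have w1 : cabs w < 1 by lra.
have E : cauchy_transform D F w - cauchy_transform D F z -
    cintegral mu D (fun t => F t * (rtoC t * (1 - rtoC t * z)^-1 ^+ 2)) * (w - z) =
    cintegral mu D (fun t => (w - z) ^+ 2 * (rtoC t ^+ 2 * (1 - rtoC t * z)^-1 ^+ 2 * (1 - rtoC t * w)^-1) * F t).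
  rewrite -cintegralB//; [|exact: cintegrable_kernel|exact: cintegrable_kernel].
  rewrite mulrC -cintegralZ//; last exact: cintegrable_kernel2.
  rewrite -cintegralB//; last 2 first.
  - by apply: cintegrableB => //; exact: cintegrable_kernel.
  - by apply: cintegrableZ => //; exact: cintegrable_kernel2.
  apply: eq_cintegral => t /Dt /unit_itv_ltN1 t1.
  have n1 := kernel_neq0 t1 z1; have n2 := kernel_neq0 t1 w1.
  by field; rewrite n1 n2.
rewrite E.
have iK : mu.-integrable D (EFin \o (fun t => K * cabs (w - z) ^+ 2 * g t)).
  by have := integrableZl mD (K * cabs (w - z) ^+ 2) ig; exact: eq_integrable.
have hb t : D t -> cabs ((w - z) ^+ 2 *
    (rtoC t ^+ 2 * (1 - rtoC t * z)^-1 ^+ 2 * (1 - rtoC t * w)^-1) * F t) <=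
    K * cabs (w - z) ^+ 2 * g t.
  move=> Dtt; have t01 := Dt Dtt; have /andP[t0 t1] := t01.
  rewrite (cabsM _ (F t)) ler_pM ?cabs_ge0//; last exact: Fg.
  rewrite (cabsM (_ ^+ 2)) cabsX mulrC ler_wpM2r ?sqr_ge0//.
  rewrite cabsM /K ler_pM ?cabs_ge0//.
    rewrite (cabsM (_ ^+ 2)) !cabsX cabs_rtoC ger0_norm// -[leRHS]mul1r ler_pM ?sqr_ge0//.
      by rewrite expr_le1// ltW.
    by rewrite lerXn2r ?nnegrE ?cabs_ge0 ?cabs_kernel_le// invr_ge0 ltW.
  rewrite (le_trans (cabs_kernel_le t01 w1))// lef_pV2 ?posrE//; lra.
rewrite mulrAC -RintegralZl//.
apply: cabs_cintegral_le => //.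
apply: (cintegrable_le mD _ iK hb).
apply: cmeasurableM; last exact: cintegrable_measurable iF.
apply: cmeasurableM; first exact: cmeasurable_cst.
apply: cmeasurableM; last exact: cmeasurable_kernel.
apply: cmeasurableM; last by apply: cmeasurableX; exact: cmeasurable_kernel.
by apply: cmeasurableX; apply: cmeasurable_unit_itv => // t _; exact: continuous_rtoC.
Qed.

End Derivative.

End CauchyTransform.

Section HilbertIntegral.
Context {R : realType}.
Variable mu : {finite_measure set (measurableTypeR R) -> \bar R}.
Implicit Types (z w : Cplx R) (f : Cplx R -> Cplx R) (t M L : R).

Lemma log_carleson_at : log_carleson mu -> exists2 M, 0 <= M & carleson_at mu 0 M.
Proof.
move=> [C0 [C00 h]]; exists C0; first exact: ltW.
move=> s s0 s1; have := h s; rewrite s0 s1 => /(_ isT) hs.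
have e : mu `[s, 1%R[%classic = (fine (mu `[s, 1%R[%classic))%:E by rewrite fineK ?fin_num_measure.
by move: hs; rewrite [X in (X * _)%E]e -EFinM lee_fin.
Qed.

Lemma bloch_taylor f : carrier bloch f -> power_series_of f (taylor_coef f).
Proof. by move=> [[df _] _]; apply: taylor_coefP. Qed.

Lemma bloch_norm_fin f : carrier bloch f -> exists2 L, 0 <= L & nnorm bloch f = L%:E.
Proof.
move=> [df fB]; exists (fine (nnorm bloch f)); first by rewrite fine_ge0// bloch_norm_ge0.
rewrite fineK// ge0_fin_numE ?bloch_norm_ge0//= lte_add_pinfty//.
exact: ltry.
Qed.

Lemma shell_kernel0 t : 0 <= t < 1 -> elog t <= shell_kernel 0 t.
Proof.
move=> /[dup] t01 /andP[t0 t1]; rewrite /shell_kernel mulr0 subr0 mul1r.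
rewrite ler_pdivlMr ?sqrtr_gt0 ?subr_gt0// ler_piMr//.
  by rewrite (le_trans _ (elog_ge1 t01)).
by rewrite -[leRHS]sqrtr1 ler_wsqrtr// gerBl.
Qed.

(** [1 - sqrt t >= (1 - t) / 2] and [ln 2 <= 1], so the logarithm increases by at most 1, which is
    at most [elog t]. *)
Lemma elog_sqrt t : 0 <= t < 1 -> Num.sqrt t < 1 /\ elog (Num.sqrt t) <= 2 * elog t.
Proof.
move=> /[dup] t01 /andP[t0 t1].
have s1 : Num.sqrt t < 1 by rewrite -[ltRHS]sqrtr1 ltr_sqrt.
split => //; have l1 := elog_ge1 t01; move: l1; rewrite !elogE// => l1.
have s0 : 0 <= Num.sqrt t by exact: sqrtr_ge0.
have ss := sqr_sqrtr t0.
have : ln ((1 - t) / 2) <= ln (1 - Num.sqrt t).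
  by rewrite ler_ln ?posrE ?divr_gt0 ?subr_gt0//; nra.
rewrite ln_div ?posrE ?subr_gt0//.
have : ln (2 : R) <= 1.
  have -> : 2 = 1 + 1 :> R by lra.
  by apply: le_ln1Dx; lra.
lra.
Qed.

(* Cauchy-Schwarz on the circle of radius [sqrt t], in the AM-GM form
   [|c| s <= (h |c|^2 s + s / h) / 2]. *)
Lemma bloch_coef_sum_le f L t N : carrier bloch f -> (nnorm bloch f <= L%:E)%E -> 0 <= t < 1 ->
  \sum_(0 <= k < N) cabs (taylor_coef f k) * t ^+ k <= (4 * L ^+ 2 + 1) / 2 * shell_kernel 0 t.
Proof.
move=> bf fL /[dup] t01 /andP[t0 t1].
have L0 : 0 <= L by rewrite -lee_fin (le_trans _ fL)// bloch_norm_ge0.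
have [s1 es] := elog_sqrt t01.
set s := Num.sqrt t in s1 es; have s0 : 0 <= s by exact: sqrtr_ge0.
have s01 : 0 <= s < 1 by rewrite s0.
have l1 := elog_ge1 t01; set l := elog t in es l1.
have sk k : s ^+ (k * 2) = t ^+ k by rewrite mulnC exprM sqr_sqrtr.
have sq : \sum_(0 <= k < N) cabs (taylor_coef f k) ^+ 2 * t ^+ k <= (2 * L * l) ^+ 2.
  under eq_bigr do rewrite -sk.
  apply: (coef_square_sum_le (bloch_taylor bf) s01) => z zs.
  have z1 : cabs z < 1 by rewrite zs.
  rewrite (le_trans (bloch_norm_growth bf fL z1))// zs.
  by rewrite [leRHS](_ : _ = L * (2 * l)) ?ler_wpM2l//; ring.
have geo := @sum_geometric_le R t N t01.
set q := Num.sqrt (1 - t).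
have q0 : 0 < q by rewrite sqrtr_gt0 subr_gt0.
have q2 : q ^+ 2 = 1 - t by rewrite sqr_sqrtr// subr_ge0 ltW.
have l0 : 0 < l by lra.
have h0 : 0 < l * q by rewrite mulr_gt0.
(* The weight [h = l * q] balances the bounds [(2 L l)^2] of the square sum and [1 / q^2] of the
   geometric sum: both halves become multiples of [l / q = shell_kernel 0 t]. *)
apply: (@le_trans _ _ (\sum_(0 <= k < N)
   ((l * q)^-1 / 2 * (cabs (taylor_coef f k) ^+ 2 * t ^+ k) + (l * q) / 2 * t ^+ k))).
  apply: ler_sum => k _; have tk : 0 <= t ^+ k by rewrite exprn_ge0.
  rewrite mulrA -mulrDl ler_wpM2r//; set x := cabs _; move: (l * q) h0 => h h0.
  have -> : h^-1 / 2 * x ^+ 2 + h / 2 = (x ^+ 2 + h ^+ 2) / (2 * h) by field; rewrite gt_eqF.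
  rewrite ler_pdivlMr ?mulr_gt0//; have := sqr_ge0 (x - h); nra.
rewrite big_split /= -!mulr_sumr.
have -> : (4 * L ^+ 2 + 1) / 2 * shell_kernel 0 t =
    (l * q)^-1 / 2 * (2 * L * l) ^+ 2 + l * q / 2 * (1 - t)^-1.
  rewrite /shell_kernel mulr0 subr0 mul1r -/q -/l -q2.
  by field; rewrite !gt_eqF.
have h1 : 0 <= (l * q)^-1 / 2 by rewrite divr_ge0 ?invr_ge0// ltW.
have h2 : 0 <= l * q / 2 by rewrite divr_ge0// ltW.
by rewrite lerD// ler_wpM2l.
Qed.

Lemma bloch_continuous f z : carrier bloch f -> cabs z < 1 -> {for z, continuous f}.
Proof. by move=> [[df _] _] z1; apply: has_cderiv_continuous (derivable_has_cderiv (df z z1)). Qed.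

Lemma bloch_cmeasurable f (D : set R) : carrier bloch f ->
  measurable (D : set (measurableTypeR R)) -> D `<=` `[0, 1%R[ ->
  cmeasurable (D : set (measurableTypeR R)) (fun t => f (rtoC t)).
Proof.
move=> bf mD D01; apply: cmeasurable_unit_itv => // t t1.
have cf : {for rtoC t, continuous f} by apply: bloch_continuous => //; exact: cabs_rtoC_lt1.
exact: (continuous_comp (@continuous_rtoC R t) cf).
Qed.

Lemma bloch_le_elog f L t : carrier bloch f -> (nnorm bloch f <= L%:E)%E -> 0 <= t < 1 ->
  cabs (f (rtoC t)) <= L * elog t.
Proof.
move=> bf fL /[dup] t01 /andP[t0 t1].
have := bloch_norm_growth bf fL (cabs_rtoC_lt1 (unit_itv_ltN1 t01)).
by rewrite cabs_rtoC ger0_norm.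
Qed.

Variable M : R.
Hypothesis hM : carleson_at mu 0 M.

Let m01 : measurable (`[0, 1%R[%classic : set (measurableTypeR R)).
Proof. exact: measurable_itv. Qed.

Let i0 : mu.-integrable `[0, 1%R[ (EFin \o (@shell_kernel R 0)).
Proof. by have [] := shell_integral (r := 0) (al := 0) _ _ hM; rewrite ?lexx ?ltr01. Qed.

Let i0Z k : mu.-integrable `[0, 1%R[ (EFin \o (fun t => k * (@shell_kernel R 0) t)).
Proof. by have := integrableZl m01 k i0; exact: eq_integrable. Qed.

Let I01 t : `[0, 1%R[%classic t -> 0 <= t < 1. Proof. by rewrite /= in_itv. Qed.

Lemma bloch_cintegrable f : carrier bloch f -> cintegrable mu `[0, 1%R[ (fun t => f (rtoC t)).
Proof.
move=> bf; have [L L0 fL] := bloch_norm_fin bf.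
apply: (cintegrable_le m01 _ (i0Z L)); first exact: bloch_cmeasurable.
move=> t /I01 t01; have fL' : (nnorm bloch f <= L%:E)%E by rewrite fL.
by rewrite (le_trans (bloch_le_elog bf fL' t01))// ler_wpM2l// shell_kernel0.
Qed.

(** [bloch_coef_sum_le] supplies an integrable majorant of the absolute Taylor sums of [f] on
    [[0, 1)]. Hence the series of moments converges, and its limit is the integral. *)
Lemma hilbert_coef_integral f n : carrier bloch f ->
  hilbert_coef mu f n = cintegral mu `[0, 1%R[ (fun t => rtoC (t ^+ n) * f (rtoC t)).
Proof.
move=> bf; have [L L0 fL] := bloch_norm_fin bf.
have fL' : (nnorm bloch f <= L%:E)%E by rewrite fL.
set c := taylor_coef f.
have mt k : cmeasurable (`[0, 1%R[ : set (measurableTypeR R)) (fun t => rtoC (t ^+ k)).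
  by apply: cmeasurable_rtoC; apply: measurable_funTS; exact: exprn_measurable.
have [||||_ ik hs] := @cintegral_series _ _ _ mu `[0, 1%R[ m01
  (fun k t => c k * rtoC (t ^+ (n + k))) (fun t => rtoC (t ^+ n) * f (rtoC t))
  (fun t => (4 * L ^+ 2 + 1) / 2 * shell_kernel 0 t).
- by move=> k; apply: cmeasurableM => //; exact: cmeasurable_cst.
- move=> t /I01 t01.
  have h := bloch_taylor bf (cabs_rtoC_lt1 (unit_itv_ltN1 t01)).
  apply: (cvg_eq1 _ (cvgM (cvg_cst (rtoC (t ^+ n) : Cplx R)) h)) => N.
  rewrite [LHS]mulr_sumr /series /=; apply: eq_bigr => k _.
  by rewrite exprD rtoCM !rtoCX -/c; ring.
- exact: i0Z.
- move=> N t /I01 /[dup] t01 /andP[t0 t1].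
  apply: le_trans (bloch_coef_sum_le N bf fL' t01); apply: ler_sum => k _.
  rewrite cabsM cabs_rtoC normrX ger0_norm// ler_wpM2l ?cabs_ge0//.
  by rewrite exprD ler_piMl ?exprn_ge0// exprn_ile1// ltW.
rewrite /hilbert_coef; apply: cplx_cvg_lim; apply: (cvg_eq1 _ hs) => N.
rewrite /series /=; apply: eq_bigr => k _.
rewrite (cintegralZ m01) ?cintegral_rtoC; first by rewrite mulrC.
apply: (cintegrable_le m01 (mt _) i0) => t /I01 /[dup] t01 /andP[t0 t1].
rewrite cabs_rtoC normrX ger0_norm// (le_trans _ (shell_kernel0 t01))//.
by rewrite (le_trans _ (elog_ge1 t01))// exprn_ile1// ltW.
Qed.

Lemma hilbert_op_integral f z : carrier bloch f -> cabs z < 1 ->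
  hilbert_op mu f z = cauchy_transform mu `[0, 1%R[ (fun t => f (rtoC t)) z.
Proof.
move=> bf z1; rewrite /hilbert_op z1; have iF := bloch_cintegrable bf.
have [g ig Fg] := cintegrable_cabs m01 iF.
have mt k : cmeasurable (`[0, 1%R[ : set (measurableTypeR R)) (fun t => rtoC (t ^+ k)).
  by apply: cmeasurable_rtoC; apply: measurable_funTS; exact: exprn_measurable.
have it k : cintegrable mu `[0, 1%R[ (fun t => rtoC (t ^+ k) * f (rtoC t)).
  apply: (@cintegrableMl _ _ _ mu _ m01 _ (fun t => rtoC (t ^+ k)) 1) => // t /I01 /andP[t0 t1].
  by rewrite cabs_rtoC normrX ger0_norm// exprn_ile1// ltW.
have [||||_ _ hs] := @cintegral_series _ _ _ mu `[0, 1%R[ m01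
  (fun n t => z ^+ n * (rtoC (t ^+ n) * f (rtoC t)))
  (fun t => f (rtoC t) * (1 - rtoC t * z)^-1) (fun t => (1 - cabs z)^-1 * g t).
- move=> n; apply: cmeasurableM; first exact: cmeasurable_cst.
  by apply: cmeasurableM => //; exact: cintegrable_measurable iF.
- move=> t /I01 t01; have t1 := unit_itv_ltN1 t01.
  have n1 := kernel_neq0 t1 z1.
  have tz1 : cabs (rtoC t * z) < 1.
    have /andP[t0 t1'] := t01; rewrite cabsM cabs_rtoC ger0_norm//.
    by apply: le_lt_trans z1; rewrite ler_piMl ?cabs_ge0// ltW.
  apply: (cvg_eq1 (u := fun n => f (rtoC t) * (1 - rtoC t * z)^-1 * (1 - (rtoC t * z) ^+ n))).
    move=> N; rewrite /series /=.
    transitivity (f (rtoC t) * \sum_(0 <= n < N) (rtoC t * z) ^+ n).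
      by rewrite geometric_sum// mulrA.
    by rewrite mulr_sumr; apply: eq_bigr => n _; rewrite rtoCX exprMn; ring.
  rewrite -[X in _ --> X]mulr1; apply: cvgM; first exact: cvg_cst.
  rewrite -[X in _ --> X]subr0; apply: cvgB; first exact: cvg_cst.
  apply/cvg_cplxP; under eq_fun do rewrite subr0 cabsX.
  by apply: cvg_expr; rewrite ger0_norm ?cabs_ge0.
- by have := integrableZl m01 (1 - cabs z)^-1 ig; exact: eq_integrable.
- move=> N t /[dup] Dt /I01 /andP[t0 t1].
  apply: (@le_trans _ _ (\sum_(0 <= k < N) cabs z ^+ k * cabs (f (rtoC t)))).
    apply: ler_sum => k _; rewrite !cabsM cabsX ler_wpM2l ?exprn_ge0 ?cabs_ge0//.
    rewrite cabs_rtoC normrX ger0_norm// ler_piMl ?cabs_ge0//.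
    by rewrite exprn_ile1// ltW.
  rewrite -mulr_suml ler_pM ?cabs_ge0 ?Fg//.
    by rewrite sumr_ge0// => k _; rewrite exprn_ge0 ?cabs_ge0.
  by apply: sum_geometric_le; rewrite cabs_ge0.
apply: cplx_cvg_lim; apply: (cvg_eq1 _ hs) => N.
rewrite /series /=; apply: eq_bigr => n _.
by rewrite (cintegralZ m01)// hilbert_coef_integral// mulrC.
Qed.

Lemma hilbert_op_has_cderiv f z : carrier bloch f -> cabs z < 1 ->
  has_cderiv (hilbert_op mu f) z
    (cintegral mu `[0, 1%R[ (fun t => f (rtoC t) * (rtoC t * (1 - rtoC t * z)^-1 ^+ 2))).
Proof.
move=> bf z1 e e0.
have [|d d0 hd] := has_cderiv_cauchy_transform m01 _ (bloch_cintegrable bf) z1 e0.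
  by [].
exists (Num.min d (1 - cabs z)); first by rewrite lt_min d0 subr_gt0.
move=> w; rewrite lt_min => /andP[w1 w2].
have w3 : cabs w < 1 by have := cabs_le_sub w z; lra.
by rewrite !hilbert_op_integral//; exact: hd.
Qed.

Lemma hilbert_op_analytic f : carrier bloch f -> analytic_disc (hilbert_op mu f).
Proof.
move=> bf; split => [z z1|z z1]; first by have [] := has_cderivP (hilbert_op_has_cderiv bf z1).
by rewrite /hilbert_op; case: ifPn => // h; exfalso; exact: z1.
Qed.

End HilbertIntegral.

(** * The BMOA norm of a Cauchy transform *)

Section HardyBound.
Context {R : realType}.
Local Notation leb := (@lebesgue_measure R).
Implicit Types (z : Cplx R).

Let m02 : measurable (`[0, 2 * pi]%classic : set (measurableTypeR R)).
Proof. exact: measurable_itv. Qed.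

(** [H1] is meant for a part with square-summable coefficients and [H2] for a bounded error. The
    factor 2 comes from [|x + y|^2 <= 2 |x|^2 + 2 |y|^2] and [2 A^2 + 2 B^2 <= (2 (A + B))^2]. *)
Lemma hardy2_norm_le (H H1 H2 : Cplx R -> Cplx R) (c : nat -> Cplx R) (A B : R) :
  0 <= A -> 0 <= B ->
  (forall z, cabs z < 1 -> {for z, continuous H}) ->
  (forall z, cabs z < 1 -> H z = H1 z + H2 z) ->
  power_series_of H1 c ->
  (forall N, \sum_(0 <= k < N) cabs (c k) ^+ 2 <= A ^+ 2) ->
  (forall z, cabs z < 1 -> cabs (H2 z) <= B) ->
  (hardy2_norm H <= (2 * (A + B))%:E)%E.
Proof.
move=> A0 B0 cH HE H1c cA H2B; apply: ge_ereal_sup => _ [r /= r01 <-].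
have {}r01 : 0 <= r < 1 by rewrite in_itv in r01.
have /andP[r0 r1] := r01.
have cp1 t : cabs (circle_point r t) < 1 by rewrite cabs_circle_point ger0_norm.
have [S [mH1 H1S hc]] := circle_mean_cvg H1c r01.
have mH : cmeasurable (`[0, 2 * pi] : set (measurableTypeR R)) (fun t => H (circle_point r t)).
  have cc t : {for t, continuous (fun t => H (circle_point r t))}.
    exact: (continuous_comp (@continuous_circle_point R r t) (cH _ (cp1 t))).
  by split; apply: measurable_funTS; apply: continuous_measurable_fun => t;
    [apply: cvg_Re; exact: cc|apply: cvg_Im; exact: cc].
have HS t : cabs (H (circle_point r t)) <= S + B.
  by rewrite HE// (le_trans (cabsD _ _))// lerD// H2B.
rewrite (circle_mean2_Rintegral mH HS) /= lee_fin.
have AB : 0 <= 2 * (A + B) by rewrite mulr_ge0// addr_ge0.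
rewrite -[leRHS](ger0_norm AB) -sqrtr_sqr ler_wsqrtr//.
rewrite -ler_pdivlMl ?invr_gt0 ?pi2_gt0// invrK.
have i1 := integrable_cabs_sqr mH1 H1S.
set I1 := \int[leb]_(t in `[0, 2 * pi]) (cabs (H1 (circle_point r t)) ^+ 2).
have hI1 : I1 <= 2 * pi * A ^+ 2.
  rewrite -ler_pdivrMl ?pi2_gt0//; apply: (cvgr_to_le hc); apply: nearW => N.
  apply: le_trans (cA N); apply: ler_sum => k _.
  by rewrite ler_piMr ?sqr_ge0// exprn_ile1// ltW.
have i2 : leb.-integrable `[0, 2 * pi] (EFin \o (fun t => 2 * cabs (H1 (circle_point r t)) ^+ 2)).
  by have := integrableZl m02 2 i1; exact: eq_integrable.
have i3 : leb.-integrable `[0, 2 * pi]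
    (EFin \o (fun t => 2 * cabs (H1 (circle_point r t)) ^+ 2 + 2 * B ^+ 2)).
  have := integrableD m02 i2 (integrable_itv_cst 0 (2 * pi) (2 * B ^+ 2)).
  exact: eq_integrable.
apply: (@le_trans _ _ (\int[leb]_(t in `[0, 2 * pi])
    (2 * cabs (H1 (circle_point r t)) ^+ 2 + 2 * B ^+ 2))).
  apply: le_Rintegral => //; first exact: (integrable_cabs_sqr mH HS).
  move=> t _; rewrite HE//; set x := H1 _; set y := H2 _.
  have hy : cabs y <= B by exact: H2B.
  have : cabs (x + y) ^+ 2 <= (cabs x + cabs y) ^+ 2.
    by rewrite ler_pXn2r ?nnegrE ?addr_ge0 ?cabs_ge0// cabsD.
  have : cabs y ^+ 2 <= B ^+ 2 by rewrite ler_pXn2r ?nnegrE ?cabs_ge0.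
  have := sqr_ge0 (cabs x - cabs y); nra.
rewrite RintegralD//; last exact: integrable_itv_cst.
rewrite RintegralZl// -/I1 Rintegral_itv_cst ?pi2_ge0// subr0.
have := mulr_ge0 A0 B0; have := sqr_ge0 A; have := sqr_ge0 B.
have p0 := @pi2_gt0 R; move: (2 * pi) hI1 p0 => p hI1 p0 ? ? ?.
have : 0 <= p * (A * B) by rewrite mulr_ge0// ltW.
have : 0 <= p * A ^+ 2 by rewrite mulr_ge0// ltW.
have : 0 <= p * B ^+ 2 by rewrite mulr_ge0// ltW.
nra.
Qed.

(** Cauchy-Schwarz against the geometric sequence [x ^ n], in AM-GM form; the weight [Q * s] makes
    the two halves equal. *)
Lemma sum_pow_le (D : nat -> R) (x Q : R) N : 0 <= x < 1 -> 0 < Q ->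
  \sum_(0 <= n < N) D n ^+ 2 = Q ^+ 2 ->
  \sum_(0 <= n < N) D n * x ^+ n <= Q / Num.sqrt (1 - x ^+ 2).
Proof.
move=> /andP[x0 x1] Q0 hQ.
have x21 : x ^+ 2 < 1 by rewrite expr_lt1.
set s := Num.sqrt _; have s0 : 0 < s by rewrite sqrtr_gt0 subr_gt0.
have s2 : s ^+ 2 = 1 - x ^+ 2 by rewrite sqr_sqrtr// subr_ge0 ltW.
apply: (@le_trans _ _ (\sum_(0 <= n < N) ((Q * s)^-1 / 2 * D n ^+ 2 + Q * s / 2 * (x ^+ 2) ^+ n))).
  apply: ler_sum => n _; rewrite -exprM mulnC exprM; set y := x ^+ n.
  have h0 : 0 < Q * s by rewrite mulr_gt0.
  move: (Q * s) h0 => h h0.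
  have -> : h^-1 / 2 * D n ^+ 2 + h / 2 * y ^+ 2 = (D n ^+ 2 + (h * y) ^+ 2) / (2 * h).
    by field; rewrite gt_eqF.
  rewrite ler_pdivlMr ?mulr_gt0//; have := sqr_ge0 (D n - h * y); nra.
rewrite big_split /= -!mulr_sumr hQ.
have geo := @sum_geometric_le R (x ^+ 2) N; rewrite sqr_ge0 x21 -s2 in geo.
have {}geo := geo isT.
have -> : Q / s = (Q * s)^-1 / 2 * Q ^+ 2 + Q * s / 2 * (s ^+ 2)^-1 by field; rewrite !gt_eqF.
by rewrite lerD2l ler_wpM2l// divr_ge0// mulr_ge0// ltW.
Qed.

End HardyBound.

Section BmoaCauchyTransform.
Context {R : realType}.
Variable mu : {finite_measure set (measurableTypeR R) -> \bar R}.
Implicit Types (t : R) (z : Cplx R).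

Variables (r M L : R) (F : R -> Cplx R) (a : Cplx R).
Hypothesis r01 : 0 <= r < 1.
Hypothesis hM : carleson_at mu r M.
Hypothesis iF : cintegrable mu `[r, 1%R[ F.
Hypothesis FL : forall t, r <= t < 1 -> cabs (F t) <= L * elog t.
Hypothesis L0 : 0 <= L.
Hypothesis a1 : cabs a < 1.

Let I := (`[r, 1%R[%classic : set (measurableTypeR R)).
Let mI : measurable I. Proof. exact: measurable_itv. Qed.
Let It t : I t -> 0 <= t < 1.
Proof.
by rewrite /I /= in_itv/= => /andP[rt ->]; rewrite (le_trans _ rt)//; case/andP: r01.
Qed.
Let I01 : I `<=` `[0, 1%R[. Proof. by move=> t /It. Qed.

Let G := cauchy_transform mu I F.
Let s := Num.sqrt (1 - cabs a ^+ 2).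
Let b t : Cplx R := (conjc a - rtoC t) / (1 - rtoC t * a).
Let bet t : Cplx R := - (rtoC t * rtoC (1 - cabs a ^+ 2)) / (1 - rtoC t * a) ^+ 2.

Let den t : -1 < t < 1 -> 1 - rtoC t * a != 0.
Proof. by move=> t1; exact: kernel_neq0. Qed.

Let a2 : 0 < 1 - cabs a ^+ 2. Proof. by rewrite subr_gt0 cabs_lt1_sqr. Qed.

Let cabs_b2 t : 0 <= t < 1 ->
  1 - cabs (b t) ^+ 2 = (1 - cabs a ^+ 2) * (1 - t ^+ 2) / cabs (1 - rtoC t * a) ^+ 2.
Proof.
move=> t01; have d0 := den (unit_itv_ltN1 t01).
have /andP[t0 t1] := t01.
have := cabs_disc_identity (rtoC t) a; rewrite conjc_rtoC cabs_rtoC ger0_norm// => h.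
have d2 : cabs (1 - rtoC t * a) != 0 by rewrite gt_eqF// cabs_gt0.
have -> : cabs (b t) = cabs (rtoC t - a) / cabs (1 - rtoC t * a).
  rewrite /b cabsM cabsV; congr (_ / _).
  rewrite -[RHS]cabs_conj cabsBC; congr cabs.
  by case: (a) => x y; apply: cplx_eqP => /=; ring.
rewrite expr_div_n; move: h d2; set d := cabs (1 - _); set e := cabs (_ - a) => h d2.
apply: (@mulIf _ (d ^+ 2)); first by rewrite expf_neq0.
by rewrite mulfVK ?expf_neq0// mulrBl mul1r mulfVK ?expf_neq0// h; ring.
Qed.

Let cabs_b t : 0 <= t < 1 -> cabs (b t) < 1.
Proof.
move=> t01; have /andP[t0 t1] := t01.
have d0 := cabs_gt0 (den (unit_itv_ltN1 t01)).
rewrite -(@ltr_pXn2r _ 2)// ?nnegrE ?cabs_ge0// expr1n -subr_gt0 cabs_b2//.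
by rewrite divr_gt0 ?exprn_gt0// mulr_gt0// subr_gt0 expr_lt1.
Qed.

Let kernel_disc_aut t z : 0 <= t < 1 -> cabs z < 1 ->
  (1 - rtoC t * disc_aut a z)^-1 - (1 - rtoC t * a)^-1 = bet t * z * (1 - b t * z)^-1.
Proof.
move=> t01 z1; have t1 := unit_itv_ltN1 t01.
have n1 := den t1.
have n2 : 1 - conjc a * z != 0 by rewrite one_minus_neq0 ?cabs_conj// ltW.
have n3 := kernel_neq0 t1 (disc_aut_lt1 a1 z1).
have n4 : 1 - b t * z != 0 by rewrite one_minus_neq0// ltW// cabs_b.
have e3 : 1 - rtoC t * disc_aut a z =
    ((1 - rtoC t * a) - (conjc a - rtoC t) * z) / (1 - conjc a * z).
  by rewrite /disc_aut; field.
have n5 : (1 - rtoC t * a) - (conjc a - rtoC t) * z != 0.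
  by apply: contraNneq n3 => h; rewrite e3 h mul0r.
have e4 : 1 - b t * z = ((1 - rtoC t * a) - (conjc a - rtoC t) * z) / (1 - rtoC t * a).
  by rewrite /b; field.
rewrite e3 e4 /bet rtoCB rtoC1 -mulJ_cabs; field.
by rewrite n1 n5 n2.
Qed.

Let d_ n : Cplx R := cintegral mu I (fun t => bet t * b t ^+ n * F t).
(** The factor [z] in [kernel_disc_aut] shifts the coefficients [d_] by one; the constant term is 0
    because [disc_aut a 0 = a]. *)
Let c_ n : Cplx R := if n is n'.+1 then d_ n' else 0.

Let one_ta t : 0 <= t < 1 -> 0 < 1 - t * cabs a /\ 1 - t * cabs a <= cabs (1 - rtoC t * a).
Proof.
move=> /andP[t0 t1]; have := one_minus_cabs_ge (rtoC t) a.
rewrite cabs_rtoC ger0_norm// => h; split => //.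
by have := cabs_ge0 a; have := a1; nra.
Qed.

Let cbet t : 0 <= t < 1 ->
  cabs (bet t) = t * (1 - cabs a ^+ 2) / cabs (1 - rtoC t * a) ^+ 2.
Proof.
move=> /andP[t0 t1]; rewrite /bet cabsM cabsN cabsV cabsX cabsM !cabs_rtoC.
by rewrite ger0_norm// (ger0_norm (ltW a2)).
Qed.

Let bet_bound t : 0 <= t < 1 -> cabs (bet t) <= (1 - cabs a)^-1 ^+ 2.
Proof.
move=> t01; have /andP[t0 t1] := t01; rewrite cbet//.
have [p0 pl] := one_ta t01.
have h : 1 - cabs a <= cabs (1 - rtoC t * a) by exact: cabs_kernel_ge.
have x0 : 0 < 1 - cabs a by rewrite subr_gt0.
rewrite -[leRHS]mul1r ler_pM ?invr_ge0 ?sqr_ge0 ?mulr_ge0 ?(ltW a2)//.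
  rewrite -[leRHS]mul1r ler_pM ?(ltW a2) ?(ltW t1)//.
  by rewrite gerBl sqr_ge0.
rewrite exprVn lef_pV2 ?posrE ?exprn_gt0 ?(lt_le_trans x0)//.
by rewrite lerXn2r ?nnegrE ?cabs_ge0 ?(ltW x0).
Qed.

Let cont_b t : -1 < t < 1 -> {for t, continuous b}.
Proof.
move=> t1; apply: cvgM.
  exact: (cvgB (cvg_cst (conjc a : Cplx R)) (@continuous_rtoC R t)).
apply: cvgV; first exact: den.
apply: cvgB; first exact: cvg_cst.
by apply: cvgM; [exact: continuous_rtoC|exact: cvg_cst].
Qed.

Let cont_bet t : -1 < t < 1 -> {for t, continuous bet}.
Proof.
move=> t1; apply: cvgM.
  by apply: cvgN; apply: cvgM; [exact: continuous_rtoC|exact: cvg_cst].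
apply: cvgV; first by rewrite expf_neq0// den.
have h : (1 - rtoC x * a) @[x --> t] --> 1 - rtoC t * a.
  apply: cvgB; first exact: cvg_cst.
  by apply: cvgM; [exact: continuous_rtoC|exact: cvg_cst].
by under eq_fun do rewrite expr2; rewrite expr2; exact: (cvgM h h).
Qed.

Let mb : cmeasurable I b. Proof. exact: cmeasurable_unit_itv cont_b. Qed.
Let mbet : cmeasurable I bet. Proof. exact: cmeasurable_unit_itv cont_bet. Qed.

Let power_series_G : power_series_of (fun z => G (disc_aut a z) - G a) c_.
Proof.
move=> z z1; rewrite /unit_disc /mkset in z1.
have [g ig Fg] := cintegrable_cabs mI iF.
have K0 : 0 <= (1 - cabs a)^-1 ^+ 2 by rewrite sqr_ge0.
have mF := cintegrable_measurable iF.
have [||||_ id hs] := @cintegral_series _ _ _ mu I mI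
  (fun n t => z ^+ n.+1 * (bet t * b t ^+ n * F t))
  (fun t => bet t * z * (1 - b t * z)^-1 * F t)
  (fun t => ((1 - cabs a)^-1 ^+ 2 * (1 - cabs z)^-1) * g t).
- move=> n; apply: cmeasurableM; first exact: cmeasurable_cst.
  by apply: cmeasurableM => //; apply: cmeasurableM => //; exact: cmeasurableX.
- move=> t /It t01; have b1 := cabs_b t01.
  have n4 : 1 - b t * z != 0 by rewrite one_minus_neq0// ltW.
  have bz1 : cabs (b t * z) < 1.
    by rewrite cabsM (le_lt_trans _ z1)// ler_piMl ?cabs_ge0// ltW.
  apply: (cvg_eq1 (u := fun n => bet t * z * (1 - b t * z)^-1 * F t * (1 - (b t * z) ^+ n))).
    move=> N; rewrite /series /=.
    transitivity (bet t * z * F t * \sum_(0 <= n < N) (b t * z) ^+ n).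
      by rewrite geometric_sum//; ring.
    rewrite mulr_sumr; apply: eq_bigr => n _; rewrite exprMn exprS; ring.
  rewrite -[X in _ --> X]mulr1; apply: cvgM; first exact: cvg_cst.
  rewrite -[X in _ --> X]subr0; apply: cvgB; first exact: cvg_cst.
  apply/cvg_cplxP; under eq_fun do rewrite subr0 cabsX.
  by apply: cvg_expr; rewrite ger0_norm ?cabs_ge0.
- by have := integrableZl mI ((1 - cabs a)^-1 ^+ 2 * (1 - cabs z)^-1) ig; exact: eq_integrable.
- move=> N t It'; have t01 := It It'; have b1 := cabs_b t01.
  apply: (@le_trans _ _ (\sum_(0 <= k < N) (1 - cabs a)^-1 ^+ 2 * g t * cabs z ^+ k)).
    apply: ler_sum => k _; rewrite cabsM cabsX mulrC ler_pM ?exprn_ge0 ?cabs_ge0//.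
      rewrite cabsM ler_pM ?cabs_ge0//; last exact: Fg.
      rewrite cabsM -[leRHS]mulr1 ler_pM ?cabs_ge0 ?bet_bound//.
      by rewrite cabsX exprn_ile1 ?cabs_ge0// ltW.
    by rewrite exprS ler_piMl ?exprn_ge0 ?cabs_ge0// ltW.
  rewrite -mulr_sumr [leRHS]mulrAC; apply: ler_wpM2l.
    by rewrite mulr_ge0// (le_trans _ (Fg _ It'))// cabs_ge0.
  by apply: sum_geometric_le; rewrite cabs_ge0.
have E : cintegral mu I (fun t => bet t * z * (1 - b t * z)^-1 * F t) = G (disc_aut a z) - G a.
  rewrite /G /cauchy_transform -cintegralB//; last 2 first.
  - by apply: cintegrable_kernel => //; exact: disc_aut_lt1.
  - exact: cintegrable_kernel.
  apply: eq_cintegral => t /It t01.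
  by rewrite -(kernel_disc_aut t01 z1); ring.
rewrite -E -(cvg_shiftS (series _)).
apply: (cvg_eq1 _ hs) => N; rewrite /series /= big_nat_recl//= mul0r add0r.
apply: eq_bigr => n _; rewrite cintegralZ; [by rewrite mulrC|exact: mI|].
apply: (@cintegrableMl _ _ _ mu _ mI F (fun t => bet t * b t ^+ n) ((1 - cabs a)^-1 ^+ 2)) => //.
  by apply: cmeasurableM => //; exact: cmeasurableX.
move=> t /It t01; rewrite cabsM -[leRHS]mulr1 ler_pM ?cabs_ge0 ?bet_bound//.
by rewrite cabsX exprn_ile1 ?cabs_ge0// ltW// cabs_b.
Qed.

Let w t := L * elog t * cabs (bet t).

(** One factor [s] and one factor [|1 - t a|] cancel: [|bet t| / sqrt (1 - |b t|^2)] equals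
    [t s / (|1 - t a| sqrt (1 - t^2))]. *)
Let weight_bound t : 0 <= t < 1 ->
  w t / Num.sqrt (1 - cabs (b t) ^+ 2) <= L * s * shell_kernel (cabs a) t.
Proof.
move=> t01; have /andP[t0 t1] := t01.
have [p0 pl] := one_ta t01.
have l1 := elog_ge1 t01.
have d0 := lt_le_trans p0 pl.
have t2 : 0 < 1 - t ^+ 2 by rewrite subr_gt0 expr_lt1.
have s0 : 0 < s by rewrite sqrtr_gt0.
have s2 : s ^+ 2 = 1 - cabs a ^+ 2 by rewrite sqr_sqrtr// ltW.
rewrite cabs_b2// sqrtrM ?mulr_ge0 ?(ltW a2) ?(ltW t2)// sqrtrM ?(ltW a2)// sqrtrV ?sqr_ge0//.
rewrite sqrtr_sqr (ger0_norm (ltW d0)) -/s /w cbet// -s2 /shell_kernel.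
set d := cabs (1 - _) in pl d0 *; set q := Num.sqrt (1 - t ^+ 2); set q1 := Num.sqrt (1 - t).
have q0 : 0 < q1 by rewrite sqrtr_gt0 subr_gt0.
have qq : q1 <= q by rewrite ler_wsqrtr//; nra.
have q00 := lt_le_trans q0 qq.
have -> : L * elog t * (t * s ^+ 2 / d ^+ 2) / (s * q / d) = (L * s * elog t) * (t / (d * q)).
  by field; rewrite !gt_eqF.
have -> : L * s * (elog t / ((1 - t * cabs a) * q1)) = (L * s * elog t) * ((1 - t * cabs a) * q1)^-1.
  by rewrite mulrA.
apply: ler_wpM2l; first by rewrite !mulr_ge0 ?(ltW s0)//; lra.
rewrite -[leRHS]mul1r ler_pM ?invr_ge0 ?mulr_ge0 ?(ltW d0) ?(ltW q00) ?(ltW t1)//.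
by rewrite lef_pV2 ?posrE ?mulr_gt0// ler_pM// ltW.
Qed.

Let shell : mu.-integrable I (EFin \o shell_kernel (cabs a)) /\
  \int[mu]_(t in I) shell_kernel (cabs a) t <= 128 * M / Num.sqrt (1 - cabs a).
Proof. by apply: shell_integral => //; rewrite cabs_ge0. Qed.

Let w_ge0 t : 0 <= t < 1 -> 0 <= w t.
Proof.
by move=> t01; rewrite !mulr_ge0 ?cabs_ge0// (le_trans _ (elog_ge1 t01)).
Qed.

Let w_pow_le t n : 0 <= t < 1 -> w t * cabs (b t) ^+ n <= L * s * shell_kernel (cabs a) t.
Proof.
move=> t01; have b1 := cabs_b t01; apply: le_trans (weight_bound t01); apply: ler_wpM2l; first exact: w_ge0.
apply: (@le_trans _ _ 1); first by rewrite exprn_ile1 ?cabs_ge0// ltW.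
have q0 : 0 < Num.sqrt (1 - cabs (b t) ^+ 2) by rewrite sqrtr_gt0 subr_gt0 cabs_lt1_sqr.
rewrite invf_ge1// -[leRHS]sqrtr1 ler_wsqrtr// gerBl sqr_ge0//.
Qed.

Let mw n : measurable_fun I (fun t => w t * cabs (b t) ^+ n).
Proof.
apply: measurable_fun_unit_itv => // t t1; have /andP[_ t11] := t1.
apply: cvgM.
  apply: cvgM; last by apply: cvg_cabs; exact: cont_bet.
  by apply: cvgM; [exact: cvg_cst|exact: continuous_elog].
elim: n => [|n IH]; first by under eq_fun do rewrite expr0; rewrite expr0; exact: cvg_cst.
under eq_fun do rewrite exprS; rewrite exprS; apply: cvgM => //.
by apply: cvg_cabs; exact: cont_b.
Qed.

Let iS (k : R) : mu.-integrable I (EFin \o (fun t => k * shell_kernel (cabs a) t)).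
Proof. by have := integrableZl mI k shell.1; exact: eq_integrable. Qed.

Let iw n : mu.-integrable I (EFin \o (fun t => w t * cabs (b t) ^+ n)).
Proof.
apply: (le_integrable mI _ _ (iS (L * s))); first by apply/measurable_EFinP; exact: mw.
move=> t /It t01 /=; rewrite lee_fin.
have p0 : 0 <= w t * cabs (b t) ^+ n by rewrite mulr_ge0 ?exprn_ge0 ?cabs_ge0 ?w_ge0.
by rewrite (ger0_norm p0) (le_trans (w_pow_le n t01))// ler_norm.
Qed.

(** Majorants of [|d_ n|] given by nonnegative integrands, so that their square sum can be expanded
    under the integral sign. *)
Let D_ n := \int[mu]_(t in I) (w t * cabs (b t) ^+ n).

Let d_le_D n : cabs (d_ n) <= D_ n.
Proof.
have h t : I t -> cabs (bet t * b t ^+ n * F t) <= w t * cabs (b t) ^+ n.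
  move=> It'; have t01 := It It'; rewrite (cabsM (bet t * b t ^+ n)) (cabsM (bet t)) cabsX /w mulrC.
  rewrite [leRHS](_ : _ = L * elog t * (cabs (bet t) * cabs (b t) ^+ n)); last by ring.
  rewrite ler_wpM2r// ?mulr_ge0 ?exprn_ge0 ?cabs_ge0//.
  by apply: FL; move: It'; rewrite /I /= in_itv.
apply: cabs_cintegral_le => //; apply: (cintegrable_le mI _ (iw n) h).
apply: cmeasurableM; last exact: cintegrable_measurable iF.
by apply: cmeasurableM => //; exact: cmeasurableX.
Qed.

Let W := L * s * (128 * M / Num.sqrt (1 - cabs a)).

(** Writing one factor of each [D_ n ^ 2] as its integral turns [Q ^ 2] into the integral of [w]
    times the sum of [D_ n |b|^n]. By [sum_pow_le] the inner sum is at most [Q / sqrt (1 - |b|^2)],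
    and one [Q] cancels. *)
Let sum_D N (Q : R) : 0 < Q -> \sum_(0 <= n < N) D_ n ^+ 2 = Q ^+ 2 -> Q <= W.
Proof.
move=> Q0 hQ.
have isum K : mu.-integrable I (EFin \o (fun t => \sum_(0 <= n < K) D_ n * (w t * cabs (b t) ^+ n))) /\
    \int[mu]_(t in I) (\sum_(0 <= n < K) D_ n * (w t * cabs (b t) ^+ n)) = \sum_(0 <= n < K) D_ n ^+ 2.
  elim: K => [|K [IH1 IH2]].
    rewrite big_nil; split.
      by apply: (eq_integrable mI _ _ _ (integrable0 mu I)) => t _ /=; rewrite big_nil.
    under eq_Rintegral do rewrite big_nil.
    by rewrite /Rintegral integral0.
  have iZ : mu.-integrable I (EFin \o (fun t => D_ K * (w t * cabs (b t) ^+ K))).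
    by have := integrableZl mI (D_ K) (iw K); exact: eq_integrable.
  split.
    have := integrableD mI IH1 iZ; apply: eq_integrable => // t _ /=.
    by rewrite big_nat_recr//=.
  under eq_Rintegral do rewrite big_nat_recr//=.
  by rewrite RintegralD// IH2 RintegralZl// big_nat_recr//= expr2.
have [i1 e1] := isum N.
have : Q ^+ 2 <= \int[mu]_(t in I) (Q * (L * s) * shell_kernel (cabs a) t).
  rewrite -hQ -e1; apply: le_Rintegral => // t /It t01.
  under eq_bigr do rewrite mulrCA; rewrite -mulr_sumr -mulrA.
  have b1 : 0 <= cabs (b t) < 1 by rewrite cabs_ge0 cabs_b.
  apply: (@le_trans _ _ (w t * (Q / Num.sqrt (1 - cabs (b t) ^+ 2)))).
    by apply: ler_wpM2l; [exact: w_ge0|exact: sum_pow_le].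
  by rewrite mulrCA ler_wpM2l ?(ltW Q0)// weight_bound.
rewrite RintegralZl//; last exact: shell.1.
rewrite expr2 -mulrA ler_pM2l// => h; apply: le_trans h _.
by rewrite ler_wpM2l ?shell.2// mulr_ge0// sqrtr_ge0.
Qed.

Let M0 : 0 <= M.
Proof.
have /andP[r0 r1] := r01; have := hM (lexx r) r1 => h.
have : 0 <= M * (1 - r).
  apply: le_trans h; rewrite mulr_ge0 ?fine_ge0//.
  by rewrite (le_trans _ (elog_ge1 r01)).
by rewrite pmulr_lge0// subr_gt0.
Qed.

(** [s <= 2 sqrt (1 - |a|)] removes the last dependence on [a] and doubles the 128 of the shell
    integral. *)
Let W_le : 0 <= W /\ W <= 256 * (L * M).
Proof.
have x0 : 0 < 1 - cabs a by rewrite subr_gt0.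
have q0 : 0 < Num.sqrt (1 - cabs a) by rewrite sqrtr_gt0.
split; first by rewrite !mulr_ge0 ?sqrtr_ge0// ?invr_ge0 ?sqrtr_ge0.
have sq : s <= 2 * Num.sqrt (1 - cabs a).
  have h4 : 2 * Num.sqrt (1 - cabs a) = Num.sqrt (4 * (1 - cabs a)).
    have -> : 4 = 2 ^+ 2 :> R by rewrite expr2; lra.
    by rewrite sqrtrM ?sqr_ge0// sqrtr_sqr ger0_norm.
  by rewrite h4 ler_wsqrtr//; have := cabs_ge0 a; have := a1; nra.
rewrite /W [leLHS](_ : _ = 128 * (L * M) * (s / Num.sqrt (1 - cabs a))); last by ring.
rewrite [leRHS](_ : _ = 128 * (L * M) * 2); last by ring.
by rewrite ler_wpM2l ?mulr_ge0// ler_pdivrMr.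
Qed.

Lemma cauchy_transform_disc_aut : exists2 c, power_series_of (fun z => G (disc_aut a z) - G a) c &
  forall N, \sum_(0 <= k < N) cabs (c k) ^+ 2 <= (256 * (L * M)) ^+ 2.
Proof.
exists c_; first exact: power_series_G.
have [W0 W1] := W_le.
move=> N; apply: (@le_trans _ _ (\sum_(0 <= n < N) D_ n ^+ 2)).
  case: N => [|N]; first by rewrite !big_nil.
  rewrite big_nat_recl// (_ : c_ 0%N = 0)// cabs0 expr0n add0r big_nat_recr//= ler_wpDr ?sqr_ge0//.
  apply: ler_sum => n _; have D0 := le_trans (cabs_ge0 _) (d_le_D n).
  by rewrite ler_pXn2r ?nnegrE ?cabs_ge0//; exact: d_le_D.
have S0 : 0 <= \sum_(0 <= n < N) D_ n ^+ 2 by apply: sumr_ge0 => n _; exact: sqr_ge0.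
have := sqr_sqrtr S0; set Q := Num.sqrt _ => hQ.
have := sqrtr_ge0 (\sum_(0 <= n < N) D_ n ^+ 2); rewrite -/Q le_eqVlt => /predU1P[Q0|Q0].
  by rewrite -hQ -Q0 expr0n sqr_ge0.
have QW := sum_D Q0 (esym hQ).
by rewrite -hQ ler_pXn2r ?nnegrE ?(ltW Q0) ?(le_trans W0)// (le_trans QW).
Qed.

Lemma cauchy_transform_0 : cabs (G 0) <= 128 * (L * M).
Proof.
have := @shell_integral _ mu r M 0 r01; rewrite lexx ltr01 => /(_ isT hM) [i0 h0].
have iL : mu.-integrable I (EFin \o (fun t => L * shell_kernel 0 t)).
  by have := integrableZl mI L i0; exact: eq_integrable.
apply: (@le_trans _ _ (\int[mu]_(t in I) (L * shell_kernel 0 t))).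
  apply: cabs_cintegral_le => //; first by apply: cintegrable_kernel => //; rewrite cabs0.
  move=> t It'; rewrite mulr0 subr0 invr1 mulr1.
  apply: (@le_trans _ _ (L * elog t)); first by apply: FL; move: It'; rewrite /I /= in_itv.
  by rewrite ler_wpM2l// shell_kernel0// It.
rewrite RintegralZl// (_ : 128 * (L * M) = L * (128 * M)); last by ring.
rewrite ler_wpM2l//; apply: le_trans h0 _.
by rewrite subr0 sqrtr1 divr1.
Qed.

End BmoaCauchyTransform.

(** * Upper bound *)

Section PolynomialOperators.
Context {R : realType}.
Implicit Types (c : nat -> Cplx R) (z a : Cplx R) (f g h : Cplx R -> Cplx R).

(** The error [E] contributes [e] at the origin. In the seminorm [E o disc_aut a - E a] is bounded
    by [2 e], doubled by [hardy2_norm_le]; this makes [5 e] in all. *)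
Lemma bmoa_norm_le h (G E : Cplx R -> Cplx R) (A0 A e : R) :
  0 <= A -> 0 <= e ->
  (forall z, cabs z < 1 -> {for z, continuous h}) ->
  (forall z, cabs z < 1 -> h z = G z + E z) ->
  cabs (G 0) <= A0 ->
  (forall a, cabs a < 1 -> exists2 c, power_series_of (fun z => G (disc_aut a z) - G a) c &
     forall N, \sum_(0 <= k < N) cabs (c k) ^+ 2 <= A ^+ 2) ->
  (forall z, cabs z < 1 -> cabs (E z) <= e) ->
  (nnorm bmoa h <= (A0 + 2 * A + 5 * e)%:E)%E.
Proof.
move=> Age ege ch hGE G0 Ga Ee.
have z0 : cabs (0 : Cplx R) < 1 by rewrite cabs0.
have -> : A0 + 2 * A + 5 * e = (A0 + e) + 2 * (A + 2 * e) by ring.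
rewrite EFinD; apply: leeD.
  by rewrite lee_fin hGE// (le_trans (cabsD _ _))// lerD// Ee.
apply: ge_ereal_sup => _ [a a1 <-]; rewrite /unit_disc /mkset in a1.
have [c Gc cA] := Ga a a1.
apply: (@hardy2_norm_le _ _ (fun z => G (disc_aut a z) - G a)
  (fun z => E (disc_aut a z) - E a) c).
- exact: Age.
- by rewrite mulr_ge0.
- move=> z z1; have cd := has_cderiv_continuous (has_cderiv_disc_aut a1 z1).
  have hc : h (disc_aut a x) @[x --> z] --> h (disc_aut a z).
    exact: (continuous_comp cd (ch _ (disc_aut_lt1 a1 z1))).
  exact: (cvgB hc (cvg_cst (h a))).
- by move=> z z1; rewrite (hGE _ a1) (hGE _ (disc_aut_lt1 a1 z1)); ring.
- exact: Gc.
- exact: cA.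
- move=> z z1; rewrite (le_trans (cabsB _ _))//.
  by have := Ee _ (disc_aut_lt1 a1 z1); have := Ee _ a1; lra.
Qed.

Lemma has_cderiv_local f g z d : (forall w, cabs w < 1 -> f w = g w) -> cabs z < 1 ->
  has_cderiv f z d -> has_cderiv g z d.
Proof.
move=> fg z1 hf e e0; have [dl d0 hd] := hf e e0.
exists (Num.min dl (1 - cabs z)); first by rewrite lt_min d0 subr_gt0.
move=> w; rewrite lt_min => /andP[w1 w2].
have w3 : cabs w < 1 by have := cabs_le_sub w z; lra.
by rewrite -!fg//; exact: hd.
Qed.

Lemma has_cderiv_horner g z d (k : Cplx R) : has_cderiv g z d ->
  has_cderiv (fun w => k + w * g w) z (g z + z * d).
Proof.
move=> hg e e0.
have z0 : 0 < 2 * (cabs z + 1) by rewrite mulr_gt0// ltr_wpDl ?cabs_ge0.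
have d0 : 0 < 2 * (cabs d + 1) by rewrite mulr_gt0// ltr_wpDl ?cabs_ge0.
have [dl dl0 hd] := hg (e / (2 * (cabs z + 1))) (divr_gt0 e0 z0).
exists (Num.min dl (Num.min 1 (e / (2 * (cabs d + 1))))).
  by rewrite !lt_min dl0 ltr01 divr_gt0.
move=> w; rewrite !lt_min => /and3P[w1 w2 w3].
have -> : k + w * g w - (k + z * g z) - (g z + z * d) * (w - z) =
  w * (g w - g z - d * (w - z)) + d * (w - z) * (w - z) by ring.
rewrite (le_trans (cabsD _ _))// (cabsM w) (cabsM (d * _)) (cabsM d).
have wz : cabs w <= cabs z + 1 by have := cabs_le_sub w z; lra.
have x0 := cabs_ge0 (w - z).
have E1 : cabs w * cabs (g w - g z - d * (w - z)) <= e / 2 * cabs (w - z).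
  have -> : e / 2 * cabs (w - z) = (cabs z + 1) * (e / (2 * (cabs z + 1)) * cabs (w - z)).
    by field; rewrite gt_eqF// ltr_wpDl ?cabs_ge0.
  by rewrite ler_pM ?cabs_ge0// hd.
have E2 : cabs d * cabs (w - z) * cabs (w - z) <= e / 2 * cabs (w - z).
  rewrite ler_wpM2r//; move: w3; rewrite ltr_pdivlMr// => w3.
  have := cabs_ge0 d; nra.
lra.
Qed.

Lemma has_cderiv_poly c K z :
  has_cderiv (fun w => \sum_(0 <= n < K) c n * w ^+ n) z
    (\sum_(0 <= n < K) c n * n%:R * z ^+ n.-1).
Proof.
elim: K c => [|K IH] c.
  move=> e e0; exists 1 => // w _.
  by rewrite !big_nil mul0r !subr0 cabs0 mulr_ge0 ?cabs_ge0// ltW.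
have hd := has_cderiv_horner (c 0%N) (IH (fun n => c n.+1)).
have -> : \sum_(0 <= n < K.+1) c n * n%:R * z ^+ n.-1 =
    \sum_(0 <= n < K) c n.+1 * z ^+ n + z * \sum_(0 <= n < K) c n.+1 * n%:R * z ^+ n.-1.
  rewrite big_nat_recl// mulr0 mul0r add0r mulr_sumr -big_split /=.
  apply: eq_bigr => -[_|n _] /=; first by rewrite mulr0n mulr1n; ring.
  by rewrite -(natr1 n.+1) exprS; ring.
suff -> : (fun w => \sum_(0 <= n < K.+1) c n * w ^+ n) =
   (fun w => c 0%N + w * \sum_(0 <= n < K) c n.+1 * w ^+ n) by [].
apply/funext => w; rewrite big_nat_recl// expr0 mulr1 mulr_sumr; congr (_ + _).
by apply: eq_bigr => n _; rewrite exprS mulrCA.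
Qed.

Definition poly_disc c K z : Cplx R :=
  if cabs z < 1 then \sum_(0 <= n < K) c n * z ^+ n else 0.

Lemma poly_discE c K z : cabs z < 1 -> poly_disc c K z = \sum_(0 <= n < K) c n * z ^+ n.
Proof. by rewrite /poly_disc => ->. Qed.

Lemma has_cderiv_poly_disc c K z : cabs z < 1 ->
  has_cderiv (poly_disc c K) z (\sum_(0 <= n < K) c n * n%:R * z ^+ n.-1).
Proof.
move=> z1; apply: has_cderiv_local (has_cderiv_poly c K z) => // w w1.
by rewrite poly_discE.
Qed.

Lemma poly_disc_analytic c K : analytic_disc (poly_disc c K).
Proof.
split=> z; rewrite /unit_disc /mkset => z1; last by rewrite /poly_disc; case: ifP.
by have [] := has_cderivP (has_cderiv_poly_disc c K z1).
Qed.

Lemma poly_disc_linear (k : Cplx R) c c' K :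
  poly_disc (fun n => k * c n + c' n) K = k *: poly_disc c K + poly_disc c' K.
Proof.
apply/funext => z; transitivity (k * poly_disc c K z + poly_disc c' K z) => //.
have [z1|z1] := boolP (cabs z < 1).
  rewrite !poly_discE// mulr_sumr -big_split /=; apply: eq_bigr => n _.
  by rewrite mulrDl mulrA.
by rewrite /poly_disc (negbTE z1) mulr0 addr0.
Qed.

Lemma poly_discB c c' K :
  poly_disc c K - poly_disc c' K = poly_disc (fun n => c n - c' n) K.
Proof.
apply/funext => z; transitivity (poly_disc c K z - poly_disc c' K z) => //.
have [z1|z1] := boolP (cabs z < 1).
  by rewrite !poly_discE// -sumrB; apply: eq_bigr => n _; rewrite mulrBl.
by rewrite /poly_disc (negbTE z1) subr0.
Qed.

Lemma poly_disc_bound c K z : cabs (poly_disc c K z) <= \sum_(0 <= n < K) cabs (c n).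
Proof.
rewrite /poly_disc; case: ifPn => z1; last by rewrite cabs0 sumr_ge0// => i _; exact: cabs_ge0.
rewrite (le_trans (cabs_sum _ _ _))// ler_sum// => i _.
by rewrite cabsM cabsX ler_piMr ?cabs_ge0// exprn_ile1 ?cabs_ge0// ltW.
Qed.

(** [bmoa_norm_le] with zero main part. The crude bound is enough to deduce convergence in BMOA from
    convergence of finitely many coefficients. *)
Lemma poly_disc_bmoa_norm c K :
  (nnorm bmoa (poly_disc c K) <= (5 * \sum_(0 <= n < K) cabs (c n))%:E)%E.
Proof.
have S0 : 0 <= \sum_(0 <= n < K) cabs (c n) by apply: sumr_ge0 => i _; exact: cabs_ge0.
have -> : 5 * \sum_(0 <= n < K) cabs (c n) = 0 + 2 * 0 + 5 * \sum_(0 <= n < K) cabs (c n).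
  by rewrite mulr0 !add0r.
apply: (@bmoa_norm_le _ (fun=> 0) (poly_disc c K)).
- by [].
- exact: S0.
- move=> z z1; have [df _] := poly_disc_analytic c K.
  exact: has_cderiv_continuous (derivable_has_cderiv (df z z1)).
- by move=> z _; rewrite add0r.
- by rewrite cabs0.
- move=> a _; exists (fun=> 0).
    move=> z _; rewrite subrr; apply: (cvg_eq1 (u := fun=> 0)); last exact: cvg_cst.
    by move=> n; rewrite /series /= big1// => i _; rewrite mul0r.
  by move=> N; rewrite big1 ?expr0n// => i _; rewrite cabs0 expr0n.
- by move=> z _; exact: poly_disc_bound.
Qed.

Lemma bmoa_seminorm_le_norm f : (bmoa_seminorm f <= nnorm bmoa f)%E.
Proof. by rewrite leeDr// lee_fin cabs_ge0. Qed.

Lemma poly_disc_bmoa c K : carrier bmoa (poly_disc c K).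
Proof.
split; first exact: poly_disc_analytic.
apply: le_lt_trans (bmoa_seminorm_le_norm _) _.
exact: le_lt_trans (poly_disc_bmoa_norm c K) (ltry _).
Qed.

Lemma taylor_coef_linear (k : Cplx R) f g : carrier bloch f -> carrier bloch g ->
  taylor_coef (k *: f + g) = (fun n => k * taylor_coef f n + taylor_coef g n).
Proof.
move=> bf bg; apply: taylor_coef_unique => z z1.
have h : (fun n => k * series (fun n => taylor_coef f n * z ^+ n) n + series (fun n => taylor_coef g n * z ^+ n) n) @ \oo
    --> k * f z + g z.
  exact: (cvgD (cvgM (cvg_cst k) (bloch_taylor bf z1)) (bloch_taylor bg z1)).
apply: (cvg_eq1 _ h) => n; rewrite /series /= mulr_sumr -big_split /=.
by apply: eq_bigr => i _; rewrite mulrA -mulrDl.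
Qed.

Lemma increasing_seq_ge (s : nat -> nat) : {homo s : m n / (m < n)%N} -> forall n, (n <= s n)%N.
Proof. by move=> hs; elim=> // n IH; apply: leq_ltn_trans IH _; exact: hs. Qed.

Lemma cvg_subseq (U : topologicalType) (u : nat -> U) (s : nat -> nat) (l : U) :
  {homo s : m n / (m < n)%N} -> u @ \oo --> l -> (u \o s) @ \oo --> l.
Proof.
move=> hs ul; apply: cvg_comp ul; move=> P [N _ hN]; exists N => // n /= Nn.
by apply: hN => /=; exact: leq_trans Nn (increasing_seq_ge hs n).
Qed.

Lemma bolzano_weierstrass_cplx (v : nat -> Cplx R) (B : R) : (forall i, cabs (v i) <= B) ->
  exists (s : nat -> nat) (l : Cplx R), {homo s : m n / (m < n)%N} /\ (v \o s) @ \oo --> l.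
Proof.
move=> vB.
have bnd (g : Cplx R -> R) : (forall z, `|g z| <= cabs z) -> forall s : nat -> nat, bounded_fun (fun i => g (v (s i))).
  move=> gz s; exists B; split; first exact: num_real.
  by move=> x Bx i _ /=; rewrite (le_trans (gz _))// (le_trans (vB _))// ltW.
have [s1 is1 c1] := bolzano_weierstrass (bnd _ Re_le_cabs id).
have [s2 is2 c2] := bolzano_weierstrass (bnd _ Im_le_cabs s1).
have h1 : {homo s1 : m n / (m < n)%N} by move=> m n mn; have := leW_mono is1 m n; rewrite !ltEnat /= mn.
have h2 : {homo s2 : m n / (m < n)%N} by move=> m n mn; have := leW_mono is2 m n; rewrite !ltEnat /= mn.
move: c1 c2 => /cvg_ex[/= l1 hl1] /cvg_ex[/= l2 hl2].
exists (s1 \o s2), (l1 +i* l2)%C; split; first by move=> m n /h2/h1.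
apply: cvg_ReIm => /=; last exact: hl2.
exact: (@cvg_subseq _ (fun i => Re (v (s1 i))) s2 l1 h2 hl1).
Qed.

Lemma bolzano_weierstrass_vec (K : nat) (v : nat -> nat -> Cplx R) (B : nat -> R) :
  (forall n i, cabs (v n i) <= B n) ->
  exists (s : nat -> nat) (l : nat -> Cplx R), {homo s : m n / (m < n)%N} /\
    forall n, (n < K)%N -> (v n \o s) @ \oo --> l n.
Proof.
move=> vB; elim: K => [|K [s [l [hs hl]]]]; first by exists id, (fun=> 0); split.
have [s' [l' [hs' hl']]] := @bolzano_weierstrass_cplx (fun i => v K (s i)) (B K) (fun i => vB K (s i)).
exists (s \o s'), (fun n => if n == K then l' else l n); split; first by move=> m n mn; apply: hs; exact: hs'.
move=> n; rewrite ltnS leq_eqVlt => /orP[/eqP ->|nK].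
  by rewrite eqxx; exact: hl'.
rewrite (ltn_eqF nK).
exact: (@cvg_subseq _ (v n \o s) s' (l n) hs' (hl n nK)).
Qed.

End PolynomialOperators.

(** * Cutting the integral at r and the upper estimate *)

Lemma Rintegral_unit_split {R : realType} (mu : {measure set (measurableTypeR R) -> \bar R})
  (r : R) (g : R -> R) : 0 <= r < 1 -> mu.-integrable `[0, 1%R[ (EFin \o g) ->
  \int[mu]_(t in `[0, 1%R[) g t = \int[mu]_(t in `[r, 1%R[) g t + \int[mu]_(t in `[0, r[) g t.
Proof.
move=> /andP[r0 rlt1] ig.
have JI : `[0, 1%R[%classic = `[0, r[%classic `|` `[r, 1%R[%classic :> set R.
  by apply: itv_bndbnd_setU; rewrite bnd_simp// ltW.
rewrite JI addrC Rintegral_setU -?JI//; try exact: measurable_itv.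
apply/disj_setPS => t []; rewrite /= !in_itv/= => /andP[_ tr] /andP[rt _].
by have := lt_le_trans tr rt; rewrite ltxx.
Qed.

Section UpperBound.
Context {R : realType}.
Variable mu : {finite_measure set (measurableTypeR R) -> \bar R}.
Implicit Types (t : R) (z : Cplx R) (f g : Cplx R -> Cplx R) (K : nat).
Variables (M0 r M : R).
Hypothesis hM0 : carleson_at mu 0 M0.
Hypothesis r01 : 0 <= r < 1.
Hypothesis hM : carleson_at mu r M.

Let I := (`[r, 1%R[%classic : set (measurableTypeR R)).
Let J := (`[0%R, r[%classic : set (measurableTypeR R)).
Let mI : measurable I. Proof. exact: measurable_itv. Qed.
Let mJ : measurable J. Proof. exact: measurable_itv. Qed.
(** A radius strictly between [r] and 1. Coefficient bounds at [r1] make the Taylor remainders on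
    [[0, r]] decay like [q ^ K], uniformly over the unit ball. *)
Let r1 := (1 + r) / 2.
Let q := r / r1.
Let r1_01 : 0 <= r1 < 1. Proof. by case/andP: r01 => *; rewrite /r1; apply/andP; split; lra. Qed.
Let r1_0 : 0 < r1. Proof. by case/andP: r01 => *; rewrite /r1; lra. Qed.
Let q01 : 0 <= q < 1.
Proof.
case/andP: r01 => r0 rlt1; rewrite divr_ge0 ?(ltW r1_0)//= ltr_pdivrMr// mul1r /r1; lra.
Qed.
Let Jt t : J t -> 0 <= t <= r /\ 0 <= t < 1.
Proof.
rewrite /J /= in_itv/= => /andP[t0 tr]; rewrite t0 (ltW tr); split => //.
by rewrite (lt_trans tr)//; case/andP: r01.
Qed.
Let J01 : J `<=` `[0, 1%R[. Proof. by move=> t /Jt[_]. Qed.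
Let I01 : I `<=` `[0, 1%R[.
Proof.
move=> t; rewrite /I /= !in_itv/= => /andP[rt ->]; rewrite (le_trans _ rt)//.
by case/andP: r01.
Qed.

Let m_ (j : nat) : R := \int[mu]_(t in J) (t ^+ j).
Let coef K f n : Cplx R := \sum_(0 <= k < K) rtoC (m_ (n + k)) * taylor_coef f k.
(** Written through moments of the measure on [[0, r)], so that linearity and finite rank are
    visible; [S_integral] gives the integral form that is compared with the Hilbert operator. *)
Let S K f := poly_disc (coef K f) K.

Let Bf (L : R) := (4 * L ^+ 2 + 1) / 2 * shell_kernel 0 r1.

Let coef_bound L f k : carrier bloch f -> (nnorm bloch f <= L%:E)%E ->
  cabs (taylor_coef f k) * r1 ^+ k <= Bf L.
Proof.
move=> bf fL; apply: le_trans (bloch_coef_sum_le k.+1 bf fL r1_01).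
rewrite big_nat_recr//= lerDr sumr_ge0// => i _.
by rewrite mulr_ge0 ?cabs_ge0// exprn_ge0// ltW.
Qed.

Let S_linear K : linear_operator bloch bmoa (S K).
Proof.
split=> [f _|k f g bf bg]; first exact: poly_disc_bmoa.
rewrite /S -poly_disc_linear; congr (poly_disc _ K); apply/funext => n.
rewrite /coef taylor_coef_linear// mulr_sumr -big_split /=.
by apply: eq_bigr => j _; rewrite mulrDr mulrCA.
Qed.

Let m_bound j : `|m_ j| <= fine (mu J).
Proof.
have iC : mu.-integrable J (EFin \o (fun=> 1 : R)) by exact: finite_measure_integrable_cst.
have it : mu.-integrable J (EFin \o (fun t : R => t ^+ j)).
  apply: (le_integrable mJ _ _ iC).
    by apply/measurable_EFinP; apply: measurable_funTS; exact: exprn_measurable.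
  move=> t /Jt[_ /andP[t0 t1]] /=; rewrite lee_fin normrX ger0_norm// normr1.
  by rewrite exprn_ile1// ltW.
rewrite (le_trans (le_normr_Rintegral mJ it))// -[leRHS]mul1r -Rintegral_cst//.
apply: le_Rintegral => //; first exact: (integrable_norm it).
move=> t /Jt[_ /andP[t0 t1]]; rewrite normrX ger0_norm//.
by rewrite exprn_ile1// ltW.
Qed.

(** A bounded sequence has images with bounded coefficients. There are only [K] of them, so a common
    subsequence converges, and [poly_disc_bmoa_norm] turns this into norm convergence. *)
Let S_compact K : compact_operator bloch bmoa (S K).
Proof.
move=> u L hu.
have cB n i : cabs (coef K (u i) n) <= \sum_(0 <= k < K) fine (mu J) * (Bf L / r1 ^+ k).
  rewrite (le_trans (cabs_sum _ _ _))// ler_sum// => k _.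
  rewrite cabsM cabs_rtoC ler_pM ?cabs_ge0//.
  by rewrite ler_pdivlMr ?exprn_gt0//; have [b1 b2] := hu i; exact: coef_bound.
have [s [l [hs hl]]] := @bolzano_weierstrass_vec R K (fun n i => coef K (u i) n) _ cB.
exists s, (poly_disc l K); split => //; first exact: poly_disc_bmoa.
have E i : S K (u (s i)) - poly_disc l K = poly_disc (fun n => coef K (u (s i)) n - l n) K.
  exact: poly_discB.
under eq_fun do rewrite E.
apply: (@squeeze_cvge _ _ _ _ (cst 0%E) _
  (fun i => (5 * \sum_(0 <= n < K) cabs (coef K (u (s i)) n - l n))%:E)).
- apply: nearW => i; rewrite poly_disc_bmoa_norm andbT.
  apply: le_trans (bloch_norm_ge0 _) (bloch_norm_le_bmoa _).
  exact: poly_disc_analytic.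
- exact: cvg_cst.
apply: cvg_EFin; first exact: nearW.
rewrite -[X in _ --> X](mulr0 5); apply: cvgM; first exact: cvg_cst.
have : forall N, (N <= K)%N ->
   \sum_(0 <= n < N) cabs (coef K (u (s i)) n - l n) @[i --> \oo] --> (0 : R).
  elim=> [_|N IH NK]; first by under eq_fun do rewrite big_nil; exact: cvg_cst.
  apply: (cvg_eq1 (u := fun i => \sum_(0 <= n < N) cabs (coef K (u (s i)) n - l n) +
    cabs (coef K (u (s i)) N - l N))) => [i|]; first by rewrite big_nat_recr.
  have h1 : cabs (coef K (u (s i)) N - l N) @[i --> \oo] --> (0 : R).
    by have /cvg_cplxP := hl N NK.
  suff : \sum_(0 <= n < N) cabs (coef K (u (s i)) n - l n) + cabs (coef K (u (s i)) N - l N)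
    @[i --> \oo] --> (0 + 0 : R) by rewrite addr0.
  exact: (cvgD (IH (ltnW NK)) h1).
by apply.
Qed.

Let T_split f z : carleson_at mu 0 M0 -> carrier bloch f -> cabs z < 1 ->
  hilbert_op mu f z = cauchy_transform mu I (fun t => f (rtoC t)) z +
    cauchy_transform mu J (fun t => f (rtoC t)) z.
Proof.
move=> h0 bf z1; rewrite (hilbert_op_integral h0 bf z1) /cauchy_transform.
have m01 : measurable (`[0, 1%R[%classic : set (measurableTypeR R)) by exact: measurable_itv.
have [iR iI] := cintegrable_kernel m01 (@subset_refl _ _) (bloch_cintegrable h0 bf) z1.
by apply: cplx_eqP; rewrite ?ReD ?ImD /= (Rintegral_unit_split r01).
Qed.

Let rpow_cint j : cintegrable mu J (fun t => rtoC (t ^+ j)).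
Proof.
apply: (@cintegrable_le _ _ _ mu _ mJ _ (fun=> 1)).
- by apply: cmeasurable_rtoC; apply: measurable_funTS; exact: exprn_measurable.
- exact: finite_measure_integrable_cst.
- move=> t /Jt[_ /andP[t0 t1]]; rewrite cabs_rtoC normrX ger0_norm//.
  by rewrite exprn_ile1// ltW.
Qed.

Let S_integral K f z : cabs z < 1 -> S K f z =
  cintegral mu J (fun t => (\sum_(0 <= k < K) taylor_coef f k * rtoC t ^+ k) *
    \sum_(0 <= n < K) (rtoC t * z) ^+ n).
Proof.
move=> z1; rewrite /S poly_discE//.
transitivity (cintegral mu J (fun t => \sum_(0 <= n < K) \sum_(0 <= k < K)
    (taylor_coef f k * z ^+ n) * rtoC (t ^+ (n + k)))).
  rewrite cintegral_sum//; last first.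
    by move=> n; apply: cintegrable_sum => // k; exact: cintegrableZ.
  apply: eq_bigr => n _; rewrite cintegral_sum//; last by move=> k; exact: cintegrableZ.
  rewrite /coef mulr_suml; apply: eq_bigr => k _.
  by rewrite cintegralZ// cintegral_rtoC /m_; ring.
apply: eq_cintegral => t _; rewrite mulrC big_distrlr /=.
apply: eq_bigr => n _; apply: eq_bigr => k _.
by rewrite rtoCX exprD exprMn; ring.
Qed.

Let partial_sum_bound f t K : carrier bloch f -> (nnorm bloch f <= 1%:E)%E -> 0 <= t <= r ->
  cabs (\sum_(0 <= k < K) taylor_coef f k * rtoC t ^+ k) <= Bf 1 / (1 - q) /\
  cabs (f (rtoC t) - \sum_(0 <= k < K) taylor_coef f k * rtoC t ^+ k) <= Bf 1 / (1 - q) * q ^+ K.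
Proof.
move=> bf f1 /andP[t0 tr]; have /andP[r0 rlt1] := r01; have /andP[q0 q1] := q01.
have B0 : 0 <= Bf 1.
  by apply: le_trans (coef_bound 0 bf f1); rewrite mulr_ge0 ?cabs_ge0// exprn_ge0// ltW.
have term k : cabs (taylor_coef f k * rtoC t ^+ k) <= Bf 1 * q ^+ k.
  rewrite cabsM cabsX cabs_rtoC ger0_norm// /q expr_div_n mulrCA.
  rewrite (@le_trans _ _ (cabs (taylor_coef f k) * r ^+ k))//.
    by rewrite ler_wpM2l ?cabs_ge0// lerXn2r ?nnegrE.
  rewrite mulrC ler_wpM2l ?exprn_ge0// ler_pdivlMr ?exprn_gt0//.
  exact: coef_bound.
split.
  rewrite (le_trans (cabs_sum _ _ _))//.
  apply: (@le_trans _ _ (\sum_(0 <= k < K) Bf 1 * q ^+ k)); first by apply: ler_sum => k _; exact: term.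
  by rewrite -mulr_sumr ler_wpM2l// sum_geometric_le.
have t1 : cabs (rtoC t) < 1 by rewrite cabs_rtoC ger0_norm//; lra.
set s := \sum_(0 <= k < K) _.
have h : (fun N => series (fun k => taylor_coef f k * rtoC t ^+ k) N - s) @ \oo --> f (rtoC t) - s.
  exact: (cvgB (bloch_taylor bf t1) (cvg_cst s)).
apply: (cvgr_to_le (cvg_cabs h)); exists K => // N /= KN.
rewrite /series /= (big_cat_nat (n := K))//= -/s addrAC subrr add0r.
rewrite (le_trans (cabs_sum _ _ _))//.
apply: (@le_trans _ _ (\sum_(K <= k < N) Bf 1 * q ^+ k)); first by apply: ler_sum => k _; exact: term.
rewrite -{1}[K]add0n big_addn.
apply: (@le_trans _ _ (Bf 1 * q ^+ K * \sum_(0 <= i < N - K) q ^+ i)).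
  by rewrite mulr_sumr; apply: ler_sum => i _; rewrite exprD mulrA mulrAC.
rewrite [leRHS]mulrAC; apply: ler_wpM2l; first by rewrite mulr_ge0// exprn_ge0.
by apply: sum_geometric_le; rewrite q0.
Qed.

(** [q ^ K] comes from truncating [f] and [r ^ K] from truncating the kernel. The estimate
    [|1 - t z| >= 1 - r], valid for [t <= r], makes the error uniform on the whole disc. *)
Let err K := (Bf 1 / (1 - q) * (q ^+ K + r ^+ K)) / (1 - r) * fine (mu J).

Let error_bound K f z : carrier bloch f -> (nnorm bloch f <= 1%:E)%E -> cabs z < 1 ->
  cabs (cauchy_transform mu J (fun t => f (rtoC t)) z - S K f z) <= err K.
Proof.
move=> bf f1 z1; have /andP[r0 rlt1] := r01.
rewrite S_integral// /cauchy_transform.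
have i1 : cintegrable mu J (fun t => f (rtoC t)).
  have [g1 g2] := bloch_cintegrable hM0 bf.
  have m01 : measurable (`[0, 1%R[%classic : set (measurableTypeR R)) by exact: measurable_itv.
  by split; [exact: integrableS g1|exact: integrableS g2].
have i2 : cintegrable mu J (fun t => f (rtoC t) * (1 - rtoC t * z)^-1) by exact: cintegrable_kernel.
have i3 : cintegrable mu J (fun t => (\sum_(0 <= k < K) taylor_coef f k * rtoC t ^+ k) *
    \sum_(0 <= n < K) (rtoC t * z) ^+ n).
  have mr : cmeasurable J (fun t => rtoC t) by apply: cmeasurable_unit_itv => // t _; exact: continuous_rtoC.
  apply: (@cintegrable_le _ _ _ mu _ mJ _ (fun=> Bf 1 / (1 - q) * K%:R)).
  - apply: cmeasurableM.
      apply: cmeasurable_sum => k; apply: cmeasurableM; first exact: cmeasurable_cst.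
      exact: cmeasurableX.
    apply: cmeasurable_sum => n; apply: cmeasurableX.
    exact: (cmeasurableM mr (cmeasurable_cst _ z)).
  - exact: finite_measure_integrable_cst.
  - move=> t /Jt[tr /andP[t0 t1]]; rewrite cabsM ler_pM ?cabs_ge0//.
      by have [] := partial_sum_bound K bf f1 tr.
    rewrite (le_trans (cabs_sum _ _ _))//.
    apply: (@le_trans _ _ (\sum_(0 <= n < K) 1)); last by rewrite big_const_nat subn0 iter_addr_0.
    apply: ler_sum => n _; rewrite cabsX exprn_ile1 ?cabs_ge0//.
    rewrite cabsM cabs_rtoC ger0_norm// mulr_ile1 ?cabs_ge0// ltW//.
rewrite -cintegralB// /err -Rintegral_cst//.
apply: cabs_cintegral_le => //; first exact: cintegrableB.
  exact: finite_measure_integrable_cst.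
move=> t /Jt[tr /[dup] t01 /andP[t0 t1]]; have [h1 h2] := partial_sum_bound K bf f1 tr.
set s := \sum_(0 <= k < K) taylor_coef f k * _ in h1 h2 *.
have /andP[_ tr'] := tr.
have n1 := kernel_neq0 (unit_itv_ltN1 t01) z1.
rewrite (geometric_sum _ n1).
have -> : f (rtoC t) * (1 - rtoC t * z)^-1 - s * ((1 - rtoC t * z)^-1 * (1 - (rtoC t * z) ^+ K)) =
  ((f (rtoC t) - s) + s * (rtoC t * z) ^+ K) * (1 - rtoC t * z)^-1 by ring.
have tz : cabs (rtoC t * z) <= r.
  rewrite cabsM cabs_rtoC ger0_norm// -[leRHS]mulr1 ler_pM ?cabs_ge0// ltW//.
rewrite cabsM ler_pM ?cabs_ge0//; last first.
  rewrite cabsV lef_pV2 ?posrE ?subr_gt0 ?cabs_gt0//.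
  have := cabs_le_sub (1 : Cplx R) (rtoC t * z); rewrite cabs1; lra.
rewrite (le_trans (cabsD _ _))// mulrDr lerD// cabsM cabsX ler_pM ?cabs_ge0 ?exprn_ge0 ?cabs_ge0//.
by rewrite lerXn2r ?nnegrE ?cabs_ge0.
Qed.

Let err_cvg : err K @[K --> \oo] --> (0 : R).
Proof.
have /andP[r0 rlt1] := r01; have /andP[q0 q1] := q01.
have h : (q ^+ K + r ^+ K) @[K --> \oo] --> (0 + 0 : R).
  by apply: cvgD; apply: cvg_expr; rewrite ger0_norm.
rewrite -[X in _ --> X](_ : (Bf 1 / (1 - q) * (0 + 0)) / (1 - r) * fine (mu J) = 0); last first.
  by rewrite addr0 mulr0 !mul0r.
apply: cvgM; last exact: cvg_cst.
apply: cvgM; last exact: cvg_cst.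
by apply: cvgM; [exact: cvg_cst|exact: h].
Qed.

Let M_ge0 : 0 <= M.
Proof.
have /andP[r0 rlt1] := r01; have := hM (lexx r) rlt1 => h.
have : 0 <= M * (1 - r).
  apply: le_trans h; rewrite mulr_ge0 ?fine_ge0//.
  by rewrite (le_trans _ (elog_ge1 r01)).
by rewrite pmulr_lge0// subr_gt0.
Qed.

Lemma essential_norm_upper :
  (essential_norm bloch bmoa (hilbert_op mu) <= (640 * M)%:E)%E.
Proof.
have /andP[r0 rlt1] := r01.
apply/lee_addgt0Pr => e e0.
have e5 : 0 < e / 5 by rewrite divr_gt0.
have [K _ /(_ K (leqnn K)) hK] := cvgr_lt _ err_cvg _ e5.
apply: (@le_trans _ _ (opnorm bloch bmoa (fun f => hilbert_op mu f - S K f))).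
  apply: ereal_inf_lbound; exists (S K); last by [].
  by split; [exact: S_linear|exact: S_compact].
apply: ge_ereal_sup => _ [f [bf f1] <-].
(* 128 bounds the value at 0 and [2 * 256] the seminorm of the part over [[r, 1)], whence 640; the
   truncation error costs [5 * (e / 5)]. *)
rewrite -EFinD; apply: (@le_trans _ _ (128 * (1 * M) + 2 * (256 * (1 * M)) + 5 * (e / 5))%:E); last first.
  by rewrite lee_fin; lra.
have FL t : r <= t < 1 -> cabs (f (rtoC t)) <= 1 * elog t.
  move=> /andP[rt t1]; apply: bloch_le_elog => //.
  by rewrite t1 (le_trans r0).
have i1 : cintegrable mu I (fun t => f (rtoC t)).
  have [g1 g2] := bloch_cintegrable hM0 bf.
  have m01 : measurable (`[0, 1%R[%classic : set (measurableTypeR R)) by exact: measurable_itv.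
  by split; [exact: integrableS g1|exact: integrableS g2].
apply: (@bmoa_norm_le _ _ (cauchy_transform mu I (fun t => f (rtoC t)))
   (fun z => cauchy_transform mu J (fun t => f (rtoC t)) z - S K f z)).
- by have := M_ge0; lra.
- exact: ltW.
- move=> z z1.
  have h1 := has_cderiv_continuous (hilbert_op_has_cderiv hM0 bf z1).
  have [dS _] := poly_disc_analytic (coef K f) K.
  have h2 := has_cderiv_continuous (derivable_has_cderiv (dS z z1)).
  exact: (cvgB h1 h2).
- move=> z z1; rewrite [LHS](_ : _ = hilbert_op mu f z - S K f z)// (T_split hM0)//.
  by rewrite addrA.
- by apply: cauchy_transform_0.
- by move=> a a1; apply: cauchy_transform_disc_aut.
- by move=> z z1; apply: le_trans (error_bound K bf f1 z1) (ltW hK).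
Qed.

End UpperBound.

(** * Lower bound *)

Section Transfer.
Context {R : realType}.
Implicit Types (f g : Cplx R -> Cplx R) (z : Cplx R).

Lemma has_cderiv_linear (k : Cplx R) f g z a b : has_cderiv f z a -> has_cderiv g z b ->
  has_cderiv (k *: f + g) z (k * a + b).
Proof.
move=> hf hg e e0.
have k0 : 0 < 2 * (cabs k + 1) by rewrite mulr_gt0// ltr_wpDl ?cabs_ge0.
have e2 : 0 < e / 2 by rewrite divr_gt0.
have [d1 d10 h1] := hf (e / (2 * (cabs k + 1))) (divr_gt0 e0 k0).
have [d2 d20 h2] := hg (e / 2) e2.
exists (Num.min d1 d2); first by rewrite lt_min d10.
move=> w; rewrite lt_min => /andP[/h1 w1 /h2 w2].
rewrite [X in cabs X](_ : _ = k * (f w - f z - a * (w - z)) + (g w - g z - b * (w - z))); last first.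
  transitivity ((k * f w + g w) - (k * f z + g z) - (k * a + b) * (w - z)) => //.
  by move: (f w) (f z) (g w) (g z) => x y x' y'; ring.
rewrite (le_trans (cabsD _ _))// cabsM.
have x0 := cabs_ge0 (w - z).
have : cabs k * cabs (f w - f z - a * (w - z)) <= e / 2 * cabs (w - z).
  have -> : e / 2 * cabs (w - z) = (cabs k + 1) * (e / (2 * (cabs k + 1)) * cabs (w - z)).
    by field; rewrite gt_eqF// ltr_wpDl ?cabs_ge0.
  by rewrite ler_pM ?cabs_ge0// lerDl.
by move: w2; move: (cabs _) (cabs _ * cabs _) => *; lra.
Qed.

Lemma has_cderivB f g z a b : has_cderiv f z a -> has_cderiv g z b ->
  has_cderiv (f - g) z (a - b).
Proof.
move=> hf hg; have := has_cderiv_linear (-1) hg hf.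
by rewrite scaleN1r addrC mulN1r [- b + a]addrC.
Qed.

Lemma analytic_has_cderiv f z : analytic_disc f -> cabs z < 1 -> has_cderiv f z (derive1 f z).
Proof. by move=> [df _] z1; apply: derivable_has_cderiv; apply: df. Qed.

Lemma analytic_discB f g : analytic_disc f -> analytic_disc g -> analytic_disc (f - g).
Proof.
move=> af ag; split=> z z1.
  by have [] := has_cderivP (has_cderivB (analytic_has_cderiv af z1) (analytic_has_cderiv ag z1)).
transitivity (f z - g z) => //; have [_ ->//] := af; have [_ ->//] := ag.
exact: subrr.
Qed.

Lemma derivative_le_bloch_norm f z : cabs z < 1 ->
  ((cabs (derive1 f z) * (1 - cabs z ^+ 2))%:E <= nnorm bloch f)%E.
Proof.
move=> z1; apply: (@le_trans _ _ (bloch_seminorm f)).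
  by apply: ereal_sup_ubound; exists z.
by rewrite leeDr// lee_fin cabs_ge0.
Qed.

(** An operator that is compact into BMOA is also compact into the Bloch space, and the operator
    norm of the difference can only decrease. *)
Lemma essential_norm_bloch_le_bmoa (mu : {finite_measure set (measurableTypeR R) -> \bar R}) (M0 : R) :
  carleson_at mu 0 M0 ->
  (essential_norm bloch bloch (hilbert_op mu) <= essential_norm bloch bmoa (hilbert_op mu))%E.
Proof.
move=> h0; apply: le_ereal_inf_tmp => _ [S [[SB Slin] Scpt] <-].
apply: (@le_trans _ _ (opnorm bloch bloch (fun f => hilbert_op mu f - S f))).
  apply: ereal_inf_lbound; exists S; last by [].
  split; first by split; [move=> f bf; apply: bmoa_carrier_bloch; exact: SB|exact: Slin].
  move=> u M uM; have [s [g [hs gB sg]]] := Scpt u M uM.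
  exists s, g; split; [exact: hs|exact: bmoa_carrier_bloch|].
  apply: (@squeeze_cvge _ _ _ _ (cst 0%E) _ (fun n => nnorm bmoa (S (u (s n)) - g))); last exact: sg.
    apply: nearW => n; rewrite bloch_norm_ge0 /=; apply: bloch_norm_le_bmoa.
    apply: analytic_discB; last by case: gB.
    by have [] := SB _ (uM (s n)).1.
  exact: cvg_cst.
apply: ge_ereal_sup => _ [f [bf f1] <-].
apply: (@le_trans _ _ (nnorm bmoa (hilbert_op mu f - S f))).
  apply: bloch_norm_le_bmoa; apply: analytic_discB; first exact: hilbert_op_analytic h0 _ bf.
  by have [] := SB _ bf.
by apply: ereal_sup_ubound; exists f.
Qed.

End Transfer.

(** * Logarithmic test polynomials *)

Section TestFunctions.
Context {R : realType}.
Implicit Types (A B : pred nat) (z : Cplx R).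

(** [k] times the coefficient is [1/2] for every positive [k] in [A], so up to this factor the
    derivative is a subsum of a geometric series. *)
Definition log_coef A (k : nat) : R := if A k then (2 * k%:R)^-1 else 0.

Definition log_poly A K : Cplx R -> Cplx R := poly_disc (fun k => rtoC (log_coef A k)) K.

Lemma log_coef_ge0 A k : 0 <= log_coef A k.
Proof. by rewrite /log_coef; case: ifP => // _; rewrite invr_ge0 mulr_ge0. Qed.

(* Whatever the exponents in [A], the derivative is dominated by [1 / (2 (1 - |z|))]. *)
Lemma log_poly_bloch_norm A K : (nnorm bloch (log_poly A K) <= 1%:E)%E.
Proof.
have z0 : cabs (0 : Cplx R) < 1 by rewrite cabs0.
(* The convention [0^-1 = 0] removes the constant term even when [A] contains 0. *)
have l0 : log_coef A 0 = 0 by rewrite /log_coef mulr0 invr0 if_same.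
have -> : nnorm bloch (log_poly A K) = bloch_seminorm (log_poly A K).
  rewrite /=; suff -> : cabs (log_poly A K 0) = 0 by rewrite add0e.
  rewrite /log_poly poly_discE// big1 ?cabs0// => -[|k] _; first by rewrite l0 rtoC0 mul0r.
  by rewrite expr0n mulr0.
apply: ge_ereal_sup => _ [z z1 <-]; rewrite /unit_disc /mkset in z1.
have [_ ->] := has_cderivP (has_cderiv_poly_disc (fun k => rtoC (log_coef A k)) K z1).
have c0 := cabs_ge0 z.
have h : cabs (\sum_(0 <= n < K) rtoC (log_coef A n) * n%:R * z ^+ n.-1) <= 1 / 2 * (1 - cabs z)^-1.
  rewrite (le_trans (cabs_sum _ _ _))//.
  case: K => [|K]; first by rewrite big_nil mulr_ge0// invr_ge0 subr_ge0 ltW.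
  rewrite big_nat_recl// mulr0 mul0r cabs0 add0r.
  apply: (@le_trans _ _ (\sum_(0 <= i < K) 1 / 2 * cabs z ^+ i)); last first.
    by rewrite -mulr_sumr ler_wpM2l// sum_geometric_le// c0.
  apply: ler_sum => i _; rewrite cabsM cabsX ler_wpM2r ?exprn_ge0//.
  have -> : (i.+1%:R : Cplx R) = rtoC i.+1%:R by rewrite /rtoC rmorph_nat.
  rewrite -rtoCM cabs_rtoC ger0_norm ?mulr_ge0 ?log_coef_ge0//.
  rewrite /log_coef; case: ifP => _; last by rewrite mul0r.
  by rewrite invfM mulfVK ?pnatr_eq0// div1r.
rewrite lee_fin.
(* [1 - |z|^2 <= 2 (1 - |z|)]; the 2 is what the [1/2] in [log_coef] compensates. *)
apply: (@le_trans _ _ (1 / 2 * (1 - cabs z)^-1 * (2 * (1 - cabs z)))).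
  rewrite ler_pM ?cabs_ge0//; last by nra.
  by rewrite subr_ge0 ltW// cabs_lt1_sqr.
by rewrite le_eqVlt; apply/orP; left; apply/eqP; field; rewrite subr_eq0 eq_sym lt_eqF.
Qed.

Lemma log_poly_bloch A K : carrier bloch (log_poly A K).
Proof.
split; first exact: poly_disc_analytic.
apply: (@le_lt_trans _ _ (nnorm bloch (log_poly A K))); first by rewrite leeDr// lee_fin cabs_ge0.
exact: le_lt_trans (log_poly_bloch_norm A K) (ltry _).
Qed.

Lemma log_poly_add A B K K' : (K <= K')%N -> (forall k, A k -> (k < K)%N) ->
  (forall k, A k -> ~~ B k) ->
  log_poly A K + log_poly B K' = log_poly (fun k => A k || B k) K'.
Proof.
move=> KK AK AB; apply/funext => z.
transitivity (log_poly A K z + log_poly B K' z) => //.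
have [z1|z1] := boolP (cabs z < 1); last by rewrite /log_poly /poly_disc (negbTE z1) addr0.
rewrite /log_poly !poly_discE//.
have -> : \sum_(0 <= k < K) rtoC (log_coef A k) * z ^+ k = \sum_(0 <= k < K') rtoC (log_coef A k) * z ^+ k.
  rewrite [RHS](big_cat_nat (n := K))//= -[LHS]addr0; congr (_ + _).
  rewrite big_nat_cond big1// => k /andP[/andP[Kk _] _].
  rewrite /log_coef; case: ifPn => [/AK|_]; first by rewrite ltnNge Kk.
  by rewrite rtoC0 mul0r.
rewrite -big_split /=; apply: eq_bigr => k _; rewrite -mulrDl -rtoCD; congr (rtoC _ * _).
rewrite /log_coef; have := AB k; case: (A k) => /= [/(_ isT)/negbTE ->|_]; first by rewrite addr0.
by rewrite add0r.
Qed.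

(** Over these exponents the sum of [1/k] is at least [ln (N^2) - ln N = ln N]. *)
Definition block N : pred nat := fun k => (N <= k < N ^ 2)%N.

Definition test_fun N : Cplx R -> Cplx R := log_poly (block N) (N ^ 2).

Lemma harmonic_ge_ln (N K : nat) : (0 < N)%N -> (N <= K)%N ->
  ln K%:R - ln N%:R <= \sum_(N <= k < K) k%:R^-1 :> R.
Proof.
move=> N0; elim: K => [|K IH]; first by rewrite leqn0 => /eqP ->; rewrite subrr big_geq.
rewrite leq_eqVlt => /predU1P[<-|]; first by rewrite subrr big_geq.
rewrite ltnS => NK; rewrite big_nat_recr//=.
have K0 : 0 < K%:R :> R by rewrite ltr0n (leq_trans N0).
have h : ln K.+1%:R <= ln K%:R + K%:R^-1 :> R.
  have -> : K.+1%:R = K%:R * (1 + K%:R^-1) :> R.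
    by rewrite mulrDr mulr1 mulfV ?gt_eqF// natr1.
  rewrite lnM ?posrE ?addr_gt0 ?invr_gt0// lerD2l; apply: le_ln1Dx.
  by apply: (@lt_trans _ _ 0); [lra|rewrite invr_gt0].
have := IH NK; lra.
Qed.

Lemma bernoulli (x : R) n : 0 <= x <= 1 -> 1 - n%:R * (1 - x) <= x ^+ n.
Proof.
move=> /andP[x0 x1]; elim: n => [|n IH]; first by rewrite mul0r subr0.
rewrite exprS -natr1.
have h : x * (1 - n%:R * (1 - x)) <= x * x ^+ n by rewrite ler_wpM2l.
have n0 : 0 <= n%:R :> R by [].
have h2 : 0 <= n%:R * (1 - x) ^+ 2 by rewrite mulr_ge0 ?sqr_ge0.
apply: le_trans h; rewrite -subr_ge0; apply: le_trans h2 _.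
by rewrite le_eqVlt; apply/orP; left; apply/eqP; ring.
Qed.

Lemma ln8_ge1 : 1 <= ln (8 : R).
Proof.
have -> : 8 = 2 ^+ 3 :> R by rewrite -natrX.
rewrite lnXn// -[ln 2 *+ 3](mulr_natl (ln 2) 3).
have h : ln (2^-1 : R) <= - 2^-1.
  have e : 1 + - 2^-1 = 2^-1 :> R by lra.
  by rewrite -{1}e; apply: le_ln1Dx; lra.
by move: h; rewrite lnV ?posrE//; lra.
Qed.

(* Degrees [N ^ 2] just below [1 / (2 (1 - r))] make [t ^ (N ^ 2) >= 1/2] on [r, 1),
   while [ln N] stays comparable to [elog r]. *)
Lemma exists_degree (N0 : nat) : exists2 dl : R, 2^-1 <= dl < 1 & forall r, dl < r -> r < 1 ->
  exists2 N, (N0 <= N)%N & (N ^ 2)%:R * (1 - r) <= 2^-1 /\ elog r <= 4 * ln N%:R.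
Proof.
pose n0 := maxn 8 N0.
have n08 : (8 <= n0)%N by rewrite leq_maxl.
have n0R : 8 <= n0%:R :> R by rewrite ler_nat.
have n0p : 0 < 2 * n0%:R ^+ 2 :> R by rewrite mulr_gt0// exprn_gt0//; lra.
exists (1 - (2 * n0%:R ^+ 2)^-1).
  rewrite gtrBl invr_gt0 n0p andbT.
  suff : (2 * n0%:R ^+ 2)^-1 <= 2^-1 :> R by lra.
  rewrite lef_pV2 ?posrE//; have : 1 <= n0%:R ^+ 2 :> R by rewrite expr_ge1//; lra.
  lra.
move=> r dr r1.
have x0 : 0 < 1 - r by lra.
(* [N] is the integer part of [y], so [N^2 (1 - r) <= 1/2], and [N] is at least 8 because [r]
   exceeds the threshold. *)
pose y := Num.sqrt (2 * (1 - r))^-1.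
have y2 : y ^+ 2 = (2 * (1 - r))^-1 by rewrite sqr_sqrtr// invr_ge0 mulr_ge0// ltW.
have y0 : 0 <= y by exact: sqrtr_ge0.
have ny : n0%:R <= y.
  rewrite -(@ler_pXn2r _ 2)// ?nnegrE// y2 -[leLHS]invrK lef_pV2 ?posrE ?mulr_gt0 ?invr_gt0 ?exprn_gt0//; last by lra.
  have : (2 * n0%:R ^+ 2)^-1 = 2^-1 * (n0%:R ^+ 2)^-1 :> R by rewrite invfM.
  lra.
have /andP[Ny yN] := truncn_itv y0.
set N := Num.truncn y in Ny yN.
have n0N : (n0 <= N)%N.
  by rewrite -ltnS -(ltr_nat R); apply: le_lt_trans yN.
have N8 : 8 <= N%:R :> R by rewrite ler_nat (leq_trans n08).
exists N; first by rewrite (leq_trans _ n0N)// leq_maxr.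
split.
  have : N%:R ^+ 2 <= (2 * (1 - r))^-1 by rewrite -y2 lerXn2r ?nnegrE.
  move=> /(ler_wpM2r (ltW x0)); rewrite natrX.
  by rewrite (_ : (2 * (1 - r))^-1 * (1 - r) = 2^-1)//; field; rewrite gt_eqF.
(* From [y < N + 1 <= 2 N] follows [1 / (1 - r) <= 8 N^2 <= N^3]. Hence [elog r <= 1 + 3 ln N], and
   [ln N >= ln 8 >= 1] absorbs the 1. *)
have h : (1 - r)^-1 <= N%:R ^+ 3.
  have h1 : (2 * (1 - r))^-1 <= (2 * N%:R) ^+ 2.
    rewrite -y2 lerXn2r ?nnegrE ?mulr_ge0// (le_trans (ltW yN))// -natr1; lra.
  have -> : (1 - r)^-1 = 2 * (2 * (1 - r))^-1 by field; rewrite gt_eqF.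
  have := sqr_ge0 (N%:R : R); rewrite exprS; nra.
rewrite elogE// -lnV ?posrE//.
have : ln (1 - r)^-1 <= ln (N%:R ^+ 3) by rewrite ler_ln ?posrE ?invr_gt0// exprn_gt0//; lra.
rewrite lnXn; last lra.
have : ln 8 <= ln N%:R :> R by rewrite ler_ln ?posrE//; lra.
by have := ln8_ge1; rewrite -[ln _ *+ 3](mulr_natl (ln N%:R) 3); lra.
Qed.

(** By Bernoulli's inequality [t^k >= r^(N^2) >= 1/2] for every [k] in the block, so the sum is at
    least a quarter of the sum of [1/k]. *)
Lemma test_fun_ge (N : nat) (r t : R) : (0 < N)%N -> 0 <= r -> r <= t -> t < 1 ->
  (N ^ 2)%:R * (1 - r) <= 2^-1 ->
  exists2 x : R, test_fun N (rtoC t) = rtoC x & ln N%:R / 4 <= x.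
Proof.
move=> N0 r0 rt t1 hN; have t0 := le_trans r0 rt.
exists (\sum_(0 <= k < N ^ 2) log_coef (block N) k * t ^+ k).
  rewrite /test_fun /log_poly poly_discE; last by rewrite cabs_rtoC ger0_norm.
  by rewrite rtoC_sum; apply: eq_bigr => k _; rewrite -rtoCX -rtoCM.
have tN : 2^-1 <= t ^+ (N ^ 2).
  have rr : 0 <= r <= 1 by rewrite r0 ltW// (le_lt_trans rt).
  have := bernoulli (N ^ 2) rr; have : r ^+ (N ^ 2) <= t ^+ (N ^ 2) by rewrite lerXn2r ?nnegrE.
  lra.
have NN : (N <= N ^ 2)%N by rewrite leq_pexpn2l// || rewrite -{1}[N]expn1 leq_pexp2l.
rewrite (big_cat_nat (n := N))//=; apply: (@le_trans _ _ (\sum_(N <= k < N ^ 2) log_coef (block N) k * t ^+ k)).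
  apply: (@le_trans _ _ (\sum_(N <= k < N ^ 2) 4^-1 * k%:R^-1)).
    rewrite -mulr_sumr mulrC ler_wpM2l//.
    have := harmonic_ge_ln N0 NN; rewrite natrX lnXn ?ltr0n// mulr2n; lra.
  rewrite big_nat_cond [leRHS]big_nat_cond; apply: ler_sum => k /andP[kN _].
  rewrite /log_coef /block kN invfM.
  have h : 2^-1 <= t ^+ k.
    by rewrite (le_trans tN)// ler_wiXn2l// ?t0 ?(ltW t1)//; case/andP: kN => _ /ltnW.
  have : 0 <= k%:R^-1 :> R by rewrite invr_ge0.
  by nra.
by rewrite lerDr sumr_ge0// => i _; rewrite mulr_ge0 ?log_coef_ge0 ?exprn_ge0.
Qed.

Lemma test_fun_real (N : nat) (t : R) : 0 <= t < 1 ->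
  exists2 x : R, test_fun N (rtoC t) = rtoC x & 0 <= x.
Proof.
move=> /andP[t0 t1]; exists (\sum_(0 <= k < N ^ 2) log_coef (block N) k * t ^+ k).
  rewrite /test_fun /log_poly poly_discE; last by rewrite cabs_rtoC ger0_norm.
  by rewrite rtoC_sum; apply: eq_bigr => k _; rewrite -rtoCX -rtoCM.
by rewrite sumr_ge0// => i _; rewrite mulr_ge0 ?log_coef_ge0 ?exprn_ge0.
Qed.

End TestFunctions.

(** * Test functions under compact perturbations and the lower estimate *)

Lemma cabs_mean_le {R : realType} (X : nat -> Cplx R) (x : Cplx R) J :
  J%:R * cabs x <= \sum_(0 <= j < J) cabs (X j - x) + cabs (\sum_(0 <= j < J) X j).
Proof.
have -> : J%:R * cabs x = cabs (\sum_(0 <= j < J) x).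
  rewrite big_const_nat subn0 iter_addr_0 -[x *+ J]mulr_natl cabsM; congr (_ * _).
  have -> : (J%:R : Cplx R) = rtoC J%:R by rewrite /rtoC rmorph_nat.
  by rewrite cabs_rtoC ger0_norm.
have -> : \sum_(0 <= j < J) x = \sum_(0 <= j < J) X j - \sum_(0 <= j < J) (X j - x).
  by rewrite -sumrB; apply: eq_bigr => j _; rewrite opprB addrC subrK.
rewrite (le_trans (cabsB _ _))// addrC lerD2r; exact: cabs_sum.
Qed.

Section LowerBound.
Context {R : realType}.
Variable mu : {finite_measure set (measurableTypeR R) -> \bar R}.
Variables (M0 m : R).
Hypothesis hM0 : carleson_at mu 0 M0.
Hypothesis hm : forall dl : R, dl < 1 -> exists r, [/\ dl < r, r < 1 &
  m * (1 - r) <= fine (mu `[r, 1%R[%classic) * elog r].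

Let hilbert_test_derivative (N : nat) (r : R) : (0 < N)%N -> 2^-1 <= r -> r < 1 ->
  (N ^ 2)%:R * (1 - r) <= 2^-1 -> elog r <= 4 * ln N%:R ->
  m * (1 - r) <= fine (mu `[r, 1%R[%classic) * elog r ->
  m / 64 <= cabs (derive1 (hilbert_op mu (test_fun N)) (rtoC r)) * (1 - cabs (rtoC r) ^+ 2).
Proof.
move=> N0 r2 r1 hN hl hmr.
have r0 : 0 <= r by lra.
have bt := log_poly_bloch (R := R) (block N) (N ^ 2).
have z1 : cabs (rtoC r) < 1 by rewrite cabs_rtoC ger0_norm.
have [_ ->] := has_cderivP (hilbert_op_has_cderiv hM0 bt z1).
rewrite cabs_rtoC ger0_norm//.
have m01 : measurable (`[0, 1%R[%classic : set (measurableTypeR R)) by exact: measurable_itv.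
have mI : measurable (`[r, 1%R[%classic : set (measurableTypeR R)) by exact: measurable_itv.
pose F (t : R) := test_fun N (rtoC t) * (rtoC t * (1 - rtoC t * rtoC r)^-1 ^+ 2).
rewrite -[X in cabs X]/(cintegral mu `[0, 1%R[ F); set c := cintegral _ _ _.
have iF : cintegrable mu `[0, 1%R[ F.
  exact: (cintegrable_kernel2 m01 (@subset_refl _ _) (bloch_cintegrable hM0 bt) z1).
have FE t : 0 <= t < 1 -> exists2 x : R, test_fun N (rtoC t) = rtoC x & 0 <= x /\
    Re (F t) = x * (t * (1 - t * r)^-1 ^+ 2).
  move=> t01; have [x xE x0] := test_fun_real N t01; exists x => //; split => //.
  by rewrite /F xE -rtoC1 -rtoCM -rtoCB -rtoCV -rtoCX -!rtoCM.
(* For [t] in [[r, 1)] one has [t >= r] and [1 - t r <= 1 - r^2], so the derivative of the kernel is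
   smallest at [t = r]. *)
pose kap := ln N%:R / 4 * (r * (1 - r ^+ 2)^-1 ^+ 2).
have lN : 0 <= ln N%:R :> R by rewrite ln_ge0// ler1n.
have r2p : 0 < 1 - r ^+ 2 by rewrite subr_gt0 expr_lt1.
have Re_ge0 t : 0 <= t < 1 -> 0 <= Re (F t).
  move=> /[dup] t01 /andP[t0 t1]; have [x _ [x0 ->]] := FE t t01.
  by rewrite mulr_ge0// mulr_ge0// sqr_ge0.
have Re_gek t : r <= t < 1 -> kap <= Re (F t).
  move=> /andP[rt t1]; have t01 : 0 <= t < 1 by rewrite t1 (le_trans r0).
  have [x xE [x0 ->]] := FE t t01; have [y yE yl] := test_fun_ge N0 r0 rt t1 hN.
  have xy : x = y by move: xE; rewrite yE => /(@complexI _).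
  have tr : 0 < 1 - t * r by nra.
  rewrite xy /kap; apply: ler_pM => //; [exact: divr_ge0|by rewrite mulr_ge0 ?sqr_ge0|].
  apply: ler_pM => //; first exact: sqr_ge0.
  rewrite lerXn2r ?nnegrE ?invr_ge0 ?(ltW tr) ?(ltW r2p)//.
  by rewrite lef_pV2 ?posrE//; nra.
have kapm : kap * fine (mu `[r, 1%R[%classic) <= cabs c.
  rewrite (le_trans _ (Re_le_cabs c))// (le_trans _ (ler_norm _))//.
  have [iR _] := iF; have r01 : 0 <= r < 1 by rewrite r0.
  rewrite /c /= (Rintegral_unit_split r01)// -[leLHS]addr0; apply: lerD.
    rewrite -Rintegral_cst//; apply: le_Rintegral => //.
    - exact: finite_measure_integrable_cst.
    - apply: integrableS iR => // t /=; rewrite !in_itv/= => /andP[rt ->].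
      by rewrite (le_trans r0).
  apply: Rintegral_ge0 => t /=; rewrite in_itv/= => /andP[t0 tr].
  by apply: Re_ge0; rewrite t0 (lt_trans tr).
apply: (@le_trans _ _ (kap * fine (mu `[r, 1%R[%classic) * (1 - r ^+ 2))); last first.
  by rewrite ler_wpM2r// ltW.
have f0 : 0 <= fine (mu `[r, 1%R[%classic) by rewrite fine_ge0.
set f := fine _ in f0 hmr *.
have x0 : 0 < 1 - r by lra.
have e1 : kap * f * (1 - r ^+ 2) = ln N%:R / 4 * f * (r / (1 + r)) * (1 - r)^-1.
  rewrite /kap; have -> : 1 - r ^+ 2 = (1 - r) * (1 + r) by ring.
  by field; rewrite !gt_eqF//; lra.
rewrite e1 -[leLHS]divr1 -[leLHS]mulr1 ler_pdivlMr//.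
have h1 : f * elog r <= f * (4 * ln N%:R) by rewrite ler_wpM2l.
have h2 : 4^-1 <= r / (1 + r) by rewrite ler_pdivlMr; lra.
have h3 : 0 <= ln N%:R / 4 * f by rewrite mulr_ge0// divr_ge0.
have h4 : ln N%:R / 4 * f * 4^-1 <= ln N%:R / 4 * f * (r / (1 + r)) by rewrite ler_wpM2l.
by rewrite divr1 mulr1; move: h1 h4 hmr; move: (ln _) (_ / (1 + r)) => *; nra.
Qed.

Let exists_test (N0 : nat) : exists2 N, (N0 <= N)%N & exists2 z : Cplx R, cabs z < 1 &
  m / 64 <= cabs (derive1 (hilbert_op mu (test_fun N)) z) * (1 - cabs z ^+ 2).
Proof.
have [dl /andP[dl2 dl1] hdl] := @exists_degree R (maxn 1 N0).
have [r [dr r1 hr]] := hm dl1.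
have [N N0N [h1 h2]] := hdl r dr r1.
have /andP[Np NN0] : (0 < N)%N && (N0 <= N)%N by rewrite -geq_max.
have r0 : 2^-1 <= r by lra.
exists N => //; exists (rtoC r); first by rewrite cabs_rtoC ger0_norm//; lra.
exact: hilbert_test_derivative.
Qed.

Let test_seq : exists (N : nat -> nat) (z : nat -> Cplx R),
  [/\ forall i, (N i ^ 2 <= N i.+1)%N, forall i, (0 < N i)%N, forall i, cabs (z i) < 1 &
   forall i, m / 64 <= cabs (derive1 (hilbert_op mu (test_fun (N i))) (z i)) * (1 - cabs (z i) ^+ 2)].
Proof.
have /choice[F hF] : forall N0, exists N, (N0 <= N)%N /\ exists2 z : Cplx R, cabs z < 1 &
    m / 64 <= cabs (derive1 (hilbert_op mu (test_fun N)) z) * (1 - cabs z ^+ 2).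
  by move=> N0; have [N h1 h2] := exists_test N0; exists N.
(* Each new degree is at least the square of the previous one, which makes the blocks disjoint;
   starting from [F 1] keeps all of them positive. *)
pose N i := iter i (fun k => F (k ^ 2)%N) (F 1%N).
have hN i : exists z : Cplx R, cabs z < 1 /\
    m / 64 <= cabs (derive1 (hilbert_op mu (test_fun (N i))) z) * (1 - cabs z ^+ 2).
  by case: i => [|i]; [have [_ [z ? ?]] := hF 1%N|have [_ [z ? ?]] := hF (N i ^ 2)%N]; exists z.
have /choice[z hz] := hN.
exists N, z; split => [i|i|i|i]; [exact: (hF (N i ^ 2)%N).1| |exact: (hz i).1|exact: (hz i).2].
elim: i => [|i IH]; first exact: (hF 1%N).1.
by apply: leq_trans (hF (N i ^ 2)%N).1; rewrite expn_gt0 IH.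
Qed.

Lemma bloch_norm_cvg0_near (v : nat -> Cplx R -> Cplx R) (e : R) : 0 < e ->
  (fun n => nnorm bloch (v n)) @ \oo --> 0%E ->
  \forall n \near \oo, (nnorm bloch (v n) <= e%:E)%E.
Proof.
move=> e0 /fine_cvgP[hf hc]; have hlt : \forall n \near \oo, fine (nnorm bloch (v n)) < e by exact: cvgr_lt hc _ e0.
apply: filterS2 hf hlt => n hfin hn.
by rewrite -(fineK hfin) lee_fin ltW.
Qed.

(* Sums of the test functions along any subsequence stay in the unit ball, since the
   blocks are disjoint; so their averages, and hence the images of these, tend to [0]. *)
Let compact_limit_eq0 (S : (Cplx R -> Cplx R) -> Cplx R -> Cplx R) (N s : nat -> nat) g :
  (forall i, (N i ^ 2 <= N i.+1)%N) -> (forall i, (0 < N i)%N) ->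
  {homo s : a b / (a < b)%N} ->
  linear_operator bloch bloch S -> compact_operator bloch bloch S ->
  carrier bloch g ->
  (fun n => nnorm bloch (S (test_fun (N (s n))) - g)) @ \oo --> 0%E ->
  forall z, cabs z < 1 -> derive1 g z = 0.
Proof.
move=> NS N0 hs [SB Slin] Scpt bg Sg z z1.
pose u j := test_fun (R := R) (N (s j)).
have bu j : carrier bloch (u j) by exact: log_poly_bloch.
have NN i : (N i <= N i ^ 2)%N by rewrite -{1}[N i]expn1 leq_pexp2l.
have Nmono i j : (i <= j)%N -> (N i <= N j)%N.
  move=> ij; rewrite -(subnK ij); elim: (j - i)%N => // k IH.
  by rewrite addSn (leq_trans IH)// (leq_trans (NN _)).
have Ns J : (N (s J) ^ 2 <= N (s J.+1))%N.
  by rewrite (leq_trans (NS _))// Nmono// hs.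
pose v J : Cplx R -> Cplx R := \sum_(0 <= j < J) u j.
(* A partial sum of test functions is again a [log_poly], for the union of the blocks, so its Bloch
   norm is still at most 1. Keeping all exponents below [N (s J)] ensures that the next block is
   disjoint from them. *)
have vE J : exists2 B : pred nat, (forall k, B k -> (k < N (s J))%N) & v J = log_poly B (N (s J)).
  elim: J => [|J [B BN IH]].
    exists pred0 => //; rewrite /v big_nil; apply/funext => w.
    rewrite /log_poly /poly_disc; case: ifP => // _; rewrite big1// => k _.
    by rewrite /log_coef /= rtoC0 mul0r.
  exists (fun k => B k || block (N (s J)) k).
    move=> k /orP[/BN kN|/andP[_ kN]]; last exact: leq_trans kN (Ns J).
    by rewrite (leq_trans kN)// (leq_trans (NN _)).
  rewrite /v big_nat_recr//= -/(v J) IH.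
  have -> : u J = log_poly (block (N (s J))) (N (s J.+1)).
    have AK k : pred0 k -> (k < 0)%N by [].
    have h0 K : log_poly (R := R) pred0 K = 0.
      apply/funext => w; rewrite /log_poly /poly_disc; case: ifP => // _.
      by rewrite big1// => k _; rewrite /log_coef /= rtoC0 mul0r.
    have := @log_poly_add R (block (N (s J))) pred0 _ _ (Ns J) (fun k h => (andP h).2) (fun _ _ => isT).
    rewrite h0 addr0 => e; rewrite /u /test_fun e; congr (log_poly _ _); apply/funext => k.
    by rewrite orbF.
  rewrite log_poly_add//; first exact: leq_trans (NN _) (Ns J).
  by move=> k /BN; rewrite /block ltnNge => /negbTE ->.
have bv J : carrier bloch (v J) by have [B _ ->] := vE J; exact: log_poly_bloch.
have v1 J : (nnorm bloch (v J) <= 1%:E)%E by have [B _ ->] := vE J; exact: log_poly_bloch_norm.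
have S0 : S 0 = 0.
  have b0 : carrier bloch (0 : Cplx R -> Cplx R) by have := bv 0%N; rewrite /v big_nil.
  by have := Slin (-1) 0 0 b0 b0; rewrite scaler0 addr0 scaleN1r addNr.
have dS f : carrier bloch f -> has_cderiv (S f) z (derive1 (S f) z).
  by move=> bf; apply: analytic_has_cderiv => //; have [] := SB _ bf.
pose X j := derive1 (S (u j)) z.
have dSv J : derive1 (S (v J)) z = \sum_(0 <= j < J) X j.
  elim: J => [|J IH].
    rewrite /v !big_nil S0; have h0 : has_cderiv (0 : Cplx R -> Cplx R) z 0.
      by move=> e e0; exists 1 => // w _; rewrite !subr0 mul0r subr0 cabs0 mulr_ge0 ?cabs_ge0// ltW.
    by have [] := has_cderivP h0.
  rewrite big_nat_recr//= -IH.
  have -> : v J.+1 = 1 *: v J + u J by rewrite (scale1r (v J)) /v big_nat_recr.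
  rewrite (Slin 1 (v J) (u J) (bv J) (bu J)).
  have [_ ->] := has_cderivP (has_cderiv_linear 1 (dS _ (bv J)) (dS _ (bu J))).
  by rewrite mul1r.
set x := derive1 g z.
have dg : has_cderiv g z x by apply: analytic_has_cderiv => //; case: bg.
have w0 : 0 < 1 - cabs z ^+ 2 by rewrite subr_gt0 cabs_lt1_sqr.
have Xx : cabs (X n - x) @[n --> \oo] --> (0 : R).
  apply/cvgrPdist_le => e e0.
  have ew : 0 < e * (1 - cabs z ^+ 2) by rewrite mulr_gt0.
  have := bloch_norm_cvg0_near ew Sg; apply: filterS => n hn.
  rewrite sub0r normrN ger0_norm ?cabs_ge0// -(ler_pM2r w0) -lee_fin; apply: le_trans hn.
  apply: le_trans (derivative_le_bloch_norm _ z1); rewrite lee_fin.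
  by have [_ ->] := has_cderivP (has_cderivB (dS _ (bu n)) dg).
(* Compactness is applied a second time, to the partial sums: along a subsequence their images
   converge, so the sums of [X j] are eventually bounded by a constant [C]. The shift to [J.+1]
   matches the indexing of [arithmetic_mean]. *)
have [s' [h [hs' bh Sh]]] := Scpt (fun J => v J.+1) 1 (fun J => conj (bv J.+1) (v1 J.+1)).
have dh : has_cderiv h z (derive1 h z) by apply: analytic_has_cderiv => //; case: bh.
apply/cabs_eq0/eqP; rewrite eq_le cabs_ge0 andbT; apply/ler_addgt0Pr => e e0; rewrite add0r.
have [C hC] : exists C, \forall i \near \oo, cabs (\sum_(0 <= j < (s' i).+1) X j) <= C.
  exists ((1 + cabs (derive1 h z) * (1 - cabs z ^+ 2)) / (1 - cabs z ^+ 2)).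
  have := bloch_norm_cvg0_near ltr01 Sh; apply: filterS => i hi.
  rewrite ler_pdivlMr// -dSv.
  have := le_trans (derivative_le_bloch_norm _ z1) hi; rewrite lee_fin.
  have [_ ->] := has_cderivP (has_cderivB (dS _ (bv (s' i).+1)) dh).
  set y := derive1 (S _) z; have : cabs y - cabs (derive1 h z) <= cabs (y - derive1 h z) by exact: cabs_le_sub.
  move=> h1 h2; have := ler_wpM2r (ltW w0) h1; rewrite mulrBl lerBlDr => h3.
  by apply: le_trans h3 _; rewrite lerD2r.
(* The averages of [|X j - x|] tend to 0, and the bounded sums of [X j] divided by their number of
   terms do as well; [cabs_mean_le] then forces [x = 0]. *)
have ces := cesaro Xx.
have ces' := @cvg_subseq _ _ _ _ hs' ces.
have e2 : 0 < e / 2 by rewrite divr_gt0.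
have n1 : \forall i \near \oo, arithmetic_mean (fun n => cabs (X n - x)) (s' i) < e / 2.
  exact: cvgr_lt ces' _ e2.
have n2 : \forall i \near \oo, C / i.+1%:R < e / 2.
  have hc : C / i.+1%:R @[i --> \oo] --> (0 : R).
    by rewrite -[X in _ --> X](mulr0 C); apply: cvgM; [exact: cvg_cst|exact: cvg_harmonic].
  exact: cvgr_lt hc _ e2.
have C0 : 0 <= C.
  have [i _ /(_ i (leqnn i)) hi] := hC; exact: le_trans (cabs_ge0 _) hi.
have [i _ /(_ i (leqnn i)) [[hi1 hi2] hi3]] := filterI (filterI n1 n2) hC.
move: hi1 hi3; rewrite /arithmetic_mean /series /=; set J := (s' i).+1 => hi1 hi3.
have iJ : (i.+1 <= J)%N by rewrite ltnS; exact: increasing_seq_ge hs' i.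
have J0 : 0 < J%:R :> R by rewrite ltr0n.
have hCJ : C / J%:R <= C / i.+1%:R by rewrite ler_wpM2l// lef_pV2 ?posrE ?ltr0n// ler_nat.
have xJ := cabs_mean_le X x J.
have : cabs x <= J%:R^-1 * \sum_(0 <= j < J) cabs (X j - x) + C / J%:R.
  rewrite -(ler_pM2l J0) (le_trans xJ)// mulrDr mulVKf ?gt_eqF// lerD2l.
  by rewrite mulrCA mulfV ?gt_eqF// mulr1.
move=> hx; apply: le_trans hx _; rewrite (splitr e); apply: lerD; first exact: ltW.
exact: le_trans hCJ (ltW hi2).
Qed.

(** Along the extracted subsequence the derivative of [S f] is small in the Bloch weight, because
    the limit [g] has zero derivative, while that of [hilbert_op mu f] is at least [m / 64] at the
    test point. *)
Lemma essential_norm_lower :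
  ((m / 64)%:E <= essential_norm bloch bloch (hilbert_op mu))%E.
Proof.
apply: le_ereal_inf_tmp => _ [S [Slin Scpt] <-].
have [N [z [NS N0 z1 hz]]] := test_seq.
have [s [g [hs bg Sg]]] := Scpt (fun i => test_fun (N i)) 1
  (fun i => conj (log_poly_bloch (block (N i)) (N i ^ 2)) (log_poly_bloch_norm (block (N i)) (N i ^ 2))).
have g0 := compact_limit_eq0 NS N0 hs Slin Scpt bg Sg.
apply/lee_addgt0Pr => e e0.
have [n _ /(_ n (leqnn n)) hn] := bloch_norm_cvg0_near e0 Sg.
set f := test_fun (N (s n)) in hn.
have bf : carrier bloch f by exact: log_poly_bloch.
have f1 : (nnorm bloch f <= 1%:E)%E by exact: log_poly_bloch_norm.
set w := z (s n); have w1 : cabs w < 1 by exact: z1.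
have dT : has_cderiv (hilbert_op mu f) w (derive1 (hilbert_op mu f) w).
  by apply: analytic_has_cderiv => //; exact: hilbert_op_analytic hM0 _ bf.
have [SB _] := Slin.
have dS : has_cderiv (S f) w (derive1 (S f) w).
  by apply: analytic_has_cderiv => //; have [] := SB _ bf.
have dg : has_cderiv g w 0.
  by rewrite -(g0 w w1); apply: analytic_has_cderiv => //; case: bg.
have w0 : 0 < 1 - cabs w ^+ 2 by rewrite subr_gt0 cabs_lt1_sqr.
have hS : cabs (derive1 (S f) w) * (1 - cabs w ^+ 2) <= e.
  have := le_trans (derivative_le_bloch_norm _ w1) hn; rewrite lee_fin.
  by have [_ ->] := has_cderivP (has_cderivB dS dg); rewrite subr0.
have hT : m / 64 <= cabs (derive1 (hilbert_op mu f) w) * (1 - cabs w ^+ 2) by exact: hz.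
apply: (@le_trans _ _ (nnorm bloch (hilbert_op mu f - S f) + e%:E)%E); last first.
  by rewrite leeD2r//; apply: ereal_sup_ubound; exists f.
apply: (@le_trans _ _ ((m / 64 - e)%:E + e%:E)%E); first by rewrite -EFinD lee_fin subrK.
rewrite leeD2r//; apply: le_trans (derivative_le_bloch_norm _ w1); rewrite lee_fin.
have [_ ->] := has_cderivP (has_cderivB dT dS).
have := ler_wpM2r (ltW w0) (cabs_le_sub (derive1 (hilbert_op mu f) w) (derive1 (S f) w)).
by rewrite mulrBl; apply: le_trans; exact: lerB.
Qed.

End LowerBound.

(** * The limsup of the Carleson ratio and the conclusion *)

Lemma at_leftP {R : realType} (x : R) (A : set R) :
  (x^'-) A <-> exists2 d : R, 0 < d & forall s, x - d < s -> s < x -> A s.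
Proof.
split.
  move=> /nbhs_ballP[d /= d0 hd]; exists d => // s s1 s2; apply: hd => //.
  by rewrite -ball_normE /= ger0_norm ?subr_ge0 ?(ltW s2)//; lra.
move=> [d d0 hd]; apply/nbhs_ballP; exists d => // s.
rewrite -ball_normE /= ltr_norml => /andP[_ h] sx; apply: hd => //; lra.
Qed.

Section CarlesonLimsup.
Context {R : realType}.
Variable mu : {finite_measure set (measurableTypeR R) -> \bar R}.

Let ratio (r : R) : \bar R := (mu `[r, 1%R[%classic * (ln (expR 1 / (1 - r)) / (1 - r))%:E)%E.

Let ratioE r : ratio r = (fine (mu `[r, 1%R[%classic) * (elog r / (1 - r)))%:E.
Proof. by rewrite /ratio /elog [RHS]EFinM fineK// fin_num_measure. Qed.

Lemma carleson_at_limsup (l : R) : (carleson_limsup mu < l%:E)%E ->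
  exists2 r, 0 <= r < 1 & carleson_at mu r l.
Proof.
rewrite /carleson_limsup /limf_esup => /ereal_inf_lt[_ [A A1 <-] Al].
have /at_leftP[d d0 hd] := A1.
(* The neighbourhood only contains the open interval [(1 - d, 1)], so the left end is moved to
   [1 - d / 2]; the maximum with 0 keeps it in [[0, 1)]. *)
have r1 : Num.max 0 (1 - d / 2) < 1 by rewrite gt_max ltr01/=; lra.
exists (Num.max 0 (1 - d / 2)); first by rewrite r1 le_max lexx.
move=> s rs s1.
have s2 : 1 - d < s by move: rs; rewrite ge_max => /andP[_ h]; lra.
have : (ratio s < l%:E)%E.
  by apply: le_lt_trans Al; apply: ereal_sup_ubound; exists s => //; exact: hd.
rewrite ratioE lte_fin mulrA ltr_pdivrMr ?subr_gt0//; exact: ltW.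
Qed.

Lemma carleson_limsup_gt (l : R) : (l%:E < carleson_limsup mu)%E ->
  forall dl : R, dl < 1 -> exists r, [/\ dl < r, r < 1 &
    l * (1 - r) <= fine (mu `[r, 1%R[%classic) * elog r].
Proof.
move=> hl dl dl1.
have : (l%:E < ereal_sup [set ratio r | r in `]dl, 1%R[%classic])%E.
  apply: lt_le_trans hl _; apply: ereal_inf_lbound.
  exists (`]dl, 1%R[%classic : set R) => //.
  apply/at_leftP; exists (1 - dl) => [|r]; first by rewrite subr_gt0.
  by rewrite opprB addrC subrK /= in_itv/= => -> ->.
move=> /ereal_sup_gt[_ [r /= rI <-]].
move: rI; rewrite in_itv/= => /andP[dr r1].
rewrite ratioE lte_fin mulrA ltr_pdivlMr ?subr_gt0// => h.
by exists r; split => //; exact: ltW.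
Qed.

Lemma carleson_limsup_fin : log_carleson mu ->
  exists2 l : R, 0 <= l & carleson_limsup mu = l%:E.
Proof.
move=> /log_carleson_at[M0 M00 h0].
have r0 r : 0 < r -> r < 1 -> (0 <= ratio r <= M0%:E)%E.
  move=> r0 r1; rewrite ratioE !lee_fin mulrA ler_pdivrMr ?subr_gt0// h0 ?(ltW r0)// andbT.
  rewrite divr_ge0 ?subr_ge0 ?(ltW r1)// mulr_ge0 ?fine_ge0//.
  by rewrite (le_trans _ (@elog_ge1 _ r _))// (ltW r0).
have lim0 : (0 <= carleson_limsup mu)%E.
  apply: le_ereal_inf_tmp => _ [A A1 <-].
  have : (at_left (1 : R) (A `&` `]0, 1%R[%classic)).
    apply: filterI => //; apply/at_leftP; exists 1 => // r.
    by rewrite subrr /= in_itv/= => -> ->.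
  move=> /filter_ex[r [Ar /=]]; rewrite in_itv/= => /andP[p1 p2].
  have /andP[h _] := r0 r p1 p2; apply: le_trans h _.
  by apply: ereal_sup_ubound; exists r.
have limM : (carleson_limsup mu <= M0%:E)%E.
  apply: ge_ereal_inf; exists (ereal_sup [set ratio r | r in `]0, 1%R[%classic]).
    exists (`]0, 1%R[%classic : set R) => //.
    apply/at_leftP; exists 1 => // r.
    by rewrite subrr /= in_itv/= => -> ->.
  apply: ge_ereal_sup => _ [r /= rI <-].
  by move: rI; rewrite in_itv/= => /andP[p1 p2]; have /andP[] := r0 r p1 p2.
exists (fine (carleson_limsup mu)); first by rewrite fine_ge0.
by rewrite fineK// ge0_fin_numE// (le_lt_trans limM)// ltry.
Qed.

End CarlesonLimsup.

Theorem theorem4p3 (R : realType) :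
  exists C : R, 0 < C /\
    forall mu : {finite_measure set (measurableTypeR R) -> \bar R},
      mu (~` `[0, 1[%classic) = 0%E ->
      log_carleson mu ->
      comparable_with C (essential_norm bloch bloch (hilbert_op mu))
                        (essential_norm bloch bmoa (hilbert_op mu)) /\
      comparable_with C (essential_norm bloch bmoa (hilbert_op mu))
                        (carleson_limsup mu).
Proof.
(* Everything follows from the chain of [l / 64], the Bloch-to-Bloch norm, the Bloch-to-BMOA norm
   and [640 * l], each at most the next; the constant is the ratio of its ends. *)
exists (64 * 640); split; first lra.
move=> mu _ lc; have [M0 M00 h0] := log_carleson_at lc.
have [l l0 El] := carleson_limsup_fin lc; rewrite El.
have upper : (essential_norm bloch bmoa (hilbert_op mu) <= (640 * l)%:E)%E.
  apply/lee_addgt0Pr => e e0.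
  have /carleson_at_limsup[r r01 hr] : (carleson_limsup mu < (l + e / 640)%:E)%E.
    by rewrite El lte_fin; lra.
  apply: le_trans (essential_norm_upper h0 r01 hr) _.
  by rewrite -EFinD lee_fin; lra.
have lower : ((l / 64)%:E <= essential_norm bloch bloch (hilbert_op mu))%E.
  apply/lee_addgt0Pr => e e0.
  (* The strict inequality costs [64 * e], which becomes exactly [e] after division by 64. For
     [l = 0] the lower level is negative, and [essential_norm_lower] accepts any real [m]. *)
  have hl : ((l - 64 * e)%:E < carleson_limsup mu)%E.
    by rewrite El lte_fin; lra.
  have := essential_norm_lower h0 (carleson_limsup_gt hl) => h.
  apply: (@le_trans _ _ (((l - 64 * e) / 64)%:E + e%:E)%E); last by rewrite leeD2r.
  by rewrite -EFinD lee_fin; lra.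
have mid := essential_norm_bloch_le_bmoa h0.
move: upper lower mid.
set x := essential_norm bloch bloch _; set y := essential_norm bloch bmoa _.
move: x y => [x| |] [y| |]//; rewrite /comparable_with -!EFinM !lee_fin => *.
by split; split; rewrite ?lee_fin; lra.
Qed.
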